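(* Let $\mathcal C$ be an integral modular fusion category (over $\mathbb C$) with $\mathrm{FPdim}(\mathcal C)=dm$, where $d$ is a square-free positive integer coprime with $m$. Then $d\mid\mathrm{FPdim}(\mathcal C_{pt})$ and $\mathcal C$ admits a decomposition $$\mathcal C\simeq\mathcal D\boxtimes\mathcal D',$$ where $\mathcal D$ is a pointed modular fusion category of dimension $d$ and $\mathcal D'$ is a modular fusion category of dimension $m$.
   Context: $\mathrm{FPdim}$ is the Frobenius–Perron dimension; integral means $\mathrm{FPdim}(X)\in\mathbb Z$ for every simple object $X$. $\mathcal C_{pt}$ is the maximal pointed fusion subcategory, generated by the invertible simple objects; pointed means all simple objects are invertible. $\boxtimes$ is the Deligne tensor product, and $\simeq$ is equivalence of braided fusion categories. *)

(* Defs.v *)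
(* For [R : realType], the ground field is [R[i]], the complex numbers over R.
   The categorical notions follow Etingof, Gelaki, Nikshych and Ostrik,
   "Tensor categories". *)
From HB Require Import structures.
From mathcomp Require Import all_boot all_order all_algebra.
From mathcomp Require Import all_classical all_reals.
From mathcomp Require Import complex.

Set Implicit Arguments.
Unset Strict Implicit.
Unset Printing Implicit Defensive.

Import Order.TTheory GRing.Theory Num.Theory.
Local Open Scope classical_set_scope.
Local Open Scope ring_scope.

Definition squarefree (d : nat) : Prop := forall p, prime p -> ~~ (p ^ 2 %| d)%N.

Declare Scope cat_scope.
Delimit Scope cat_scope with cat.
Local Open Scope cat_scope.

Reserved Notation "g ∘ f" (at level 40, left associativity).
Reserved Notation "X ⊗ Y" (at level 38, left associativity).
Reserved Notation "f ⊛ g" (at level 38, left associativity).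

Section LinearCategories.
Context {R : realType}.
Notation K := (R[i]%C).

Record linCat := LinCat {
  ob :> Type;
  hom : ob -> ob -> lmodType K;
  idm : forall X, hom X X;
  comp : forall X Y Z, hom Y Z -> hom X Y -> hom X Z;
  compA : forall W X Y Z (h : hom Y Z) (g : hom X Y) (f : hom W X),
    comp h (comp g f) = comp (comp h g) f;
  comp1m : forall X Y (f : hom X Y), comp (idm Y) f = f;
  compm1 : forall X Y (f : hom X Y), comp f (idm X) = f;
  comp_linl : forall X Y Z (a : K) (g g' : hom Y Z) (f : hom X Y),
    comp (a *: g + g') f = a *: comp g f + comp g' f;
  comp_linr : forall X Y Z (a : K) (g : hom Y Z) (f f' : hom X Y),
    comp g (a *: f + f') = a *: comp g f + comp g f' }.

Arguments idm {l} X.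
Notation "g ∘ f" := (comp g f) : cat_scope.

Section InACategory.
Context {A : linCat}.

Definition inverse_to (X Y : A) (f : hom X Y) (g : hom Y X) : Prop :=
  g ∘ f = idm X /\ f ∘ g = idm Y.

Definition is_iso (X Y : A) (f : hom X Y) : Prop := exists g, inverse_to f g.

Definition isomorphic (X Y : A) : Prop := exists f : hom X Y, is_iso f.

Definition is_mono (X Y : A) (f : hom X Y) : Prop :=
  forall W (g h : hom W X), f ∘ g = f ∘ h -> g = h.

Definition is_epi (X Y : A) (f : hom X Y) : Prop :=
  forall Z (g h : hom Y Z), g ∘ f = h ∘ f -> g = h.

Definition is_ker (X Y : A) (f : hom X Y) (N : A) (k : hom N X) : Prop :=
  f ∘ k = 0 /\
  forall W (g : hom W X), f ∘ g = 0 -> exists! h : hom W N, k ∘ h = g.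

Definition is_coker (X Y : A) (f : hom X Y) (Q : A) (c : hom Y Q) : Prop :=
  c ∘ f = 0 /\
  forall Z (g : hom Y Z), g ∘ f = 0 -> exists! h : hom Q Z, h ∘ c = g.

Definition is_direct_sum (n : nat) (F : 'I_n -> A) (X : A) : Prop :=
  exists (inj : forall i, hom (F i) X) (prj : forall i, hom X (F i)),
    [/\ forall i, prj i ∘ inj i = idm (F i),
        forall i j, i != j -> prj i ∘ inj j = 0
      & \sum_(i < n) inj i ∘ prj i = idm X].

Definition simple (X : A) : Prop :=
  idm X <> 0 /\
  forall Y (f : hom Y X), is_mono f -> f = 0 \/ is_iso f.

(* [s] lists the simple objects, one for each isomorphism class. *)
Definition simple_reps (n : nat) (s : 'I_n -> A) : Prop :=
  [/\ forall i, simple (s i),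
      forall X, simple X -> exists i, isomorphic X (s i)
    & forall i j, isomorphic (s i) (s j) -> i = j].

End InACategory.

(* The case n = 0 of finite direct sums provides a zero object. *)
Record abelian (A : linCat) : Prop := {
  abelian_dsum : forall n (F : 'I_n -> A), exists X, is_direct_sum F X;
  abelian_ker : forall (X Y : A) (f : hom X Y),
    exists (N : A) (k : hom N X), is_ker f k;
  abelian_coker : forall (X Y : A) (f : hom X Y),
    exists (Q : A) (c : hom Y Q), is_coker f c;
  abelian_mono : forall (X Y : A) (f : hom X Y), is_mono f ->
    exists (Z : A) (g : hom Y Z), is_ker g f;
  abelian_epi : forall (X Y : A) (f : hom X Y), is_epi f ->
    exists (W : A) (g : hom W X), is_coker g f }.

Definition semisimple (A : linCat) : Prop :=
  forall X : A, exists n (F : 'I_n -> A),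
    (forall i, simple (F i)) /\ is_direct_sum F X.

Definition has_dim (V : lmodType K) (n : nat) : Prop :=
  exists f : {linear V -> 'rV[K]_n}, bijective f.

(* The dimension of V, with value 0 when V is not finite-dimensional. *)
Definition vdim (V : lmodType K) : nat := xget 0%N [set n | has_dim V n].

Record linFun (A B : linCat) := LinFun {
  fob :> A -> B;
  fmap : forall X Y, hom X Y -> hom (fob X) (fob Y);
  fmap1 : forall X, fmap (idm X) = idm (fob X);
  fmapM : forall X Y Z (g : hom Y Z) (f : hom X Y),
    fmap (g ∘ f) = fmap g ∘ fmap f;
  fmap_lin : forall X Y (a : K) (f f' : hom X Y),
    fmap (a *: f + f') = a *: fmap f + fmap f' }.

Record bifun (A B C : linCat) := Bifun {
  bob :> A -> B -> C;
  bmap : forall X X' Y Y', hom X X' -> hom Y Y' -> hom (bob X Y) (bob X' Y');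
  bmap1 : forall X Y, bmap (idm X) (idm Y) = idm (bob X Y);
  bmapM : forall X X' X'' Y Y' Y'' (f' : hom X' X'') (f : hom X X')
      (g' : hom Y' Y'') (g : hom Y Y'),
    bmap (f' ∘ f) (g' ∘ g) = bmap f' g' ∘ bmap f g;
  bmap_linl : forall X X' Y Y' (a : K) (f f' : hom X X') (g : hom Y Y'),
    bmap (a *: f + f') g = a *: bmap f g + bmap f' g;
  bmap_linr : forall X X' Y Y' (a : K) (f : hom X X') (g g' : hom Y Y'),
    bmap f (a *: g + g') = a *: bmap f g + bmap f g' }.

Definition equivalence (A B : linCat) (F : linFun A B) : Prop :=
  exists (G : linFun B A)
         (u : forall X, hom X (G (F X))) (v : forall Y, hom (F (G Y)) Y),
    [/\ forall X, is_iso (u X),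
        forall X X' (f : hom X X'), u X' ∘ f = fmap G (fmap F f) ∘ u X,
        forall Y, is_iso (v Y)
      & forall Y Y' (g : hom Y Y'), v Y' ∘ fmap F (fmap G g) = g ∘ v Y].

Definition right_exact (A B : linCat) (F : linFun A B) : Prop :=
  forall (X Y Q : A) (f : hom X Y) (c : hom Y Q),
    is_coker f c -> is_coker (fmap F f) (fmap F c).

Definition right_exact2 (A B C : linCat) (F : bifun A B C) : Prop :=
  (forall (X Y Q : A) (f : hom X Y) (c : hom Y Q) (Z : B),
     is_coker f c -> is_coker (bmap F f (idm Z)) (bmap F c (idm Z))) /\
  (forall (Z : A) (X Y Q : B) (f : hom X Y) (c : hom Y Q),
     is_coker f c -> is_coker (bmap F (idm Z) f) (bmap F (idm Z) c)).

(* B exhibits E as the Deligne tensor product of C and D: for every abelian A,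
   composition with B is an equivalence from right exact functors E -> A to
   bilinear functors C x D -> A right exact in each variable; the second and
   third clauses are essential surjectivity and full faithfulness. *)
Definition is_deligne_product (C D E : linCat) (B : bifun C D E) : Prop :=
  [/\ right_exact2 B,
      forall (A : linCat), abelian A ->
      forall F : bifun C D A, right_exact2 F ->
        exists (G : linFun E A) (t : forall X Y, hom (G (B X Y)) (F X Y)),
          [/\ right_exact G, forall X Y, is_iso (t X Y)
            & forall X X' Y Y' (f : hom X X') (g : hom Y Y'),
                t X' Y' ∘ fmap G (bmap B f g) = bmap F f g ∘ t X Y]
    & forall (A : linCat), abelian A ->
      forall G G' : linFun E A, right_exact G -> right_exact G' ->
      forall t : forall X Y, hom (G (B X Y)) (G' (B X Y)),
        (forall X X' Y Y' (f : hom X X') (g : hom Y Y'),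
           t X' Y' ∘ fmap G (bmap B f g) = fmap G' (bmap B f g) ∘ t X Y) ->
      let extends (w : forall Z, hom (G Z) (G' Z)) :=
        (forall Z Z' (f : hom Z Z'), w Z' ∘ fmap G f = fmap G' f ∘ w Z) /\
        (forall X Y, w (B X Y) = t X Y) in
      (exists w, extends w) /\
      (forall w w', extends w -> extends w' -> forall Z, w Z = w' Z)].

Record monCat := MonCat {
  mon_lin :> linCat;
  tens : bifun mon_lin mon_lin mon_lin;
  unit_ob : mon_lin;
  ass : forall X Y Z, hom (tens (tens X Y) Z) (tens X (tens Y Z));
  assV : forall X Y Z, hom (tens X (tens Y Z)) (tens (tens X Y) Z);
  lun : forall X, hom (tens unit_ob X) X;
  run : forall X, hom (tens X unit_ob) X;
  assK : forall X Y Z, inverse_to (ass X Y Z) (assV X Y Z);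
  lun_iso : forall X, is_iso (lun X);
  run_iso : forall X, is_iso (run X);
  ass_nat : forall X X' Y Y' Z Z' (f : hom X X') (g : hom Y Y') (h : hom Z Z'),
    ass X' Y' Z' ∘ bmap tens (bmap tens f g) h =
    bmap tens f (bmap tens g h) ∘ ass X Y Z;
  lun_nat : forall X X' (f : hom X X'),
    lun X' ∘ bmap tens (idm unit_ob) f = f ∘ lun X;
  run_nat : forall X X' (f : hom X X'),
    run X' ∘ bmap tens f (idm unit_ob) = f ∘ run X;
  pentagon : forall W X Y Z,
    ass W X (tens Y Z) ∘ ass (tens W X) Y Z =
    bmap tens (idm W) (ass X Y Z) ∘ ass W (tens X Y) Z
      ∘ bmap tens (ass W X Y) (idm Z);
  triangle : forall X Y,
    bmap tens (idm X) (lun Y) ∘ ass X unit_ob Y = bmap tens (run X) (idm Y) }.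

End LinearCategories.

Arguments linCat R : clear implicits.
Arguments monCat R : clear implicits.
Arguments idm {R l} X.
Arguments unit_ob {R} m.
Arguments lun {R m} X.
Arguments run {R m} X.
Arguments ass {R m} X Y Z.
Arguments assV {R m} X Y Z.

Notation "g ∘ f" := (comp g f) : cat_scope.
Notation "X ⊗ Y" := (tens _ X Y) : cat_scope.
(* The tensor product of morphisms. *)
Notation "f ⊛ g" := (bmap (tens _) f g) : cat_scope.

Section FusionCategories.
Context {R : realType}.
Notation K := (R[i]%C).

Section InAMonoidalCategory.
Context {M : monCat R}.

(* Xs is a left dual of X; equivalently, X is a right dual of Xs. *)
Definition dual_data (X Xs : M)
    (ev : hom (Xs ⊗ X) (unit_ob M)) (coev : hom (unit_ob M) (X ⊗ Xs)) : Prop :=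
  run X ∘ (idm X ⊛ ev) ∘ ass X Xs X ∘ (coev ⊛ idm X) = lun X /\
  lun Xs ∘ (ev ⊛ idm Xs) ∘ assV Xs X Xs ∘ (idm Xs ⊛ coev) = run Xs.

Definition left_dual (X Xs : M) : Prop :=
  exists ev coev, dual_data (X := X) (Xs := Xs) ev coev.

Definition invertible (X : M) : Prop :=
  exists Y, isomorphic (X ⊗ Y) (unit_ob M) /\ isomorphic (Y ⊗ X) (unit_ob M).

End InAMonoidalCategory.

Record is_fusion (M : monCat R) : Prop := {
  fusion_abelian : abelian M;
  fusion_homfin : forall X Y : M, exists n, has_dim (hom X Y) n;
  fusion_semisimple : semisimple M;
  fusion_finite : exists n (s : 'I_n -> M), simple_reps s;
  fusion_ldual : forall X : M, exists Y, left_dual X Y;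
  fusion_rdual : forall X : M, exists Y, left_dual Y X;
  fusion_unit : simple (unit_ob M) }.

(* The matrix of left multiplication by X on the Grothendieck ring, in the
   basis of simple objects: by semisimplicity the multiplicity of s j in
   X ⊗ s i is the dimension of Hom(s j, X ⊗ s i). *)
Definition fusion_mx (M : monCat R) n (s : 'I_n -> M) (X : M) : 'M[R]_n :=
  \matrix_(i, j) (vdim (hom (s j) (X ⊗ s i)))%:R.

(* The supremum is a maximum: the set is finite, and nonempty by the
   Frobenius-Perron theorem. *)
Definition max_nneg_eigenvalue n (N : 'M[R]_n) : R :=
  sup [set x | 0 <= x /\ eigenvalue N x].

(* For fusion categories, the sets below are singletons: the values do not
   depend on the choice of representatives of the simple objects. *)
Definition FPdim_ob (M : monCat R) (X : M) : R :=
  xget 0 [set x | exists n (s : 'I_n -> M),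
                    simple_reps s /\ x = max_nneg_eigenvalue (fusion_mx s X)].

Definition FPdim (M : monCat R) : R :=
  xget 0 [set x | exists n (s : 'I_n -> M),
                    simple_reps s /\ x = \sum_(i < n) FPdim_ob (s i) ^+ 2].

Definition integral_cat (M : monCat R) : Prop :=
  forall X : M, simple X -> FPdim_ob X \is a Num.int.

Definition pointed_cat (M : monCat R) : Prop :=
  forall X : M, simple X -> invertible X.

Section FullSubcategory.
Context (M : monCat R) (P : M -> Prop).
Context (P1 : P (unit_ob M)) (PM : forall X Y, P X -> P Y -> P (X ⊗ Y)).

Definition full_sub_lin : linCat R :=
  @LinCat R {X : M | P X} (fun X Y => hom (sval X) (sval Y))
    (fun X => idm (sval X)) (fun X Y Z g f => g ∘ f)
    (fun _ _ _ _ => @compA R M _ _ _ _) (fun _ _ => @comp1m R M _ _)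
    (fun _ _ => @compm1 R M _ _) (fun _ _ _ => @comp_linl R M _ _ _)
    (fun _ _ _ => @comp_linr R M _ _ _).

Definition full_sub_tens : bifun full_sub_lin full_sub_lin full_sub_lin :=
  @Bifun R full_sub_lin full_sub_lin full_sub_lin
    (fun X Y => exist P (sval X ⊗ sval Y) (PM (svalP X) (svalP Y)))
    (fun X X' Y Y' f g => f ⊛ g)
    (fun _ _ => @bmap1 _ _ _ _ (tens M) _ _)
    (fun _ _ _ _ _ _ => @bmapM _ _ _ _ (tens M) _ _ _ _ _ _)
    (fun _ _ _ _ => @bmap_linl _ _ _ _ (tens M) _ _ _ _)
    (fun _ _ _ _ => @bmap_linr _ _ _ _ (tens M) _ _ _ _).


Definition full_sub : monCat R :=
  @MonCat R full_sub_lin full_sub_tens (exist P (unit_ob M) P1)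
    (fun X Y Z => ass (sval X) (sval Y) (sval Z))
    (fun X Y Z => assV (sval X) (sval Y) (sval Z))
    (fun X => lun (sval X)) (fun X => run (sval X))
    (fun X Y Z => assK (sval X) (sval Y) (sval Z))
    (fun X => lun_iso (sval X)) (fun X => run_iso (sval X))
    (fun _ _ _ _ _ _ => @ass_nat R M _ _ _ _ _ _)
    (fun _ _ => @lun_nat R M _ _) (fun _ _ => @run_nat R M _ _)
    (fun W X Y Z => pentagon (sval W) (sval X) (sval Y) (sval Z))
    (fun X Y => triangle (sval X) (sval Y)).

End FullSubcategory.

(* The (replete, full) fusion subcategory with object class P. *)
Record fusion_sub (M : monCat R) (P : M -> Prop) : Prop := {
  fsub_unit : P (unit_ob M);
  fsub_tens : forall X Y, P X -> P Y -> P (X ⊗ Y);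
  fsub_dsum : forall n (F : 'I_n -> M) X,
    is_direct_sum F X -> (forall i, P (F i)) -> P X;
  fsub_summand : forall X Y (i : hom Y X) (p : hom X Y),
    p ∘ i = idm Y -> P X -> P Y;
  fsub_dual : forall X Y, left_dual X Y -> (P X <-> P Y) }.

(* Objects of the fusion subcategory generated by the invertible simple
   objects. *)
Definition pt_ob (M : monCat R) (X : M) : Prop :=
  forall P : M -> Prop, fusion_sub P ->
    (forall Y, simple Y -> invertible Y -> P Y) -> P X.

Lemma pt_ob_unit (M : monCat R) : pt_ob (unit_ob M).
Proof. by move=> P subP _; apply: fsub_unit. Qed.

Lemma pt_ob_tens (M : monCat R) (X Y : M) :
  pt_ob X -> pt_ob Y -> pt_ob (X ⊗ Y).
Proof.
by move=> ptX ptY P subP invP; apply: fsub_tens => //; [apply: ptX|apply: ptY].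
Qed.

Definition pointed_part (M : monCat R) : monCat R :=
  full_sub (@pt_ob_unit M) (@pt_ob_tens M).

Record braidCat := BraidCat {
  braid_mon :> monCat R;
  br : forall X Y : braid_mon, hom (X ⊗ Y) (Y ⊗ X);
  br_iso : forall X Y, is_iso (br X Y);
  br_nat : forall X X' Y Y' (f : hom X X') (g : hom Y Y'),
    br X' Y' ∘ (f ⊛ g) = (g ⊛ f) ∘ br X Y;
  hexagon1 : forall X Y Z,
    ass Y Z X ∘ br X (Y ⊗ Z) ∘ ass X Y Z =
    (idm Y ⊛ br X Z) ∘ ass Y X Z ∘ (br X Y ⊛ idm Z);
  hexagon2 : forall X Y Z,
    assV Z X Y ∘ br (X ⊗ Y) Z ∘ assV X Y Z =
    (br X Z ⊛ idm Y) ∘ assV X Z Y ∘ (idm X ⊛ br Y Z) }.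

Record braidFusCat := BraidFusCat {
  braidfus_braid :> braidCat;
  braidfus_fusion : is_fusion braidfus_braid }.

(* F, with tensor structure J and unit isomorphism u, is a braided monoidal
   functor. *)
Record braided_functor (C D : braidCat) (F : linFun C D)
    (J : forall X Y : C, hom (F X ⊗ F Y) (F (X ⊗ Y)))
    (u : hom (unit_ob D) (F (unit_ob C))) : Prop := {
  bf_iso : forall X Y, is_iso (J X Y);
  bf_unit_iso : is_iso u;
  bf_nat : forall X X' Y Y' (f : hom X X') (g : hom Y Y'),
    J X' Y' ∘ (fmap F f ⊛ fmap F g) = fmap F (f ⊛ g) ∘ J X Y;
  bf_ass : forall X Y Z,
    fmap F (ass X Y Z) ∘ J (X ⊗ Y) Z ∘ (J X Y ⊛ idm (F Z)) =
    J X (Y ⊗ Z) ∘ (idm (F X) ⊛ J Y Z) ∘ ass (F X) (F Y) (F Z);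
  bf_lun : forall X,
    fmap F (lun X) ∘ J (unit_ob C) X ∘ (u ⊛ idm (F X)) = lun (F X);
  bf_run : forall X,
    fmap F (run X) ∘ J X (unit_ob C) ∘ (idm (F X) ⊛ u) = run (F X);
  bf_br : forall X Y, fmap F (br X Y) ∘ J X Y = J Y X ∘ br (F X) (F Y) }.

Definition braided_equiv (C D : braidCat) : Prop :=
  exists (F : linFun C D) (J : forall X Y, hom (F X ⊗ F Y) (F (X ⊗ Y)))
         (u : hom (unit_ob D) (F (unit_ob C))),
    braided_functor J u /\ equivalence F.

(* B : C x D -> E, with structure maps J and u, is a braided monoidal functor
   for the componentwise braided monoidal structure on C x D. *)
Record braided_bifunctor (C D E : braidCat) (B : bifun C D E)
    (J : forall (X X' : C) (Y Y' : D),
       hom (B X Y ⊗ B X' Y') (B (X ⊗ X') (Y ⊗ Y')))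
    (u : hom (unit_ob E) (B (unit_ob C) (unit_ob D))) : Prop := {
  bb_iso : forall X X' Y Y', is_iso (J X X' Y Y');
  bb_unit_iso : is_iso u;
  bb_nat : forall X1 X2 X1' X2' Y1 Y2 Y1' Y2'
      (f : hom X1 X2) (f' : hom X1' X2') (g : hom Y1 Y2) (g' : hom Y1' Y2'),
    J X2 X2' Y2 Y2' ∘ (bmap B f g ⊛ bmap B f' g') =
    bmap B (f ⊛ f') (g ⊛ g') ∘ J X1 X1' Y1 Y1';
  bb_ass : forall X X' X'' Y Y' Y'',
    bmap B (ass X X' X'') (ass Y Y' Y'') ∘ J (X ⊗ X') X'' (Y ⊗ Y') Y''
      ∘ (J X X' Y Y' ⊛ idm (B X'' Y'')) =
    J X (X' ⊗ X'') Y (Y' ⊗ Y'') ∘ (idm (B X Y) ⊛ J X' X'' Y' Y'')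
      ∘ ass (B X Y) (B X' Y') (B X'' Y'');
  bb_lun : forall X Y,
    bmap B (lun X) (lun Y) ∘ J (unit_ob C) X (unit_ob D) Y
      ∘ (u ⊛ idm (B X Y)) = lun (B X Y);
  bb_run : forall X Y,
    bmap B (run X) (run Y) ∘ J X (unit_ob C) Y (unit_ob D)
      ∘ (idm (B X Y) ⊛ u) = run (B X Y);
  bb_br : forall X X' Y Y',
    bmap B (br X X') (br Y Y') ∘ J X X' Y Y' =
    J X' X Y' Y ∘ br (B X Y) (B X' Y') }.

(* E is a Deligne tensor product of C and D as a braided category: its braided
   monoidal structure is the one induced from those of C and D. *)
Definition is_braided_deligne_product (C D E : braidCat) : Prop :=
  exists (B : bifun C D E)
         (J : forall X X' Y Y', hom (B X Y ⊗ B X' Y') (B (X ⊗ X') (Y ⊗ Y')))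
         (u : hom (unit_ob E) (B (unit_ob C) (unit_ob D))),
    is_deligne_product B /\ braided_bifunctor J u.

(* The last clause is theta_{X^*} = (theta_X)^*. *)
Record is_ribbon (C : braidCat) (theta : forall X : C, hom X X) : Prop := {
  ribbon_iso : forall X, is_iso (theta X);
  ribbon_nat : forall X Y (f : hom X Y), theta Y ∘ f = f ∘ theta X;
  ribbon_tens : forall X Y,
    theta (X ⊗ Y) = br Y X ∘ br X Y ∘ (theta X ⊛ theta Y);
  ribbon_dual : forall X Xs ev coev, dual_data (X := X) (Xs := Xs) ev coev ->
    ev ∘ (theta Xs ⊛ idm X) = ev ∘ (idm Xs ⊛ theta X) }.

(* The trace ev ∘ c_{X,X^*} ∘ (theta_X f ⊗ id) ∘ coev, an endomorphism of the
   (simple) unit object identified with a scalar; it does not depend on the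
   choice of the dual. *)
Definition ribbon_trace (C : braidCat) (theta : forall X : C, hom X X)
    (X : C) (f : hom X X) : K :=
  xget 0 [set t | exists (Xs : C) ev coev,
    dual_data (X := X) (Xs := Xs) ev coev /\
    ev ∘ br X Xs ∘ ((theta X ∘ f) ⊛ idm Xs) ∘ coev = t *: idm (unit_ob C)].

Definition S_matrix (C : braidCat) (theta : forall X : C, hom X X)
    n (s : 'I_n -> C) : 'M[K]_n :=
  \matrix_(i, j) ribbon_trace theta (br (s j) (s i) ∘ br (s i) (s j)).

Record modularCat := ModularCat {
  modular_fus :> braidFusCat;
  twist : forall X : modular_fus, hom X X;
  twist_ribbon : is_ribbon twist;
  modular_nondeg : forall n (s : 'I_n -> modular_fus),
    simple_reps s -> S_matrix twist s \in unitmx }.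

End FusionCategories.

Arguments braidCat R : clear implicits.
Arguments braidFusCat R : clear implicits.
Arguments modularCat R : clear implicits.

(* Main.v *)
(* A loop labelled by the simple object j acts on the simple object k by a
   scalar h k j; the functions h k are the characters of the Grothendieck ring,
   and by integrality the positive one gives the dimensions, which are positive
   integers whose squares divide FPdim C.

   Let p be a prime divisor of d, so that p divides FPdim C exactly once and no
   dimension, and consider the simple objects j such that h k j is congruent,
   for all k, to the value at the unit object modulo a prime ideal above p.
   For them no h k j vanishes, and a Burnside-type argument (the arithmetic-
   geometric mean inequality on Galois-stable sets of characters) gives
   |h k j| = 1, which makes j invertible. Since their squared dimensions add up
   to a multiple of p, they form a group of order divisible by p. Hence d
   divides the order of the group of invertible objects, and its d-torsion A has
   order d.

   The double braiding is nondegenerate on A: otherwise an element of A of prime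
   order p would lie in its own centralizer and act there by permutations, and
   counting fixed points modulo p, with its twist either trivial or not, would
   contradict p^2 not dividing FPdim C. Every simple object is then uniquely the
   product of an element of A and of a simple object centralizing A, so that C
   is the product of the subcategories D and D' generated by A and by its
   centralizer: the tensor product of C restricts to the universal functor on
   D x D', and is braided since the double braidings between D and D' are
   trivial. *)
From Pilot Require Import Defs.
From HB Require Import structures.
From mathcomp Require Import all_boot all_order all_algebra.
From mathcomp Require Import all_classical all_reals.
From mathcomp Require Import complex ring zify.
From mathcomp Require Import fingroup perm action morphism cyclic pgroup sylow.

Set Implicit Arguments.
Unset Strict Implicit.
Unset Printing Implicit Defensive.

Import Order.TTheory GRing.Theory Num.Theory.
Import Pilot.Defs.
Local Open Scope cat_scope.
Local Open Scope ring_scope.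

(** * Semisimple linear categories *)

(** Two notions of dimension have to be kept apart. The loop values [h o k] at the unit object are
    the dimensions given by the ribbon structure, a priori complex numbers; the Frobenius-Perron
    dimensions are the values of a positive character [h j0], whose index need not be that of the
    unit. Integrality concerns the second kind and the symmetry of the S-matrix the first, so
    [|h o k| = dim k] must be known before the hypothesis on primes can bear on the S-matrix. No
    Galois group ever acts. The role of a Galois-stable set is played by the set of characters at
    which an integral element of the Grothendieck ring vanishes, and a product over such a set is
    rational because it is a quotient of coefficients of determinants of integer matrices. The prime
    ideal above p lives in the ring of all algebraic integers of the ground field and comes from
    Zorn's lemma. All the arithmetic takes place on the finite data of a [modular_datum]; categories
    serve to produce these data and to turn sets of indices back into subcategories. *)

Lemma dependent_choice (I : Type) (T : I -> Type) (P : forall i, T i -> Prop) :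
  (forall i, exists x, P i x) -> exists f, forall i, P i (f i).
Proof. by move=> h; exists (fun i => sval (cid (h i))) => i; apply: svalP. Qed.

Section LinearCategory.
Context {R : realType} {A : linCat R}.
Implicit Types X Y Z W : A.

Lemma compDl X Y Z (g g' : hom Y Z) (f : hom X Y) :
  (g + g') ∘ f = g ∘ f + g' ∘ f.
Proof. by have := comp_linl 1 g g' f; rewrite !scale1r. Qed.

Lemma compDr X Y Z (g : hom Y Z) (f f' : hom X Y) :
  g ∘ (f + f') = g ∘ f + g ∘ f'.
Proof. by have := comp_linr 1 g f f'; rewrite !scale1r. Qed.

Lemma comp0l X Y Z (f : hom X Y) : (0 : hom Y Z) ∘ f = 0.
Proof. by apply: (addrI (0 ∘ f)); rewrite -compDl !addr0. Qed.

Lemma comp0r X Y Z (g : hom Y Z) : g ∘ (0 : hom X Y) = 0.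
Proof. by apply: (addrI (g ∘ 0)); rewrite -compDr !addr0. Qed.

Lemma compZl X Y Z a (g : hom Y Z) (f : hom X Y) : (a *: g) ∘ f = a *: (g ∘ f).
Proof. by have := comp_linl a g 0 f; rewrite comp0l !addr0. Qed.

Lemma compZr X Y Z a (g : hom Y Z) (f : hom X Y) : g ∘ (a *: f) = a *: (g ∘ f).
Proof. by have := comp_linr a g f 0; rewrite comp0r !addr0. Qed.

Lemma compNl X Y Z (g : hom Y Z) (f : hom X Y) : (- g) ∘ f = - (g ∘ f).
Proof. by rewrite -scaleN1r compZl scaleN1r. Qed.

Lemma compNr X Y Z (g : hom Y Z) (f : hom X Y) : g ∘ (- f) = - (g ∘ f).
Proof. by rewrite -scaleN1r compZr scaleN1r. Qed.

Lemma comp_suml X Y Z I (r : seq I) (P : pred I) (g : I -> hom Y Z) (f : hom X Y) :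
  (\sum_(i <- r | P i) g i) ∘ f = \sum_(i <- r | P i) g i ∘ f.
Proof. by apply: (big_morph (fun g => g ∘ f)) => [? ?|]; rewrite ?compDl ?comp0l. Qed.

Lemma comp_sumr X Y Z I (r : seq I) (P : pred I) (g : hom Y Z) (f : I -> hom X Y) :
  g ∘ (\sum_(i <- r | P i) f i) = \sum_(i <- r | P i) g ∘ f i.
Proof. by apply: (big_morph (fun f => g ∘ f)) => [? ?|]; rewrite ?compDr ?comp0r. Qed.

Lemma inverse_sym X Y (f : hom X Y) g : inverse_to f g -> inverse_to g f.
Proof. by case. Qed.

Lemma inverse_comp X Y Z (f : hom X Y) f' (g : hom Y Z) g' :
  inverse_to f f' -> inverse_to g g' -> inverse_to (g ∘ f) (f' ∘ g').
Proof.
move=> [f1 f2] [g1 g2]; split.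
  by rewrite -compA (compA g') g1 comp1m.
by rewrite -compA (compA f) f2 comp1m.
Qed.

Lemma idm_iso X : is_iso (idm X).
Proof. by exists (idm X); split; rewrite comp1m. Qed.

Lemma iso_comp X Y Z (f : hom X Y) (g : hom Y Z) :
  is_iso f -> is_iso g -> is_iso (g ∘ f).
Proof. by move=> [f' ff'] [g' gg']; exists (f' ∘ g'); apply: inverse_comp. Qed.

Lemma iso_lcancel X Y Z (g : hom Y Z) (f f' : hom X Y) :
  is_iso g -> g ∘ f = g ∘ f' -> f = f'.
Proof.
by move=> [k [gk kg]] eqf; rewrite -[f]comp1m -[f']comp1m -gk -!compA eqf.
Qed.

Lemma iso_rcancel X Y Z (g g' : hom Y Z) (f : hom X Y) :
  is_iso f -> g ∘ f = g' ∘ f -> g = g'.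
Proof.
by move=> [k [gk kg]] eqf; rewrite -[g]compm1 -[g']compm1 -kg !compA eqf.
Qed.

Lemma isomorphic_refl X : isomorphic X X.
Proof. by exists (idm X); apply: idm_iso. Qed.

Lemma isomorphic_sym X Y : isomorphic X Y -> isomorphic Y X.
Proof. by move=> [f [g fg]]; exists g, f; apply: inverse_sym. Qed.

Lemma isomorphic_trans X Y Z : isomorphic X Y -> isomorphic Y Z -> isomorphic X Z.
Proof. by move=> [f ff] [g gg]; exists (g ∘ f); apply: iso_comp. Qed.

Lemma isomorphic_simple X Y : isomorphic X Y -> simple X -> simple Y.
Proof.
move=> [f [g [gf fg]]] [X0 Xm]; split.
  by move=> Y0; apply: X0; rewrite -gf -[g]compm1 Y0 comp0r comp0l.
move=> Z h hm; have [|h0|[k [hk kh]]] := Xm _ (g ∘ h).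
- move=> W u v; rewrite -!compA => /(congr1 (comp f)).
  by rewrite !compA fg !comp1m; apply: hm.
- by left; rewrite -[h]comp1m -fg -compA h0 comp0r.
right; exists (k ∘ g); split; first by rewrite -compA.
by rewrite -[RHS]fg -[in RHS](comp1m g) -kh !compA fg comp1m.
Qed.

Lemma dsum_iso1 X Y : isomorphic X Y -> is_direct_sum (fun _ : 'I_1 => X) Y.
Proof.
move=> [f [g [gf fg]]]; exists (fun=> f), (fun=> g); split=> //.
  by move=> i j; rewrite !ord1 eqxx.
by rewrite big_ord1.
Qed.

Lemma dsum_iso n (F G : 'I_n -> A) X :
  (forall i, isomorphic (F i) (G i)) -> is_direct_sum F X -> is_direct_sum G X.
Proof.
move=> /dependent_choice[f] /dependent_choice[g fg] [inj [prj [pi p0 ip]]].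
exists (fun i => inj i ∘ g i), (fun i => f i ∘ prj i); split.
- move=> i; have [gf <-] := fg i; rewrite -compA (compA (prj i)) pi.
  by rewrite comp1m.
- move=> i j ij; rewrite -compA (compA (prj i)) (p0 _ _ ij).
  by rewrite comp0l comp0r.
rewrite -ip; apply: eq_bigr => i _; have [gf _] := fg i.
by rewrite -compA (compA (g i)) gf comp1m.
Qed.

End LinearCategory.

(** * Dimensions of vector spaces *)

Section VectorDimension.
Context {R : realType}.
Notation K := (R[i]%C).

Lemma has_dim_inj (V W : lmodType K) (L : {linear V -> W}) m n :
  injective L -> has_dim V m -> has_dim W n -> (m <= n)%N.
Proof.
move=> Linj [f [f' fK f'K]] [g [g' gK g'K]].
have f'lin : linear f'.
  by move=> a u v; apply: (can_inj fK); rewrite linearP !f'K.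
pose fl : {linear _ -> _} := HB.pack f' (GRing.isLinear.Build _ _ _ _ f' f'lin).
pose T : {linear _ -> _} := g \o L \o fl.
have Tinj : injective T.
  by move=> u v /(can_inj gK)/Linj/(can_inj f'K).
have : row_free (lin1_mx T).
  rewrite -kermx_eq0; apply/rowV0P => v /sub_kermxP; rewrite mul_rV_lin1 => Tv0.
  by apply: Tinj; rewrite Tv0 linear0.
by move=> /eqP <-; apply: rank_leq_col.
Qed.

Lemma has_dim_unique (V : lmodType K) m n : has_dim V m -> has_dim V n -> m = n.
Proof.
move=> hm hn; apply/eqP; rewrite eqn_leq.
by apply/andP; split; [apply: (@has_dim_inj V V idfun)
                     |apply: (@has_dim_inj V V idfun)].
Qed.

Lemma vdimE (V : lmodType K) n : has_dim V n -> vdim V = n.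
Proof.
by move=> hn; apply: xget_unique => // m hm; apply: has_dim_unique hn.
Qed.

Lemma has_dim_bij (V W : lmodType K) (f : V -> W) n :
  linear f -> bijective f -> has_dim W n -> has_dim V n.
Proof.
move=> lf bf [g bg].
pose fl : {linear V -> W} := HB.pack f (GRing.isLinear.Build _ _ _ _ f lf).
by exists (g \o fl : {linear _ -> _}); apply: bij_comp.
Qed.

Lemma vdim_bij (V W : lmodType K) (f : V -> W) :
  linear f -> bijective f -> vdim V = vdim W.
Proof.
move=> lf bf; have [f' fK f'K] := bf.
have lf' : linear f'.
  by move=> a u v; apply: (can_inj fK); rewrite lf !f'K.
rewrite /vdim; congr xget; rewrite predeqE => n; split=> hn.
  by apply: has_dim_bij lf' _ hn; exists f.
by apply: has_dim_bij lf _ hn.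
Qed.

End VectorDimension.

Lemma has_dim_sum {R : realType} (V : lmodType R[i]) n (W : 'I_n -> lmodType R[i])
    (p : forall i, V -> W i) (q : forall i, W i -> V) (m : 'I_n -> nat) :
  (forall i, linear (p i)) ->
  (forall i w, p i (q i w) = w) ->
  (forall i j w, i != j -> p i (q j w) = 0) ->
  (forall v, \sum_i q i (p i v) = v) ->
  (forall i, has_dim (W i) (m i)) -> has_dim V (\sum_i m i)%N.
Proof.
move=> plin pq pq0 qp /dependent_choice[f fbij].
have [g fg] := dependent_choice (fun i => let: Bijective g fK gK := fbij i in
  ex_intro (fun g => cancel (f i) g /\ cancel g (f i)) g (conj fK gK)).
pose L v := \mxrow_i (f i (p i v)).
have Llin : linear L.
  by move=> a u v; apply/rowP => j; rewrite !mxE plin linearP !mxE.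
pose L' u := \sum_i q i (g i (submxrow u i)).
have pL' i u : p i (L' u) = g i (submxrow u i).
  have p0 : p i 0 = 0.
    by have := plin i (-1) 0 0; rewrite scaler0 add0r scaleN1r addNr.
  have pD : {morph p i : x y / x + y}.
    by move=> x y; have := plin i 1 x y; rewrite !scale1r.
  rewrite /L' (big_morph _ pD p0) (bigD1 i) //= pq big1 ?addr0 // => j ji.
  by rewrite pq0 // eq_sym.
exists (HB.pack L (GRing.isLinear.Build _ _ _ _ L Llin) : {linear _ -> _}).
exists L' => v /=; rewrite /L.
  rewrite -[RHS]qp; apply: eq_bigr => i _.
  by rewrite mxrowK; case: (fg i) => ->.
rewrite -[RHS]submxrowK; apply: eq_mxrow => i; rewrite pL'.
by case: (fg i) => _ ->.
Qed.

(** * Schur's lemma *)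

Section Schur.
Context {R : realType} {A : linCat R}.
Notation K := (R[i]%C).
Context (Aab : abelian A).
Context (Afin : forall X Y : A, exists n, has_dim (hom X Y) n).
Implicit Types X Y Z : A.

(** The kernel of [f] is a monomorphism into [X], and it is not invertible since [f] is nonzero,
    hence it is zero. So [f] is itself a monomorphism, and simplicity of [Y] applies to it. *)
Lemma schur_iso X Y (f : hom X Y) : simple X -> simple Y -> f <> 0 -> is_iso f.
Proof.
move=> [X0 Xs] [Y0 Ys] f0; have [N [k [fk ku]]] := abelian_ker Aab f.
have km : is_mono k.
  move=> W g h kgh; have [|w [kw wu]] := ku W (k ∘ g).
    by rewrite compA fk comp0l.
  by rewrite -(wu g) // -(wu h).
have [k0|[k' [_ kk']]] := Xs _ _ km; last first.
  by case: f0; rewrite -[f]compm1 -kk' compA fk comp0l.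
case: (Ys _ f) => // W g h fgh; apply/eqP; rewrite -subr_eq0; apply/eqP.
have [|w [<- _]] := ku W (g - h); last by rewrite k0 comp0l.
by rewrite compDr compNr fgh subrr.
Qed.

(** Composition with [f] is a linear map of the finite-dimensional nonzero space End(X), so it has
    an eigenvalue [c]. Then [f - c] kills a nonzero endomorphism and cannot be invertible. *)
Lemma schur_scal X (f : hom X X) : simple X -> exists c, f = c *: idm X.
Proof.
move=> Xs; have [n [L [L' LK L'K]]] := Afin X X.
have L'lin : linear L'.
  by move=> a u v; apply: (can_inj LK); rewrite linearP !L'K.
have Tlin : linear (fun v => L (f ∘ L' v)).
  by move=> a u v; rewrite L'lin compDr compZr linearP.
pose T : {linear 'rV[K]_n -> 'rV[K]_n} := HB.pack (fun v => L (f ∘ L' v))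
  (GRing.isLinear.Build _ _ _ _ _ Tlin).
have n0 : (0 < n)%N.
  rewrite lt0n; apply/eqP => n0; case: Xs => X0 _; apply: X0; apply: (can_inj LK).
  by apply/rowP => -[k lek]; exfalso; rewrite n0 in lek.
have /closed_rootP[c] : size (char_poly (lin1_mx T)) != 1%N.
  by rewrite size_char_poly; case: (n) n0.
rewrite -eigenvalue_root_char => /eigenvalueP[v vT v0].
exists c; apply: contrapT => fc.
have [|g [gf fg]] := @schur_iso X X (f - c *: idm X) Xs Xs.
  by move/eqP; rewrite subr_eq0 => /eqP.
case/eqP: v0; apply: (can_inj L'K).
have L'0 : L' 0 = 0.
  by have := L'lin (-1) 0 0; rewrite scaler0 add0r scaleN1r addNr.
rewrite L'0 -[L' v]comp1m -gf -compA compDl compNl compZl comp1m.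
have -> : f ∘ L' v = c *: L' v.
  have L'Z : L' (c *: v) = c *: L' v.
    by have := L'lin c v 0; rewrite !addr0 L'0 addr0.
  by rewrite -L'Z -vT mul_rV_lin1 /= LK.
by rewrite subrr comp0r.
Qed.

End Schur.

(** * Matrix calculus for direct sums of a fixed family of objects *)

Section Decomposition.
Context {R : realType}.
Notation K := (R[i]%C).

Section Family.
Context {A : linCat R} {J : eqType} (T : J -> A).

(** The identity transported along [i = j], and zero when the indices differ. Being defined for all
    pairs of indices, it lets matrices of morphisms be multiplied without casts between [T i] and
    [T j]. *)
Definition fam_id (i j : J) : hom (T i) (T j) :=
  match i =P j with
  | ReflectT e => eq_rect i (fun j => hom (T i) (T j)) (idm (T i)) j e
  | ReflectF _ => 0
  end.

Lemma fam_id1 i : fam_id i i = idm (T i).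
Proof. by rewrite /fam_id; case: eqP => // e; rewrite (eq_axiomK e). Qed.

Lemma fam_id0 i j : i != j -> fam_id i j = 0.
Proof. by rewrite /fam_id; case: eqP. Qed.

Lemma fam_idM i j k : fam_id j k ∘ fam_id i j = (i == j)%:R *: fam_id i k.
Proof.
have [->|ij] := eqVneq i j; first by rewrite fam_id1 compm1 scale1r.
by rewrite (fam_id0 ij) comp0r scale0r.
Qed.

(** The data of [is_direct_sum], kept in [Type] so that matrices and functors can be built from
    them. *)
Record decomp n (κ : 'I_n -> J) (X : A) := Decomp {
  dinj : forall a, hom (T (κ a)) X;
  dprj : forall a, hom X (T (κ a));
  decomp1 : forall a, dprj a ∘ dinj a = idm (T (κ a));
  decomp0 : forall a b, a != b -> dprj a ∘ dinj b = 0;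
  decompS : \sum_a dinj a ∘ dprj a = idm X }.

Lemma decomp_dsum n (κ : 'I_n -> J) X :
  decomp κ X -> is_direct_sum (fun a => T (κ a)) X.
Proof. by case=> i p *; exists i, p. Qed.

Lemma dsum_decomp n (κ : 'I_n -> J) X :
  is_direct_sum (fun a => T (κ a)) X -> inhabited (decomp κ X).
Proof. by case=> i [p [p1 p0 ip]]; split; exists i p. Qed.

Lemma decompE n (κ : 'I_n -> J) X (δ : decomp κ X) a b :
  dprj δ a ∘ dinj δ b = (a == b)%:R *: fam_id (κ b) (κ a).
Proof.
have [->|ab] := eqVneq a b; first by rewrite decomp1 fam_id1 scale1r.
by rewrite decomp0 // scale0r.
Qed.

Definition mxhom m n (κ : 'I_m -> J) (ν : 'I_n -> J) X Y
    (δ : decomp κ X) (ε : decomp ν Y) (F : 'M[K]_(n, m)) : hom X Y :=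
  \sum_b \sum_a F b a *: (dinj ε b ∘ fam_id (κ a) (ν b) ∘ dprj δ a).

(** [mxhom] ignores the entries between different labels, but a matrix product does not: composition
    is the matrix product only once those entries vanish. *)
Definition mxblock_compat m n (κ : 'I_m -> J) (ν : 'I_n -> J)
    (F : 'M[K]_(n, m)) := forall b a, κ a != ν b -> F b a = 0.

Section MatrixMorphisms.
Context l m n (κ : 'I_l -> J) (μ : 'I_m -> J) (ν : 'I_n -> J).
Context X Y Z (δ : decomp κ X) (ε : decomp μ Y) (ζ : decomp ν Z).

Lemma mxhom_lin a (F G : 'M[K]_(m, l)) :
  mxhom δ ε (a *: F + G) = a *: mxhom δ ε F + mxhom δ ε G.
Proof.
rewrite /mxhom scaler_sumr -big_split; apply: eq_bigr => b _ /=.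
rewrite scaler_sumr -big_split; apply: eq_bigr => c _ /=.
by rewrite !mxE scalerDl scalerA.
Qed.

Lemma mxhom1 : mxhom δ δ 1%:M = idm X.
Proof.
rewrite -(decompS δ); apply: eq_bigr => a _.
rewrite (bigD1 a) //= big1 => [|b ba]; last by rewrite mxE eq_sym (negPf ba) scale0r.
by rewrite mxE eqxx scale1r fam_id1 compm1 addr0.
Qed.

Lemma mxhomM (G : 'M[K]_(n, m)) (F : 'M[K]_(m, l)) : mxblock_compat κ μ F ->
  mxhom ε ζ G ∘ mxhom δ ε F = mxhom δ ζ (G *m F).
Proof.
move=> Fb; rewrite /mxhom comp_suml; apply: eq_bigr => c _.
transitivity (\sum_b \sum_a (G c b * F b a) *:
   (dinj ζ c ∘ fam_id (κ a) (ν c) ∘ dprj δ a)); last first.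
  rewrite exchange_big; apply: eq_bigr => a _ /=.
  by rewrite -scaler_suml mxE.
rewrite comp_suml; apply: eq_bigr => b _.
rewrite comp_sumr (bigD1 b) //= [X in _ + X]big1 => [|b' b'b].
  rewrite addr0 comp_sumr; apply: eq_bigr => a _.
  rewrite compZl compZr scalerA -!compA (compA (dprj ε b)) decomp1 comp1m.
  rewrite (compA (fam_id _ _)) fam_idM.
  have [_|ab] := eqVneq (κ a) (μ b); first by rewrite scale1r.
  by rewrite Fb // mulr0 !scale0r.
rewrite comp_sumr big1 // => a _; rewrite compZl compZr -!compA (compA (dprj ε b)).
by rewrite decomp0 1?eq_sym // comp0l !comp0r !scaler0.
Qed.

End MatrixMorphisms.
End Family.

Section Coefficients.
Context {A : linCat R} {J : eqType} (s : J -> A).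

Context (sch0 : forall i j (f : hom (s i) (s j)), i != j -> f = 0).
Context (sch1 : forall i (f : hom (s i) (s i)), exists c : K, f = c *: idm (s i)).
Context (s_neq0 : forall i, idm (s i) <> 0).

Definition coef i j (f : hom (s i) (s j)) : K :=
  xget 0 [set c | i = j /\ f = c *: fam_id s i j]%classic.

Lemma coefZ i j c : coef (c *: fam_id s i j) = c * (i == j)%:R.
Proof.
rewrite /coef; have [<-{j}|ij] := eqVneq i j; last first.
  by rewrite mulr0; apply: xgetPN => a [eij]; rewrite eij eqxx in ij.
rewrite mulr1; apply: xget_unique => // a [_ /eqP].
rewrite -subr_eq0 -scalerBl scaler_eq0 subr_eq0 => /orP[/eqP //|/eqP].
by rewrite fam_id1 => /s_neq0.
Qed.

Lemma coefK i j (f : hom (s i) (s j)) : f = coef f *: fam_id s i j.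
Proof.
have [ij|ij] := eqVneq i j; last by rewrite (sch0 f ij) fam_id0 // scaler0.
case: j / ij f => f; have [c ->] := sch1 f.
by rewrite -[X in coef (_ *: X)]fam_id1 coefZ eqxx mulr1 fam_id1.
Qed.

Lemma coef0 i j (f : hom (s i) (s j)) : i != j -> coef f = 0.
Proof. by move=> ij; rewrite (coefK f) coefZ (negPf ij) mulr0. Qed.

Lemma coef_lin i j a (f g : hom (s i) (s j)) :
  coef (a *: f + g) = a * coef f + coef g.
Proof.
have [ij|ij] := eqVneq i j; last by rewrite !coef0 // mulr0 addr0.
rewrite {1}(coefK f) {1}(coefK g) scalerA -scalerDl coefZ.
by rewrite (introT eqP ij) mulr1.
Qed.

Lemma coefM i j k (g : hom (s j) (s k)) (f : hom (s i) (s j)) :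
  coef (g ∘ f) = coef g * coef f.
Proof.
rewrite {1}(coefK f) {1}(coefK g) compZl compZr fam_idM !scalerA coefZ.
have [ij|ij] := boolP (i == j); last by rewrite !mulr0 mul0r (coef0 f) ?mulr0.
have [_|ik] := boolP (i == k); rewrite ?mulr1 // mulr0 (coef0 g) ?mul0r //.
by rewrite -(eqP ij).
Qed.

Section MatrixOf.
Context l m n (κ : 'I_l -> J) (μ : 'I_m -> J) (ν : 'I_n -> J).
Context X Y Z (δ : decomp s κ X) (ε : decomp s μ Y) (ζ : decomp s ν Z).

Definition mxof (f : hom X Y) : 'M[K]_(m, l) :=
  \matrix_(b, a) coef (dprj ε b ∘ f ∘ dinj δ a).

Lemma mxof_compat f : mxblock_compat κ μ (mxof f).
Proof. by move=> b a ab; rewrite mxE coef0. Qed.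

Lemma mxofK f : mxhom δ ε (mxof f) = f.
Proof.
rewrite -[RHS]comp1m -(decompS ε) comp_suml; apply: eq_bigr => b _.
rewrite -[RHS]compm1 -(decompS δ) comp_sumr; apply: eq_bigr => a _.
rewrite mxE -compZl -compZr -coefK.
by rewrite !compA.
Qed.

Lemma mxof_lin a f g : mxof (a *: f + g) = a *: mxof f + mxof g.
Proof.
by apply/matrixP => b c; rewrite !mxE compDr compZr compDl compZl coef_lin.
Qed.

End MatrixOf.

Lemma mxof1 l (κ : 'I_l -> J) X (δ : decomp s κ X) : mxof δ δ (idm X) = 1%:M.
Proof.
apply/matrixP => b a; rewrite !mxE compm1 decompE coefZ.
by have [/eqP->|_] := boolP (b == a); rewrite ?eqxx ?mulr1 ?mul0r.
Qed.

Lemma mxofM l m n (κ : 'I_l -> J) (μ : 'I_m -> J) (ν : 'I_n -> J)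
    X Y Z (δ : decomp s κ X) (ε : decomp s μ Y) (ζ : decomp s ν Z)
    (g : hom Y Z) (f : hom X Y) :
  mxof δ ζ (g ∘ f) = mxof ε ζ g *m mxof δ ε f.
Proof.
apply/matrixP => c a; rewrite !mxE -[f in LHS]comp1m -(decompS ε).
rewrite comp_suml !comp_sumr comp_suml.
have coef_sum i j I (q : seq I) (h : I -> hom (s i) (s j)) :
    coef (\sum_(b <- q) h b) = \sum_(b <- q) coef (h b).
  elim: q => [|b q IHq]; rewrite ?big_nil ?big_cons; last first.
    by rewrite -[h b]scale1r coef_lin mul1r IHq scale1r.
  by rewrite -[0](scale0r (fam_id s i j)) coefZ mul0r.
rewrite coef_sum; apply: eq_bigr => b _; rewrite !mxE -coefM.
by rewrite !compA.
Qed.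

(** The matrix of [f] is block diagonal for the labels. Erasing from its pseudo-inverse the entries
    between different labels keeps it a pseudo-inverse and makes it the matrix of a morphism. *)
Lemma generalized_inverse l m (κ : 'I_l -> J) (μ : 'I_m -> J) X Y
    (δ : decomp s κ X) (ε : decomp s μ Y) (f : hom X Y) :
  exists g : hom Y X, f ∘ g ∘ f = f.
Proof.
pose F := mxof δ ε f; pose G := \matrix_(a, b) (pinvmx F a b * (μ b == κ a)%:R).
have Fb : mxblock_compat κ μ F by apply: mxof_compat.
have Gb : mxblock_compat μ κ G.
  by move=> a b ab; rewrite mxE (negPf ab) mulr0.
exists (mxhom ε δ G); rewrite -[f](mxofK δ ε) -/F -compA mxhomM // mxhomM; last first.
  move=> a a' aa'; rewrite mxE big1 // => b _; rewrite mxE.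
  have [/eqP ba|] := boolP (μ b == κ a); last by rewrite mulr0 mul0r.
  by rewrite (Fb b a') ?mulr0 // ba.
congr mxhom; apply/matrixP => b a.
have [eab|ab] := boolP (κ a == μ b); last first.
  rewrite (Fb b a ab) mxE big1 // => a' _.
  have [/eqP ea|/Fb->] := boolP (κ a' == μ b); last by rewrite mul0r.
  rewrite [(_ *m _) a' a]mxE big1 ?mulr0 // => b' _; rewrite mxE.
  have [/eqP eb|_] := boolP (μ b' == κ a'); last by rewrite mulr0 mul0r.
  by rewrite (Fb b' a) ?mulr0 // eb ea.
rewrite -[in RHS](mulmxKpV (submx_refl F)) -mulmxA !mxE; apply: eq_bigr => a' _.
have [ea|/Fb->] := boolP (κ a' == μ b); last by rewrite !mul0r.
rewrite !mxE; congr (_ * _); apply: eq_bigr => b' _; rewrite mxE.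
have [_|ab] := boolP (μ b' == κ a'); first by rewrite mulr1.
by rewrite (Fb b' a) ?mulr0 // (eqP eab) -(eqP ea) eq_sym.
Qed.

End Coefficients.
End Decomposition.

Record fin_semisimple {R : realType} (A : linCat R) : Prop := {
  fss_abelian : abelian A;
  fss_homfin : forall X Y : A, exists n, has_dim (hom X Y) n;
  fss_semisimple : semisimple A }.

Lemma fusion_fss {R : realType} (M : monCat R) : is_fusion M -> fin_semisimple M.
Proof. by case. Qed.

(** * Multiplicities of simple objects, and splitting *)

Section Multiplicity.
Context {R : realType} {A : linCat R} (hA : fin_semisimple A).
Notation K := (R[i]%C).
Let Aab := fss_abelian hA.
Let Afin := fss_homfin hA.
Let Ass := fss_semisimple hA.
Context (r : nat) (s : 'I_r -> A) (sR : simple_reps s).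
Implicit Types X Y Z : A.

Lemma reps_simple i : simple (s i). Proof. by case: sR. Qed.

Lemma reps_hom0 i j (f : hom (s i) (s j)) : i != j -> f = 0.
Proof.
move=> ij; apply: contrapT => f0; case/eqP: ij; have [_ _] := sR; apply.
by exists f; apply: (schur_iso Aab) f0; apply: reps_simple.
Qed.

Lemma reps_hom1 i (f : hom (s i) (s i)) : exists c : K, f = c *: idm (s i).
Proof. exact: (schur_scal Aab Afin f (reps_simple i)). Qed.

Lemma reps_neq0 i : idm (s i) <> 0. Proof. by case: (reps_simple i). Qed.

Lemma reps_decomp X : exists n (κ : 'I_n -> 'I_r), inhabited (decomp s κ X).
Proof.
have [n [F [Fs FX]]] := Ass X.
have [_ sF _] := sR.
have [κ Fκ] := dependent_choice (fun a => sF _ (Fs a)).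
by exists n, κ; apply: dsum_decomp; apply: dsum_iso FX.
Qed.

Lemma has_dim_reps i j : has_dim (hom (s i) (s j)) (i == j)%N.
Proof.
have [n [L [L' LK L'K]]] := Afin (s i) (s j).
have [/eqP eij|ij] := boolP (i == j); last first.
  exists (\0 : {linear _ -> _}).
  exists (fun=> 0) => f; last by apply/rowP => -[].
  by rewrite (reps_hom0 f ij).
case: j / eij {n L L' LK L'K}.
pose L (f : hom (s i) (s i)) : 'rV[K]_1 := (coef f)%:M.
have Llin : linear L.
  move=> a u v; rewrite /L (coef_lin reps_hom0 reps_hom1 reps_neq0).
  by rewrite raddfD /= scale_scalar_mx.
exists (HB.pack L (GRing.isLinear.Build _ _ _ _ L Llin) : {linear _ -> _}).
exists (fun v : 'rV[K]_1 => v 0 0 *: idm (s i)) => [f|v] /=; rewrite /L.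
  rewrite mxE mulr1n [RHS](coefK reps_hom0 reps_hom1 reps_neq0).
  by rewrite fam_id1.
rewrite -{1}fam_id1 (coefZ reps_neq0) eqxx mulr1.
by apply/rowP => k; rewrite !ord1 mxE.
Qed.

Definition mult X k := vdim (hom (s k) X).

Lemma hom_dsum_dim Z n (F : 'I_n -> A) X m : is_direct_sum F X ->
  (forall a, has_dim (hom Z (F a)) (m a)) -> has_dim (hom Z X) (\sum_a m a)%N.
Proof.
move=> [i [p [p1 p0 ip]]]; apply: (has_dim_sum (p := fun a f => p a ∘ f)
  (q := fun a f => i a ∘ f)) => [a c u v|a u|a b u ab|u].
- exact: comp_linr.
- by rewrite compA p1 comp1m.
- by rewrite compA p0 // comp0l.
- rewrite -[RHS]comp1m -ip comp_suml; apply: eq_bigr => a _.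
  by rewrite compA.
Qed.

Lemma dsum_hom_dim Z n (F : 'I_n -> A) X m : is_direct_sum F X ->
  (forall a, has_dim (hom (F a) Z) (m a)) -> has_dim (hom X Z) (\sum_a m a)%N.
Proof.
move=> [i [p [p1 p0 ip]]]; apply: (has_dim_sum (p := fun a f => f ∘ i a)
  (q := fun a f => f ∘ p a)) => [a c u v|a u|a b u ab|u].
- exact: comp_linl.
- by rewrite -compA p1 compm1.
- by rewrite -compA p0 1?eq_sym // comp0r.
- rewrite -[RHS]compm1 -ip comp_sumr; apply: eq_bigr => a _.
  by rewrite compA.
Qed.

Lemma has_dim_mult X k : has_dim (hom (s k) X) (mult X k).
Proof. by have [n hn] := Afin (s k) X; rewrite /mult (vdimE hn). Qed.

Lemma mult_dsum n (F : 'I_n -> A) X k :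
  is_direct_sum F X -> mult X k = (\sum_a mult (F a) k)%N.
Proof.
move=> FX; apply: vdimE; apply: hom_dsum_dim FX _ => a.
exact: has_dim_mult.
Qed.

Lemma mult_reps i k : mult (s i) k = (k == i)%N.
Proof. exact/vdimE/has_dim_reps. Qed.

Lemma mult_decomp n (κ : 'I_n -> 'I_r) X k : decomp s κ X ->
  mult X k = (\sum_a (k == κ a))%N.
Proof.
move/decomp_dsum/mult_dsum=> ->; apply: eq_bigr => a _.
by rewrite mult_reps.
Qed.

Lemma mult_iso X Y k : isomorphic X Y -> mult X k = mult Y k.
Proof. by move/dsum_iso1/mult_dsum=> ->; rewrite big_ord1. Qed.

Lemma mult_hom_rev X k : has_dim (hom X (s k)) (mult X k).
Proof.
have [n [κ [δ]]] := reps_decomp X.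
rewrite (mult_decomp k δ); apply: dsum_hom_dim (decomp_dsum δ) _ => a.
by rewrite eq_sym; apply: has_dim_reps.
Qed.

Lemma mult_eq0 X k : mult X k = 0%N <-> (forall f : hom (s k) X, f = 0).
Proof.
have [L [L' LK L'K]] := has_dim_mult X k; split=> [m0 f|f0].
  apply: (can_inj LK); apply/rowP => -[a lea]; exfalso.
  by rewrite m0 in lea.
apply: vdimE; exists (\0 : {linear _ -> _}).
by exists (fun=> 0) => f; [rewrite (f0 f)|apply/rowP => -[]].
Qed.

(** The number of summands in a decomposition is the sum of all multiplicities, here 1. *)
Lemma iso_reps_mult X l : (forall k, mult X k = (k == l)%N) -> isomorphic X (s l).
Proof.
move=> Xl; have [n [κ [δ]]] := reps_decomp X.
have n1 : n = 1%N.
  transitivity (\sum_(a < n) \sum_k (k == κ a))%N.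
    rewrite (eq_bigr (fun=> 1%N)) ?sum1_card ?card_ord // => a _.
    by rewrite (bigD1 (κ a)) //= eqxx big1 // => k /negPf->.
  rewrite exchange_big /=; transitivity (\sum_k (k == l))%N.
    by apply: eq_bigr => k _; rewrite -Xl (mult_decomp k δ).
  by rewrite (bigD1 l) //= eqxx big1 // => k /negPf->.
move: κ δ; rewrite {}n1 => κ δ.
have: (\sum_a (κ ord0 == κ a) = (κ ord0 == l))%N by rewrite -(mult_decomp _ δ).
rewrite big_ord1 eqxx; case: eqP => // <- _; rewrite /=.
apply: isomorphic_sym; exists (dinj δ ord0), (dprj δ ord0); split.
  exact: decomp1.
by rewrite -(decompS δ) big_ord1.
Qed.

Definition additive_fun (V : nmodType) (φ : A -> V) :=
  forall n (F : 'I_n -> A) X, is_direct_sum F X -> φ X = \sum_a φ (F a).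

Lemma additive_iso (V : nmodType) (φ : A -> V) X Y :
  additive_fun φ -> isomorphic X Y -> φ X = φ Y.
Proof. by move=> φD /dsum_iso1/φD->; rewrite big_ord1. Qed.

Lemma additive_mult (V : nmodType) (φ : A -> V) X : additive_fun φ ->
  φ X = \sum_k φ (s k) *+ mult X k.
Proof.
move=> φD; have [n [κ [δ]]] := reps_decomp X.
rewrite (φD _ _ _ (decomp_dsum δ)).
transitivity (\sum_a \sum_k φ (s k) *+ (k == κ a)).
  apply: eq_bigr => a _; rewrite (bigD1 (κ a)) //= eqxx big1 ?addr0 // => k.
  by move/negPf->.
rewrite exchange_big; apply: eq_bigr => k _ /=.
by rewrite (mult_decomp k δ) sumrMnr.
Qed.

Lemma fusion_ginv X Y (f : hom X Y) : exists g : hom Y X, f ∘ g ∘ f = f.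
Proof.
have [n [κ [δ]]] := reps_decomp X; have [m [μ [ε]]] := reps_decomp Y.
exact: generalized_inverse reps_hom0 reps_hom1 reps_neq0 _ _ _ _ _ _ δ ε f.
Qed.

Lemma mono_split X Y (f : hom X Y) :
  is_mono f -> exists g, g ∘ f = idm X.
Proof.
move=> fm; have [g fgf] := fusion_ginv f; exists g.
by apply: fm; rewrite compm1 compA.
Qed.

(** With the converse [split_coker], being a cokernel becomes a set of equations between morphisms,
    which any linear functor preserves. *)
Lemma coker_split X Y Q (f : hom X Y) (c : hom Y Q) : is_coker f c ->
  exists (i : hom Q Y) (g : hom Y X), c ∘ i = idm Q /\ i ∘ c + f ∘ g = idm Y.
Proof.
move=> [cf cu]; have [g fgf] := fusion_ginv f.
have [|i [ic _]] := cu _ (idm Y - f ∘ g).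
  by rewrite compDl compNl comp1m fgf subrr.
exists i, g; split; last by rewrite ic subrK.
have [w [_ wu]] := cu _ c cf; rewrite -(wu (idm Q)) ?comp1m //.
apply/esym/wu; rewrite -compA ic compDr compNr compm1 compA cf comp0l.
by rewrite subr0.
Qed.

End Multiplicity.

Lemma split_coker {R : realType} {A : linCat R} (X Y Q : A) (f : hom X Y)
    (c : hom Y Q) (i : hom Q Y) (g : hom Y X) :
  c ∘ f = 0 -> c ∘ i = idm Q -> i ∘ c + f ∘ g = idm Y -> is_coker f c.
Proof.
move=> cf ci icfg; split=> // Z h hf; exists (h ∘ i); split.
  rewrite -compA -[RHS]compm1 -icfg compDr [in RHS]compA.
  by rewrite [h ∘ (f ∘ g)]compA hf comp0l addr0 compA.
by move=> h' <-; rewrite -compA ci compm1.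
Qed.

(** * Calculus in monoidal and braided categories *)

Reserved Notation "X ◁ f" (at level 38, left associativity).
Reserved Notation "f ▷ X" (at level 38, left associativity).
Notation "X ◁ f" := (bmap (tens _) (idm X) f) : cat_scope.
Notation "f ▷ X" := (bmap (tens _) f (idm X)) : cat_scope.

(* Rewriting inside a left-associated composite: [cmn] turns an equation
   between composites of m and of n morphisms into the same equation after
   composition with k. *)
Section Recomposition.
Context {R : realType} {A : linCat R}.

Lemma c21 (W X Y Z : A) (f : hom W X) (g : hom X Y) h : g ∘ f = h ->
  forall k : hom Y Z, k ∘ g ∘ f = k ∘ h.
Proof. by move=> e k; rewrite -compA e. Qed.

Lemma c22 (W X X' Y Z : A) (f : hom W X) (g : hom X Y) (f' : hom W X')
    (g' : hom X' Y) : g ∘ f = g' ∘ f' ->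
  forall k : hom Y Z, k ∘ g ∘ f = k ∘ g' ∘ f'.
Proof. by move=> e k; rewrite -compA e compA. Qed.

Lemma c32 (V W W' X Y Z : A) (f : hom V W) (g : hom W X) (h : hom X Y)
    (f' : hom V W') (g' : hom W' Y) :
  h ∘ g ∘ f = g' ∘ f' -> forall k : hom Y Z, k ∘ h ∘ g ∘ f = k ∘ g' ∘ f'.
Proof. by move=> e k; rewrite -2!compA (compA h) e compA. Qed.

Lemma c23 (V W W' X Y Z : A) (f : hom V W) (g : hom W X) (h : hom X Y)
    (f' : hom V W') (g' : hom W' Y) :
  g' ∘ f' = h ∘ g ∘ f -> forall k : hom Y Z, k ∘ g' ∘ f' = k ∘ h ∘ g ∘ f.
Proof. by move=> e k; rewrite -compA e !compA. Qed.

Lemma c33 (V W W' X X' Y Z : A) (f : hom V W) (g : hom W X) (h : hom X Y)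
    (f' : hom V W') (g' : hom W' X') (h' : hom X' Y) :
  h ∘ g ∘ f = h' ∘ g' ∘ f' ->
  forall k : hom Y Z, k ∘ h ∘ g ∘ f = k ∘ h' ∘ g' ∘ f'.
Proof. by move=> e k; rewrite -2!compA (compA h) e !compA. Qed.

End Recomposition.

Section Bifunctor.
Context {R : realType} {A B C : linCat R} (F : bifun A B C).

Lemma bmapDl (X X' : A) (Y Y' : B) (f f' : hom X X') (g : hom Y Y') :
  bmap F (f + f') g = bmap F f g + bmap F f' g.
Proof. by have := bmap_linl F 1 f f' g; rewrite !scale1r. Qed.

Lemma bmapDr (X X' : A) (Y Y' : B) (f : hom X X') (g g' : hom Y Y') :
  bmap F f (g + g') = bmap F f g + bmap F f g'.
Proof. by have := bmap_linr F 1 f g g'; rewrite !scale1r. Qed.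

Lemma bmap0l (X X' : A) (Y Y' : B) (g : hom Y Y') :
  bmap F (0 : hom X X') g = 0.
Proof. by apply: (addrI (bmap F 0 g)); rewrite -bmapDl !addr0. Qed.

Lemma bmap0r (X X' : A) (Y Y' : B) (f : hom X X') :
  bmap F f (0 : hom Y Y') = 0.
Proof. by apply: (addrI (bmap F f 0)); rewrite -bmapDr !addr0. Qed.

Lemma bmapZl (X X' : A) (Y Y' : B) a (f : hom X X') (g : hom Y Y') :
  bmap F (a *: f) g = a *: bmap F f g.
Proof. by have := bmap_linl F a f 0 g; rewrite bmap0l !addr0. Qed.

Lemma bmapZr (X X' : A) (Y Y' : B) a (f : hom X X') (g : hom Y Y') :
  bmap F f (a *: g) = a *: bmap F f g.
Proof. by have := bmap_linr F a f g 0; rewrite bmap0r !addr0. Qed.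

Lemma bmap_suml (X X' : A) (Y Y' : B) J (q : seq J)
    (f : J -> hom X X') (g : hom Y Y') :
  bmap F (\sum_(j <- q) f j) g = \sum_(j <- q) bmap F (f j) g.
Proof.
by apply: (big_morph (fun f => bmap F f g)) => [? ?|]; rewrite ?bmapDl ?bmap0l.
Qed.

Lemma bmap_sumr (X X' : A) (Y Y' : B) J (q : seq J)
    (f : hom X X') (g : J -> hom Y Y') :
  bmap F f (\sum_(j <- q) g j) = \sum_(j <- q) bmap F f (g j).
Proof.
by apply: (big_morph (fun g => bmap F f g)) => [? ?|]; rewrite ?bmapDr ?bmap0r.
Qed.

Lemma bmap_inverse (X X' : A) (Y Y' : B)
    (f : hom X X') f' (g : hom Y Y') g' :
  inverse_to f f' -> inverse_to g g' -> inverse_to (bmap F f g) (bmap F f' g').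
Proof. by move=> [f1 f2] [g1 g2]; split; rewrite -bmapM ?f1 ?g1 ?f2 ?g2 bmap1. Qed.

Lemma bmap_is_iso (X X' : A) (Y Y' : B)
    (f : hom X X') (g : hom Y Y') : is_iso f -> is_iso g -> is_iso (bmap F f g).
Proof. by move=> [f' ff'] [g' gg']; exists (bmap F f' g'); apply: bmap_inverse. Qed.

End Bifunctor.

Section Monoidal.
Context {R : realType} {M : monCat R}.
Implicit Types U V W X Y Z : M.
Local Notation I := (unit_ob M).

Lemma lw1 X Y : X ◁ idm Y = idm (X ⊗ Y). Proof. exact: bmap1. Qed.

Lemma lwM X Y Y' Y'' (g : hom Y' Y'') (f : hom Y Y') :
  X ◁ (g ∘ f) = (X ◁ g) ∘ (X ◁ f).
Proof. by rewrite -bmapM comp1m. Qed.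

Lemma rwM X Y Y' Y'' (g : hom Y' Y'') (f : hom Y Y') :
  (g ∘ f) ▷ X = (g ▷ X) ∘ (f ▷ X).
Proof. by rewrite -bmapM comp1m. Qed.

Lemma tens_rl X X' Y Y' (f : hom X X') (g : hom Y Y') :
  (f ▷ Y') ∘ (X ◁ g) = f ⊛ g.
Proof. by rewrite -bmapM comp1m compm1. Qed.

Lemma tens_lr X X' Y Y' (f : hom X X') (g : hom Y Y') :
  (X' ◁ g) ∘ (f ▷ Y) = f ⊛ g.
Proof. by rewrite -bmapM comp1m compm1. Qed.

Lemma exch X X' Y Y' (f : hom X X') (g : hom Y Y') :
  (X' ◁ g) ∘ (f ▷ Y) = (f ▷ Y') ∘ (X ◁ g).
Proof. by rewrite tens_lr tens_rl. Qed.

Lemma assVK X Y Z : assV X Y Z ∘ ass X Y Z = idm _.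
Proof. by case: (assK X Y Z). Qed.

Lemma assKV X Y Z : ass X Y Z ∘ assV X Y Z = idm _.
Proof. by case: (assK X Y Z). Qed.

Lemma ass_iso X Y Z : is_iso (ass X Y Z).
Proof. by exists (assV X Y Z); apply: assK. Qed.

Lemma assV_iso X Y Z : is_iso (assV X Y Z).
Proof. by exists (ass X Y Z); apply/inverse_sym/assK. Qed.

Definition lunV X : hom X (I ⊗ X) := sval (cid (lun_iso X)).
Definition runV X : hom X (X ⊗ I) := sval (cid (run_iso X)).

Lemma lunKV X : lun X ∘ lunV X = idm _.
Proof. by rewrite /lunV; case: cid => ? []. Qed.
Lemma runVK X : runV X ∘ run X = idm _.
Proof. by rewrite /runV; case: cid => ? []. Qed.
Lemma runKV X : run X ∘ runV X = idm _.
Proof. by rewrite /runV; case: cid => ? []. Qed.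

Lemma runV_nat X X' (f : hom X X') : (f ▷ I) ∘ runV X = runV X' ∘ f.
Proof.
apply: (iso_lcancel (run_iso X')).
by rewrite !compA run_nat -!compA runKV compA runKV compm1 comp1m.
Qed.

Lemma ass_natl X X' Y Z (f : hom X X') :
  ass X' Y Z ∘ ((f ▷ Y) ▷ Z) = (f ▷ (Y ⊗ Z)) ∘ ass X Y Z.
Proof. by rewrite ass_nat lw1. Qed.

Lemma ass_natm X Y Y' Z (f : hom Y Y') :
  ass X Y' Z ∘ ((X ◁ f) ▷ Z) = (X ◁ (f ▷ Z)) ∘ ass X Y Z.
Proof. by rewrite ass_nat. Qed.

Lemma ass_natr X Y Z Z' (f : hom Z Z') :
  ass X Y Z' ∘ ((X ⊗ Y) ◁ f) = (X ◁ (Y ◁ f)) ∘ ass X Y Z.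
Proof. by rewrite -ass_nat lw1. Qed.

Lemma assV_nat X X' Y Y' Z Z' (f : hom X X') (g : hom Y Y') (h : hom Z Z') :
  assV X' Y' Z' ∘ (f ⊛ (g ⊛ h)) = ((f ⊛ g) ⊛ h) ∘ assV X Y Z.
Proof.
apply: (iso_lcancel (ass_iso _ _ _)); rewrite !compA assKV comp1m ass_nat.
by rewrite -compA assKV compm1.
Qed.

Lemma assV_natl X X' Y Z (f : hom X X') :
  assV X' Y Z ∘ (f ▷ (Y ⊗ Z)) = ((f ▷ Y) ▷ Z) ∘ assV X Y Z.
Proof. by rewrite -assV_nat lw1. Qed.

Lemma assV_natm X Y Y' Z (f : hom Y Y') :
  assV X Y' Z ∘ (X ◁ (f ▷ Z)) = ((X ◁ f) ▷ Z) ∘ assV X Y Z.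
Proof. by rewrite -assV_nat. Qed.

Lemma assV_natr X Y Z Z' (f : hom Z Z') :
  assV X Y Z' ∘ (X ◁ (Y ◁ f)) = ((X ⊗ Y) ◁ f) ∘ assV X Y Z.
Proof. by rewrite assV_nat lw1. Qed.

Lemma lw_inj X Y (f g : hom X Y) : I ◁ f = I ◁ g -> f = g.
Proof.
by move=> e; apply: (iso_rcancel (lun_iso X)); rewrite -!lun_nat e.
Qed.

Lemma rw_inj X Y (f g : hom X Y) : f ▷ I = g ▷ I -> f = g.
Proof.
by move=> e; apply: (iso_rcancel (run_iso X)); rewrite -!run_nat e.
Qed.

(** Kelly's argument: the functor of tensoring with the unit is faithful, so the equation may be
    checked after applying it, where it follows from the pentagon on I, I, X, Y and the triangle. *)
Lemma lun_tens X Y : lun (X ⊗ Y) ∘ ass I X Y = lun X ▷ Y.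
Proof.
apply: lw_inj; apply: (iso_rcancel (ass_iso _ _ _)).
apply: (iso_rcancel (f := ass I I X ▷ Y)).
  by apply: bmap_is_iso; [apply: ass_iso|apply: idm_iso].
rewrite lwM -compA -(compA (I ◁ _)) compA -(compA (I ◁ lun _)) (compA (I ◁ ass _ _ _)).
rewrite -pentagon compA triangle -ass_natl -ass_natm -compA -rwM.
by rewrite triangle.
Qed.

Lemma run_tens X Y : (X ◁ run Y) ∘ ass X Y I = run (X ⊗ Y).
Proof.
apply: rw_inj; apply: (iso_lcancel (ass_iso X Y I)).
rewrite -triangle compA ass_natr -compA pentagon !compA -lwM triangle.
by rewrite -ass_natm -compA -rwM.
Qed.

Lemma lun_run_unit : lun I = run I.
Proof.
have run11 : run I ▷ I = run (I ⊗ I).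
  by apply: (iso_lcancel (run_iso I)); rewrite run_nat.
apply: lw_inj; apply: (iso_rcancel (ass_iso I I I)).
by rewrite triangle run_tens run11.
Qed.

End Monoidal.

(** Key locking the operators [pair_at], [copair_at] and [mor_at], so that rewriting treats them as
    atoms. *)
Fact rlang_key : unit. Proof. by []. Qed.

(** * Duality *)

Section Duals.
Context {R : realType} {M : monCat R}.
Implicit Types U V W X Y Z P Q : M.
Local Notation I := (unit_ob M).

(** The pairing [e] applied to the last two letters of a word bracketed to the left. String diagrams
    are written with such words and with operators acting at their right end, so that associators
    show up only in the lemmas that add a letter on the left. *)
Definition pair_at P Q (e : hom (P ⊗ Q) I) Z : hom (Z ⊗ P ⊗ Q) Z :=
  locked_with rlang_key (run Z ∘ (Z ◁ e) ∘ ass Z P Q).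

Lemma pair_atE P Q (e : hom (P ⊗ Q) I) Z : pair_at e Z = run Z ∘ (Z ◁ e) ∘ ass Z P Q.
Proof. by rewrite /pair_at unlock. Qed.

Definition copair_at P Q (c : hom I (P ⊗ Q)) Z : hom Z (Z ⊗ P ⊗ Q) :=
  locked_with rlang_key (assV Z P Q ∘ (Z ◁ c) ∘ runV Z).

Lemma copair_atE P Q (c : hom I (P ⊗ Q)) Z :
  copair_at c Z = assV Z P Q ∘ (Z ◁ c) ∘ runV Z.
Proof. by rewrite /copair_at unlock. Qed.

Lemma pair_nat P Q (e : hom (P ⊗ Q) I) Z Z' (f : hom Z Z') :
  pair_at e Z' ∘ (f ▷ P ▷ Q) = f ∘ pair_at e Z.
Proof.
by rewrite !pair_atE (c22 (ass_natl _ _ _)) (c22 (exch _ _)) run_nat !compA.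
Qed.

Lemma copair_nat P Q (c : hom I (P ⊗ Q)) Z Z' (f : hom Z Z') :
  (f ▷ P ▷ Q) ∘ copair_at c Z = copair_at c Z' ∘ f.
Proof.
rewrite !copair_atE -(c22 (runV_nat f)) (c22 (exch f c)) assV_natl.
by rewrite !compA.
Qed.

Lemma pair_lw P Q (e : hom (P ⊗ Q) I) U Z :
  pair_at e (U ⊗ Z) =
  (U ◁ pair_at e Z) ∘ ass U (Z ⊗ P) Q ∘ (ass U Z P ▷ Q).
Proof.
rewrite !pair_atE !lwM -(c23 (pentagon _ _ _ _)) -(c22 (ass_natr _ _ _)).
by rewrite run_tens.
Qed.

Lemma assV_pentagon U Z P Q :
  assV (U ⊗ Z) P Q ∘ assV U Z (P ⊗ Q) =
  (assV U Z P ▷ Q) ∘ assV U (Z ⊗ P) Q ∘ (U ◁ assV Z P Q).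
Proof.
apply: (iso_lcancel (g := ass U Z (P ⊗ Q) ∘ ass (U ⊗ Z) P Q)).
  by apply: iso_comp; apply: ass_iso.
rewrite !compA (c21 (assKV _ _ _)) compm1 assKV pentagon.
rewrite -[_ ∘ (ass _ _ _ ▷ _) ∘ (assV _ _ _ ▷ _)]compA -rwM assKV bmap1 compm1 (c21 (assKV _ _ _)) compm1.
by rewrite -lwM assKV lw1.
Qed.

Lemma copair_lw P Q (c : hom I (P ⊗ Q)) U Z :
  copair_at c (U ⊗ Z) =
  (assV U Z P ▷ Q) ∘ assV U (Z ⊗ P) Q ∘ (U ◁ copair_at c Z).
Proof.
rewrite !copair_atE !lwM !compA -assV_pentagon (c22 (assV_natr _ _ _)) -!compA.
congr (_ ∘ (_ ∘ _)); apply: (iso_lcancel (run_iso _)).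
rewrite runKV -run_tens !compA (c21 (assKV _ _ _)) compm1 -lwM.
by rewrite runKV lw1.
Qed.

Lemma pair_bmap P P' Q Q' (e : hom (P' ⊗ Q') I) (f : hom P P') (g : hom Q Q') Z :
  pair_at (e ∘ (f ⊛ g)) Z = pair_at e Z ∘ ((Z ◁ f) ⊛ g).
Proof. by rewrite !pair_atE lwM !compA (c22 (ass_nat _ _ _)). Qed.

Lemma copair_bmap P P' Q Q' (c : hom I (P ⊗ Q)) (f : hom P P') (g : hom Q Q') Z :
  copair_at ((f ⊛ g) ∘ c) Z = ((Z ◁ f) ⊛ g) ∘ copair_at c Z.
Proof. by rewrite !copair_atE lwM !compA assV_nat. Qed.

Lemma pair_unit P Q (e : hom (P ⊗ Q) I) : pair_at e I = e ∘ (lun P ▷ Q).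
Proof. by rewrite pair_atE -lun_run_unit lun_nat -compA lun_tens. Qed.

Lemma lunV_tens X Y : ass I X Y ∘ (lunV X ▷ Y) = lunV (X ⊗ Y).
Proof.
apply: (iso_lcancel (lun_iso _)); rewrite compA lun_tens lunKV.
by rewrite -rwM lunKV bmap1.
Qed.

Lemma rw_assKV X Y Z W : (ass X Y Z ▷ W) ∘ (assV X Y Z ▷ W) = idm _.
Proof. by rewrite -rwM assKV bmap1. Qed.

Lemma rw_assVK X Y Z W : (assV X Y Z ▷ W) ∘ (ass X Y Z ▷ W) = idm _.
Proof. by rewrite -rwM assVK bmap1. Qed.

Lemma lw_assKV X Y Z W : (W ◁ ass X Y Z) ∘ (W ◁ assV X Y Z) = idm _.
Proof. by rewrite -lwM assKV bmap1. Qed.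

Lemma lw_assVK X Y Z W : (W ◁ assV X Y Z) ∘ (W ◁ ass X Y Z) = idm _.
Proof. by rewrite -lwM assVK bmap1. Qed.

Section DualData.
Context {X Xs : M} {ev : hom (Xs ⊗ X) I} {coev : hom I (X ⊗ Xs)}.

Lemma dual_data_alt : dual_data (X := X) (Xs := Xs) ev coev <->
  pair_at ev X ∘ (coev ▷ X) = lun X /\ (ev ▷ Xs) ∘ copair_at coev Xs = lunV Xs.
Proof.
rewrite /dual_data -pair_atE; split=> -[d1 d2]; split=> //.
  apply: (iso_lcancel (lun_iso _)); rewrite copair_atE !compA d2 runKV.
  by rewrite lunKV.
move/(congr1 (fun f => lun Xs ∘ f ∘ run Xs)): d2.
by rewrite lunKV comp1m copair_atE !compA (c21 (runVK _)) compm1.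
Qed.

Context (dd : dual_data (X := X) (Xs := Xs) ev coev).

Lemma zigzag1 Z : pair_at ev (Z ⊗ X) ∘ (copair_at coev Z ▷ X) = idm (Z ⊗ X).
Proof.
have [d1 _] := dual_data_alt.1 dd.
rewrite pair_lw copair_atE !rwM !compA.
rewrite (c21 (rw_assKV _ _ _ _)) compm1.
rewrite (c22 (ass_natm _ _ _)) -lwM d1 triangle -rwM.
by rewrite runKV bmap1.
Qed.

Lemma zigzag2 Z : (pair_at ev Z ▷ Xs) ∘ copair_at coev (Z ⊗ Xs) = idm (Z ⊗ Xs).
Proof.
have [_ d2] := dual_data_alt.1 dd.
rewrite copair_lw pair_atE !rwM -triangle !compA.
rewrite (c21 (rw_assKV _ _ _ _)) compm1.
rewrite (c22 (ass_natm _ _ _)) (c21 (assKV _ _ _)) compm1 -!lwM -compA d2.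
by rewrite lunKV lw1.
Qed.

(** Frobenius reciprocity; the zigzag identities say that the two maps are mutually inverse. *)
Lemma vdim_adj V W : vdim (hom (V ⊗ X) W) = vdim (hom V (W ⊗ Xs)).
Proof.
apply: (@vdim_bij _ _ _ (fun f => (f ▷ Xs) ∘ copair_at coev V)).
  by move=> a f g; rewrite bmap_linl comp_linl.
exists (fun g => pair_at ev W ∘ (g ▷ X)) => f.
  by rewrite rwM compA pair_nat -compA zigzag1 compm1.
by rewrite rwM -compA copair_nat compA zigzag2 comp1m.
Qed.

End DualData.

Section ProductDual.
Context {X Xs Y Ys : M}.
Context {evX : hom (Xs ⊗ X) I} {coevX : hom I (X ⊗ Xs)}.
Context {evY : hom (Ys ⊗ Y) I} {coevY : hom I (Y ⊗ Ys)}.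

Definition ev_tens (evX : hom (Xs ⊗ X) I) (evY : hom (Ys ⊗ Y) I) :
    hom (Ys ⊗ Xs ⊗ (X ⊗ Y)) I :=
  evY ∘ (pair_at evX Ys ▷ Y) ∘ assV (Ys ⊗ Xs) X Y.

Definition coev_tens (coevX : hom I (X ⊗ Xs)) (coevY : hom I (Y ⊗ Ys)) :
    hom I (X ⊗ Y ⊗ (Ys ⊗ Xs)) :=
  ass (X ⊗ Y) Ys Xs ∘ (copair_at coevY X ▷ Xs) ∘ coevX.

Lemma pair_ev_tens Z : pair_at (ev_tens evX evY) Z =
  pair_at evY Z ∘ (pair_at evX (Z ⊗ Ys) ▷ Y) ∘ assV (Z ⊗ Ys ⊗ Xs) X Y
    ∘ (assV Z Ys Xs ▷ (X ⊗ Y)).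
Proof.
rewrite /ev_tens (pair_atE (_ ∘ _)) !lwM !compA (pair_lw evX) !rwM !compA.
rewrite (pair_atE evY Z) (c22 (ass_natm _ _ _)) -(c22 (assV_natl _ _ _)).
rewrite (c21 (rw_assKV _ _ _ _)) compm1.
have e : ass Z (Ys ⊗ Xs ⊗ X) Y ∘ (ass Z (Ys ⊗ Xs) X ▷ Y) ∘ assV (Z ⊗ (Ys ⊗ Xs)) X Y
    = (Z ◁ assV (Ys ⊗ Xs) X Y) ∘ ass Z (Ys ⊗ Xs) (X ⊗ Y).
  apply: (iso_rcancel (ass_iso (Z ⊗ (Ys ⊗ Xs)) X Y)).
  apply: (iso_lcancel (g := Z ◁ ass (Ys ⊗ Xs) X Y)).
    by apply: bmap_is_iso; [apply: idm_iso|apply: ass_iso].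
  by rewrite (c21 (assVK _ _ _)) compm1 !compA lw_assKV comp1m pentagon.
by rewrite (c32 e).
Qed.

Lemma copair_coev_tens Z : copair_at (coev_tens coevX coevY) Z =
  (ass Z X Y ▷ (Ys ⊗ Xs)) ∘ ass (Z ⊗ X ⊗ Y) Ys Xs
    ∘ (copair_at coevY (Z ⊗ X) ▷ Xs) ∘ copair_at coevX Z.
Proof.
rewrite /coev_tens (copair_atE (_ ∘ _)) !lwM !compA (copair_lw coevY) !rwM !compA.
rewrite (c22 (ass_natl _ _ _)) rw_assKV comp1m (copair_atE coevX Z) !compA.
rewrite -(c22 (assV_natm _ _ _)).
have e : ass (Z ⊗ (X ⊗ Y)) Ys Xs ∘ (assV Z (X ⊗ Y) Ys ▷ Xs) ∘ assV Z (X ⊗ Y ⊗ Ys) Xs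
    = assV Z (X ⊗ Y) (Ys ⊗ Xs) ∘ (Z ◁ ass (X ⊗ Y) Ys Xs).
  apply: (iso_lcancel (ass_iso Z (X ⊗ Y) (Ys ⊗ Xs))).
  rewrite !compA assKV comp1m pentagon (c21 (rw_assKV _ _ _ _)) compm1.
  by rewrite (c21 (assKV _ _ _)) compm1.
by rewrite e.
Qed.

Lemma dual_data_tens : dual_data (X := X) (Xs := Xs) evX coevX ->
  dual_data (X := Y) (Xs := Ys) evY coevY ->
  dual_data (X := X ⊗ Y) (Xs := Ys ⊗ Xs) (ev_tens evX evY) (coev_tens coevX coevY).
Proof.
move=> ddX ddY; apply/dual_data_alt.
have [dX _] := dual_data_alt.1 ddX; have [_ dY] := dual_data_alt.1 ddY.
split.
  rewrite pair_ev_tens /coev_tens !rwM !compA.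
  rewrite (c21 (rw_assVK _ _ _ _)) compm1 (c22 (assV_natl _ _ _)).
  rewrite (c22 (assV_natl _ _ _)) -[_ ∘ (pair_at _ _ ▷ Y) ∘ _]compA -rwM pair_nat.
  rewrite rwM compA (zigzag1 ddY) comp1m -rwM dX -lun_tens (c21 (assKV _ _ _)).
  by rewrite compm1.
rewrite copair_coev_tens /ev_tens !rwM !compA (c21 (rw_assVK _ _ _ _)) compm1.
rewrite -(c22 (ass_natl _ _ _)) -(ass_natl _ _ evY) -!compA.
rewrite (compA (pair_at evX Ys ▷ Y ▷ Ys ▷ Xs)) -rwM copair_nat rwM -compA.
by rewrite (zigzag2 ddX) compm1 -rwM dY lunV_tens.
Qed.

End ProductDual.
End Duals.

Section MorAt.
Context {R : realType} {M : monCat R}.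
Implicit Types U V W X Y Z P Q : M.
Local Notation I := (unit_ob M).

Definition mor_at X Y P Q (φ : hom (X ⊗ Y) (P ⊗ Q)) Z : hom (Z ⊗ X ⊗ Y) (Z ⊗ P ⊗ Q) :=
  locked_with rlang_key (assV Z P Q ∘ (Z ◁ φ) ∘ ass Z X Y).

Lemma mor_atE X Y P Q (φ : hom (X ⊗ Y) (P ⊗ Q)) Z :
  mor_at φ Z = assV Z P Q ∘ (Z ◁ φ) ∘ ass Z X Y.
Proof. by rewrite /mor_at unlock. Qed.

Lemma mor_atM X Y P Q P' Q' (ψ : hom (P ⊗ Q) (P' ⊗ Q')) (φ : hom (X ⊗ Y) (P ⊗ Q)) Z :
  mor_at (ψ ∘ φ) Z = mor_at ψ Z ∘ mor_at φ Z.
Proof. by rewrite !mor_atE lwM !compA (c21 (assKV _ _ _)) compm1. Qed.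

Lemma mor_at1 X Y Z : mor_at (idm (X ⊗ Y)) Z = idm _.
Proof. by rewrite mor_atE lw1 compm1 assVK. Qed.

Lemma mor_at_bmap X Y P Q (f : hom X P) (g : hom Y Q) Z :
  mor_at (f ⊛ g) Z = (Z ◁ f) ⊛ g.
Proof. by rewrite mor_atE assV_nat -compA assVK compm1. Qed.

Lemma mor_nat X Y P Q (φ : hom (X ⊗ Y) (P ⊗ Q)) Z Z' (f : hom Z Z') :
  mor_at φ Z' ∘ (f ▷ X ▷ Y) = (f ▷ P ▷ Q) ∘ mor_at φ Z.
Proof. by rewrite !mor_atE !compA -assV_natl -(c22 (exch _ _)) (c22 (ass_natl _ _ _)). Qed.

Lemma pair_mor X Y P Q (e : hom (P ⊗ Q) I) (φ : hom (X ⊗ Y) (P ⊗ Q)) Z :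
  pair_at (e ∘ φ) Z = pair_at e Z ∘ mor_at φ Z.
Proof. by rewrite !pair_atE mor_atE lwM !compA (c21 (assKV _ _ _)) compm1. Qed.

End MorAt.

(** * Braidings, twists and traces *)

Section Braiding.
Context {R : realType} {C : braidCat R}.
Implicit Types U V W X Y Z P Q : C.
Local Notation I := (unit_ob C).

Lemma br_natl X X' Y (f : hom X X') : br X' Y ∘ (f ▷ Y) = (Y ◁ f) ∘ br X Y.
Proof. exact: br_nat. Qed.

Lemma br_natr X Y Y' (f : hom Y Y') : br X Y' ∘ (X ◁ f) = (f ▷ X) ∘ br X Y.
Proof. exact: br_nat. Qed.

Lemma run_unit X : run (X ⊗ I) = run X ▷ I.
Proof. by apply: (iso_lcancel (run_iso X)); rewrite run_nat. Qed.

(** In the first hexagon on X, I, I, the unit constraints leave [lun X ∘ br X I] as a common left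
    factor. Cancelling it gives the equation tensored with I. *)
Lemma br_unitr X : lun X ∘ br X I = run X.
Proof.
have := congr1 (comp (lun X ∘ (I ◁ lun X))) (hexagon1 X I I).
rewrite !compA (c21 (triangle _ _)) -(c22 (br_natr _ _)) (c21 (run_tens _ _)).
rewrite run_unit (lun_nat (lun X)) (c22 (lun_nat (br X I))) (c21 (lun_tens _ _)).
rewrite -[in RHS]compA -rwM => e; apply: rw_inj; apply: iso_lcancel (esym e).
by apply: iso_comp; [apply: br_iso|apply: lun_iso].
Qed.

Lemma br_unitl X : run X ∘ br I X = lun X.
Proof.
have := congr1 (comp (run X ∘ (run X ▷ I))) (hexagon2 I I X).
have tr Y Z : (run Y ▷ Z) ∘ assV Y I Z = Y ◁ lun Z.
  by rewrite -triangle -compA assKV compm1.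
have tr' : run (I ⊗ X) ∘ assV I X I = I ◁ run X.
  by rewrite -run_tens -compA assKV compm1.
rewrite !compA (c21 (tr _ _)) -(c22 (br_natl _ _)) lun_run_unit.
rewrite (c21 (tr _ _)) (run_nat (run X)) (c22 (run_nat (br I X))) (c21 tr').
rewrite -[in RHS]compA -lwM => e; apply/esym/lw_inj; apply: iso_lcancel e.
by apply: iso_comp; [apply: br_iso|apply: run_iso].
Qed.

Local Notation bat X Y Z := (mor_at (br X Y) Z).

Lemma bat_natl X X' Y Z (f : hom X X') :
  bat X' Y Z ∘ ((Z ◁ f) ▷ Y) = ((Z ⊗ Y) ◁ f) ∘ bat X Y Z.
Proof. by rewrite -mor_at_bmap -mor_atM br_natl mor_atM mor_at_bmap lw1. Qed.

Lemma bat_natr X Y Y' Z (f : hom Y Y') :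
  bat X Y' Z ∘ ((Z ⊗ X) ◁ f) = ((Z ◁ f) ▷ X) ∘ bat X Y Z.
Proof. have := mor_at_bmap (idm X) f Z; rewrite lw1 => <-.
by rewrite -mor_atM br_natr mor_atM mor_at_bmap. Qed.

(** The hexagon with crossings at the right end of a left-bracketed word. *)
Lemma hex2_at X Y W Z : (bat X W Z ▷ Y) ∘ bat Y W (Z ⊗ X) =
  assV (Z ⊗ W) X Y ∘ bat (X ⊗ Y) W Z ∘ (ass Z X Y ▷ W).
Proof.
have p1 : (ass Z X W ▷ Y) ∘ assV (Z ⊗ X) W Y =
    assV Z (X ⊗ W) Y ∘ (Z ◁ assV X W Y) ∘ ass Z X (W ⊗ Y).
  apply: (iso_lcancel (g := (Z ◁ ass X W Y) ∘ ass Z (X ⊗ W) Y)).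
    by apply: iso_comp; [apply: ass_iso|apply: bmap_is_iso; [apply: idm_iso|apply: ass_iso]].
  rewrite !compA -pentagon (c21 (assKV _ _ _)) compm1 (c21 (assKV _ _ _)) compm1.
  by rewrite lw_assKV comp1m.
rewrite !mor_atE !rwM !compA (c23 p1) (c22 (ass_natr _ _ _)) (c23 (pentagon _ _ _ _)).
rewrite -(c22 (assV_natm _ _ _)) assV_pentagon.
have := congr1 (fun f => Z ◁ f) (hexagon2 X Y W); rewrite !lwM => h.
by rewrite -(c33 h) (c21 (lw_assVK _ _ _ _)) compm1.
Qed.

Lemma hex1_at X Y W Z : bat W Y (Z ⊗ X) ∘ (bat W X Z ▷ Y) =
  (assV Z X Y ▷ W) ∘ bat W (X ⊗ Y) Z ∘ ass (Z ⊗ W) X Y.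
Proof.
rewrite !mor_atE !rwM !compA.
have p2 : ass (Z ⊗ X) W Y ∘ (assV Z X W ▷ Y) =
    assV Z X (W ⊗ Y) ∘ (Z ◁ ass X W Y) ∘ ass Z (X ⊗ W) Y.
  apply: (iso_lcancel (ass_iso Z X (W ⊗ Y))).
  rewrite !compA pentagon (c21 (rw_assKV _ _ _ _)) compm1.
  by rewrite assKV comp1m.
rewrite (c23 p2) -(c22 (assV_natr _ _ _)) (c22 (ass_natm _ _ _)).
have := congr1 (fun f => Z ◁ f) (hexagon1 W X Y); rewrite !lwM => h.
rewrite -(c33 h) assV_pentagon (c21 (lw_assVK _ _ _ _)) compm1.
by rewrite (c23 (pentagon _ _ _ _)).
Qed.

Lemma bat_unitr X Z : (run Z ▷ X) ∘ bat X I Z = run (Z ⊗ X).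
Proof.
rewrite mor_atE -triangle !compA (c21 (assKV _ _ _)) compm1.
by rewrite -lwM br_unitr run_tens.
Qed.

Lemma bat_unitl X Z : run (Z ⊗ X) ∘ bat I X Z = run Z ▷ X.
Proof.
rewrite mor_atE -run_tens !compA (c21 (assKV _ _ _)) compm1.
by rewrite -lwM br_unitl triangle.
Qed.

(** A strand [W] that crosses both legs of a pairing can be pulled off it, by naturality of the
    braiding. *)
Lemma pair_slidel P Q (e : hom (P ⊗ Q) I) W Z :
  (pair_at e Z ▷ W) ∘ bat W Q (Z ⊗ P) ∘ (bat W P Z ▷ Q) = pair_at e (Z ⊗ W).
Proof.
rewrite (c23 (hex1_at P Q W Z)) !pair_atE !rwM (c21 (rw_assKV _ _ _ _)) compm1.
by rewrite -(c22 (bat_natr _ _ _)) bat_unitr.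
Qed.

Section Twist.
Context (theta : forall X : C, hom X X) (rib : is_ribbon theta).

(** The twist turns the left dual [Xs] into a right dual; this is its evaluation, the one that
    closes the loop in [ribbon_trace]. *)
Definition ev_twist X Xs (ev : hom (Xs ⊗ X) I) : hom (X ⊗ Xs) I :=
  ev ∘ br X Xs ∘ (theta X ▷ Xs).

Lemma pair_ev_twist X Xs (ev : hom (Xs ⊗ X) I) Z :
  pair_at (ev_twist ev) Z = pair_at ev Z ∘ bat X Xs Z ∘ ((Z ◁ theta X) ▷ Xs).
Proof. by rewrite /ev_twist pair_bmap pair_mor. Qed.

(** Pulling the [Y] loop across the strand of [X] creates a double braiding of [X] with [Y], which
    is exactly the one that the axiom [ribbon_tens] puts into the twist of the product. *)
Lemma pair_ev_twist_tens X Xs (evX : hom (Xs ⊗ X) I) Y Ys (evY : hom (Ys ⊗ Y) I) Z :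
  pair_at (ev_twist (ev_tens evX evY)) Z ∘ (ass Z X Y ▷ (Ys ⊗ Xs))
    ∘ ass (Z ⊗ X ⊗ Y) Ys Xs =
  pair_at (ev_twist evX) Z ∘ (pair_at (ev_twist evY) (Z ⊗ X) ▷ Xs).
Proof.
have -> : pair_at (ev_twist evX) Z ∘ (pair_at (ev_twist evY) (Z ⊗ X) ▷ Xs) =
    pair_at evX Z ∘ bat X Xs Z ∘ (pair_at evY (Z ⊗ X) ▷ Xs)
    ∘ (bat Y Ys (Z ⊗ X) ▷ Xs) ∘ (((Z ◁ theta X) ⊛ theta Y) ▷ Ys ▷ Xs).
  rewrite !pair_ev_twist -(tens_rl (Z ◁ theta X) (theta Y)) !rwM !compA.
  have e1 := congr1 (fun f => f ▷ Xs) (pair_nat evY (Z ◁ theta X)).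
  have e2 := congr1 (fun f => f ▷ Xs) (mor_nat (br Y Ys) (Z ◁ theta X)).
  by move: e1 e2; rewrite !rwM => e1 e2; rewrite -(c22 e1) -(c22 e2).
have e3 : pair_at evX Z ∘ bat X Xs Z ∘ (pair_at evY (Z ⊗ X) ▷ Xs) =
    pair_at evY Z ∘ (pair_at evX (Z ⊗ Ys) ▷ Y) ∘ (bat X Xs (Z ⊗ Ys) ▷ Y)
    ∘ bat Y Xs (Z ⊗ Ys ⊗ X) ∘ (bat Y X (Z ⊗ Ys) ▷ Xs) ∘ (bat X Y (Z ⊗ Ys) ▷ Xs)
    ∘ (bat X Ys Z ▷ Y ▷ Xs).
  rewrite -[pair_at evY (Z ⊗ X)]pair_slidel !rwM !compA (c22 (mor_nat _ _)) pair_nat.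
  rewrite (c21 (esym (pair_mor evX (br X Xs) _))) -(pair_slidel (evX ∘ br X Xs)) pair_mor !rwM.
  by rewrite !compA.
rewrite {}e3 pair_ev_twist pair_ev_tens.
rewrite -(c22 (ass_natl _ _ _)) -(c22 (ass_natl _ _ _)) -(c23 (hex1_at Ys Xs (X ⊗ Y) Z)).
rewrite (ribbon_tens rib) lwM !rwM !compA.
have e4 := congr1 (fun f => f ▷ Ys ▷ Xs) (ass_nat (idm Z) (theta X) (theta Y)).
have e5 := congr1 (fun f => f ▷ Xs) (bat_natl Ys Z (br Y X ∘ br X Y)).
have e6 := congr1 (fun f => f ▷ Xs) (hex2_at X Y Ys Z).
move: e4 e5 e6; rewrite !rwM => e4 e5 e6.
rewrite -(c22 e4) (c22 e5) (c23 e6) (c23 (hex2_at X Y Xs (Z ⊗ Ys))).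
congr (_ ∘ _ ∘ _ ∘ _); rewrite -!compA; congr (_ ∘ (_ ∘ (_ ∘ (_ ∘ _)))).
rewrite -!rwM (compA (bat Y X _)) -mor_atM mor_atE !compA assKV comp1m.
rewrite -[in RHS]compA assKV.
by rewrite compm1.
Qed.

Section Trace.
Context {X Xs : C} (ev : hom (Xs ⊗ X) I) (coev : hom I (X ⊗ Xs)).

Definition ptrace (V : C) (F : hom (V ⊗ X) (V ⊗ X)) : hom V V :=
  pair_at (ev_twist ev) V ∘ (F ▷ Xs) ∘ copair_at coev V.

Definition ltrace (f : hom X X) : hom I I := ev_twist ev ∘ (f ▷ Xs) ∘ coev.

End Trace.

Section TraceTens.
Context {X Xs : C} (evX : hom (Xs ⊗ X) I) (coevX : hom I (X ⊗ Xs)).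
Context {Y Ys : C} (evY : hom (Ys ⊗ Y) I) (coevY : hom I (Y ⊗ Ys)).

Lemma ltrace_tens (F : hom (X ⊗ Y) (X ⊗ Y)) :
  ltrace (ev_tens evX evY) (coev_tens coevX coevY) F =
  ltrace evX coevX (ptrace evY coevY F).
Proof.
have pI P Q (e : hom (P ⊗ Q) I) : e = pair_at e I ∘ (lunV P ▷ Q).
  by rewrite pair_unit -compA -rwM lunKV bmap1 compm1.
rewrite /ltrace [in LHS](pI _ _ (ev_twist _)) /coev_tens !compA.
rewrite -lunV_tens !rwM !compA -(c22 (ass_natl _ _ F)) -(c22 (ass_natl _ _ (lunV X ▷ Y))) pair_ev_twist_tens.
rewrite -[_ ∘ (lunV X ▷ Y ▷ Ys ▷ Xs)]compA -rwM pair_nat rwM !compA -pI.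
by [].
Qed.

Lemma ptrace_tens (V : C) (F : hom (V ⊗ (X ⊗ Y)) (V ⊗ (X ⊗ Y))) :
  ptrace (ev_tens evX evY) (coev_tens coevX coevY) F =
  ptrace evX coevX (ptrace evY coevY (assV V X Y ∘ F ∘ ass V X Y)).
Proof.
rewrite /ptrace copair_coev_tens !compA.
have e : F ∘ ass V X Y = ass V X Y ∘ (assV V X Y ∘ F ∘ ass V X Y).
  by rewrite !compA assKV comp1m.
rewrite -[_ ∘ (ass V X Y ▷ _)]compA -[(F ▷ _) ∘ _]rwM e rwM !compA.
rewrite -(c22 (ass_natl _ _ _)) pair_ev_twist_tens !rwM !compA.
by [].
Qed.

End TraceTens.

End Twist.

End Braiding.

(** * Cyclicity of traces *)

Section Cyclicity.
Context {R : realType} {C : braidCat R}.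
Context (theta : forall X : C, hom X X) (rib : is_ribbon theta).
Implicit Types U V W X Y Z P Q : C.
Local Notation I := (unit_ob C).

Section Transpose.
Context {X Xs : C} {evX : hom (Xs ⊗ X) I} {coevX : hom I (X ⊗ Xs)}.
Context (ddX : dual_data (X := X) (Xs := Xs) evX coevX).
Context {Y Ys : C} {evY : hom (Ys ⊗ Y) I} {coevY : hom I (Y ⊗ Ys)}.
Context (ddY : dual_data (X := Y) (Xs := Ys) evY coevY).

Definition transpose (g : hom Y X) : hom Xs Ys :=
  lun Ys ∘ ((evX ∘ (Xs ◁ g)) ▷ Ys) ∘ copair_at coevY Xs.

Lemma ev_transpose g : evY ∘ (transpose g ▷ Y) = evX ∘ (Xs ◁ g).
Proof.
rewrite /transpose; set k := evX ∘ _; rewrite (rwM _ _ (copair_at _ _)) rwM.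
by rewrite !compA -pair_unit pair_nat -compA (zigzag1 ddY) compm1.
Qed.

Lemma coev_transpose g : (X ◁ transpose g) ∘ coevX = (g ▷ Ys) ∘ coevY.
Proof.
have [dX _] := dual_data_alt.1 ddX; have [dY _] := dual_data_alt.1 ddY.
have inj (u u' : hom I (X ⊗ Ys)) :
    pair_at evY X ∘ (u ▷ Y) = pair_at evY X ∘ (u' ▷ Y) -> u = u'.
  move=> /(congr1 (fun f => (f ▷ Ys) ∘ copair_at coevY I)).
  by rewrite !rwM -!compA !copair_nat !compA !(zigzag2 ddY) !comp1m.
apply: inj; rewrite !rwM !compA pair_nat -[RHS]compA dY -pair_bmap.
rewrite ev_transpose pair_bmap lw1 -compA exch compA dX.
by rewrite lun_nat.
Qed.

Lemma ev_twist_transpose g :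
  ev_twist theta evX ∘ (g ▷ Xs) = ev_twist theta evY ∘ (Y ◁ transpose g).
Proof.
rewrite /ev_twist -[_ ∘ (g ▷ Xs)]compA -rwM (ribbon_nat rib) rwM !compA.
rewrite (c22 (br_natl _ _)) -ev_transpose -(c22 (br_natr _ _)).
by rewrite (c22 (exch _ _)).
Qed.

(** The morphism [g] travels around the loop: as its transpose through the evaluation, by naturality
    of braiding and twist, then back through the coevaluation. The two duals are arbitrary, so the
    case of an identity shows that the trace does not depend on the dual. *)
Lemma ltrace_cyclic (f : hom X Y) (g : hom Y X) :
  ltrace theta evX coevX (g ∘ f) = ltrace theta evY coevY (f ∘ g).
Proof.
rewrite /ltrace !rwM !compA ev_twist_transpose (c22 (exch _ _)).
by rewrite (c22 (coev_transpose _)).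
Qed.

Lemma ptrace_cyclic V (f : hom (V ⊗ X) (V ⊗ Y)) (g : hom Y X) :
  ptrace theta evX coevX ((V ◁ g) ∘ f) = ptrace theta evY coevY (f ∘ (V ◁ g)).
Proof.
rewrite /ptrace !rwM !compA -pair_bmap ev_twist_transpose pair_bmap lw1.
rewrite (c22 (exch _ _)) -!compA; congr (_ ∘ (_ ∘ _)).
have := copair_bmap coevY g (idm Ys) V; rewrite -coev_transpose copair_bmap lw1.
by [].
Qed.

End Transpose.
End Cyclicity.

(** * The scalar of a loop around a simple object *)

Section Encircling.
Context {R : realType} {C : braidFusCat R}.
Context (theta : forall X : C, hom X X) (rib : is_ribbon theta).
Notation K := (R[i]%C).
Implicit Types U V W X Y Z P Q : C.
Local Notation I := (unit_ob C).

Let fus : is_fusion C := braidfus_fusion C.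

Lemma endo_scal V (f : hom V V) : simple V -> exists c : K, f = c *: idm V.
Proof. exact: (schur_scal (fusion_abelian fus) (fusion_homfin fus)). Qed.

Lemma scal_inj V (a b : K) : simple V -> a *: idm V = b *: idm V -> a = b.
Proof.
case=> V0 _ /eqP; rewrite -subr_eq0 -scalerBl scaler_eq0 subr_eq0.
by move=> /orP[/eqP //|/eqP].
Qed.

Definition monodromy V X : hom (V ⊗ X) (V ⊗ X) := br X V ∘ br V X.

Lemma monodromy_natr V X Y (f : hom X Y) :
  monodromy V Y ∘ (V ◁ f) = (V ◁ f) ∘ monodromy V X.
Proof. by rewrite /monodromy -compA br_natr !compA br_natl. Qed.

Lemma monodromy_natl V W X (f : hom V W) :
  monodromy W X ∘ (f ▷ X) = (f ▷ X) ∘ monodromy V X.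
Proof. by rewrite /monodromy -compA br_natl !compA br_natr. Qed.

(** A loop of [V] around the product is the loop around [Y] conjugated by the crossings with [X], by
    the two hexagons. *)
Lemma monodromy_tens V X Y : assV V X Y ∘ monodromy V (X ⊗ Y) ∘ ass V X Y =
  (br X V ▷ Y) ∘ (assV X V Y ∘ (X ◁ monodromy V Y) ∘ ass X V Y) ∘ (br V X ▷ Y).
Proof.
have h1 : br V (X ⊗ Y) ∘ ass V X Y =
    assV X Y V ∘ (X ◁ br V Y) ∘ ass X V Y ∘ (br V X ▷ Y).
  apply: (iso_lcancel (ass_iso X Y V)); rewrite compA hexagon1.
  by rewrite !compA assKV comp1m.
have h2 : assV V X Y ∘ br (X ⊗ Y) V = (br X V ▷ Y) ∘ assV X V Y ∘ (X ◁ br Y V) ∘ ass X Y V.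
  by apply: (iso_rcancel (assV_iso X Y V)); rewrite hexagon2 (c21 (assKV _ _ _)) compm1.
rewrite /monodromy lwM !compA h2 -[_ ∘ ass V X Y]compA h1 !compA.
by rewrite (c21 (assKV _ _ _)) compm1.
Qed.

Lemma ptrace_lw X Xs (ev : hom (Xs ⊗ X) I) (coev : hom I (X ⊗ Xs)) U V
    (F : hom (V ⊗ X) (V ⊗ X)) :
  ptrace theta ev coev (assV U V X ∘ (U ◁ F) ∘ ass U V X) =
  U ◁ ptrace theta ev coev F.
Proof.
rewrite /ptrace pair_lw copair_lw !lwM !rwM !compA.
rewrite (c21 (rw_assKV _ _ _ _)) compm1 (c21 (rw_assKV _ _ _ _)) compm1.
by rewrite (c22 (ass_natm _ _ _)) (c21 (assKV _ _ _)) compm1.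
Qed.

Lemma ptrace_conj X Xs (ev : hom (Xs ⊗ X) I) (coev : hom I (X ⊗ Xs)) V W
    (f : hom W V) (g : hom V W) (F : hom (V ⊗ X) (V ⊗ X)) :
  ptrace theta ev coev ((g ▷ X) ∘ F ∘ (f ▷ X)) = g ∘ ptrace theta ev coev F ∘ f.
Proof.
by rewrite /ptrace !rwM !compA pair_nat -[_ ∘ _ ∘ copair_at coev W]compA copair_nat !compA.
Qed.

Lemma ptrace_lin X Xs (ev : hom (Xs ⊗ X) I) (coev : hom I (X ⊗ Xs)) V J (q : seq J)
    (F : J -> hom (V ⊗ X) (V ⊗ X)) :
  ptrace theta ev coev (\sum_(j <- q) F j) = \sum_(j <- q) ptrace theta ev coev (F j).
Proof. by rewrite /ptrace bmap_suml comp_sumr comp_suml. Qed.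

(** For simple [V] the partial trace is a scalar, the same for every dual of [X], by [encircleE];
    the default 0 is then never taken. *)
Definition encircle V X : K := xget 0 [set c | exists Xs ev coev,
  dual_data (X := X) (Xs := Xs) ev coev /\
  ptrace theta ev coev (monodromy V X) = c *: idm V]%classic.

Lemma encircleE V X Xs ev coev : simple V ->
  dual_data (X := X) (Xs := Xs) ev coev ->
  ptrace theta ev coev (monodromy V X) = encircle V X *: idm V.
Proof.
move=> Vs dd; have [c pc] := endo_scal (ptrace theta ev coev (monodromy V X)) Vs.
rewrite pc; congr (_ *: _); apply/esym/xget_unique; first by exists Xs, ev, coev.
move=> c' [Xs' [ev' [coev' [dd' pc']]]]; apply: (scal_inj Vs); rewrite -pc' -pc.
have := ptrace_cyclic rib dd' dd (V := V) (monodromy V X) (idm X).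
by rewrite lw1 comp1m compm1.
Qed.

(** A loop labelled by a product is two nested loops. The inner one is a scalar and can be taken
    out, so [encircle V] is multiplicative. *)
Lemma encircle_tens V X Y : simple V -> encircle V (X ⊗ Y) = encircle V X * encircle V Y.
Proof.
move=> Vs; have [Xs [evX [coevX ddX]]] := fusion_ldual fus X.
have [Ys [evY [coevY ddY]]] := fusion_ldual fus Y.
apply: (scal_inj Vs); rewrite -(encircleE Vs (dual_data_tens ddX ddY)).
rewrite ptrace_tens // monodromy_tens ptrace_conj ptrace_lw.
rewrite (encircleE Vs ddY) bmapZr lw1 compZr compZl compm1 -/(monodromy V X).
rewrite /ptrace bmapZl compZr compZl -/(ptrace _ _ _ _) (encircleE Vs ddX) scalerA.
by rewrite mulrC.
Qed.

Lemma encircle_dsum V : simple V -> additive_fun (encircle V).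
Proof.
move=> Vs n F X [i [p [p1 p0 ip]]].
have [Xs [ev [coev dd]]] := fusion_ldual fus X.
apply: (scal_inj Vs); rewrite -(encircleE Vs dd) scaler_suml.
have -> : monodromy V X = \sum_a (V ◁ i a) ∘ (monodromy V (F a) ∘ (V ◁ p a)).
  rewrite -[LHS]comp1m -lw1 -ip bmap_sumr comp_suml; apply: eq_bigr => a _.
  by rewrite lwM -compA monodromy_natr.
rewrite ptrace_lin; apply: eq_bigr => a _.
have [Ys [evY [coevY ddY]]] := fusion_ldual fus (F a).
rewrite (ptrace_cyclic rib dd ddY) -compA -lwM p1 lw1 compm1.
by rewrite (encircleE Vs ddY).
Qed.

Lemma rtraceE X Xs ev coev (f : hom X X) : dual_data (X := X) (Xs := Xs) ev coev ->
  ltrace theta ev coev f = ribbon_trace theta f *: idm I.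
Proof.
move=> dd; have Is := fusion_unit fus.
have [c pc] := endo_scal (ltrace theta ev coev f) Is.
rewrite pc; congr (_ *: _); apply/esym/xget_unique.
  by exists Xs, ev, coev; split=> //; rewrite -pc /ltrace /ev_twist rwM !compA.
move=> c' [Xs' [ev' [coev' [dd' pc']]]]; apply: (scal_inj Is); rewrite -pc' -pc.
have := ltrace_cyclic rib dd' dd f (idm X).
by rewrite comp1m compm1 => <-; rewrite /ltrace /ev_twist rwM !compA.
Qed.

Lemma rtrace_cyclic X Y (f : hom X Y) (g : hom Y X) :
  ribbon_trace theta (g ∘ f) = ribbon_trace theta (f ∘ g).
Proof.
have [Xs [evX [coevX ddX]]] := fusion_ldual fus X.
have [Ys [evY [coevY ddY]]] := fusion_ldual fus Y.
apply: (scal_inj (fusion_unit fus)).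
by rewrite -(rtraceE _ ddX) -(rtraceE _ ddY) (ltrace_cyclic rib ddX ddY).
Qed.

Lemma rtraceZ X c (f : hom X X) : ribbon_trace theta (c *: f) = c * ribbon_trace theta f.
Proof.
have [Xs [ev [coev dd]]] := fusion_ldual fus X.
apply: (scal_inj (fusion_unit fus)); rewrite -scalerA -!(rtraceE _ dd).
by rewrite /ltrace bmapZl compZr compZl.
Qed.

(** Closing the loop of [Y] first leaves a multiple of the identity of [X]. *)
Lemma rtrace_monodromy X Y : simple X ->
  ribbon_trace theta (monodromy X Y) = encircle X Y * ribbon_trace theta (idm X).
Proof.
move=> Xs; have [X' [evX [coevX ddX]]] := fusion_ldual fus X.
have [Y' [evY [coevY ddY]]] := fusion_ldual fus Y.
apply: (scal_inj (fusion_unit fus)).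
rewrite -(rtraceE _ (dual_data_tens ddX ddY)) ltrace_tens // (encircleE Xs ddY).
by rewrite (rtraceE _ ddX) rtraceZ.
Qed.

End Encircling.

(** * Characters and the S-matrix *)

(* What the proof retains of a modular category: [mdh k j] is the scalar by
   which a loop labelled by the j-th simple object acts on the k-th one, and
   [mdt] is the twist. The S-matrix is [mdh md0 k * mdh k j], up to a
   scalar. *)
Record modular_datum (C : numClosedFieldType) (r : nat) := ModularDatum {
  md0 : 'I_r;
  mdN : 'I_r -> 'I_r -> 'I_r -> nat;
  mdual : 'I_r -> 'I_r;
  mdh : 'I_r -> 'I_r -> C;
  mdt : 'I_r -> C;
  md_mul : forall k i j, mdh k i * mdh k j = \sum_l (mdN i j l)%:R * mdh k l;
  md_unit : forall k, mdh k md0 = 1;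
  md_comm : forall i j l, mdN i j l = mdN j i l;
  md_adj : forall i j l, mdN i j l = mdN (mdual i) l j;
  md_dual : forall i j, mdN i j md0 = (j == mdual i);
  md_sym : forall i j, mdh md0 i * mdh i j = mdh md0 j * mdh j i;
  md_inj : \matrix_(k, j) (mdh md0 k * mdh k j) \in unitmx;
  md_twist0 : forall i, mdt i != 0;
  md_twist : forall i j l, (forall l', mdN i j l' = (l' == l)) ->
    mdh md0 j * mdh j i * mdt i * mdt j = mdt l * mdh md0 l }.

Section Characters.
Context {C : numClosedFieldType} {r : nat} (D : modular_datum C r).
Local Notation o := (md0 D).
Local Notation N := (mdN D).
Local Notation "i ^∨" := (mdual D i) (at level 2, format "i ^∨").
Local Notation h := (mdh D).
Local Notation δ i j := ((i == j)%:R : C).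

Lemma md_dualK i : (i^∨)^∨ = i.
Proof. by have := md_dual D (i^∨) i; rewrite md_comm md_dual eqxx; case: eqP. Qed.

Lemma md_unitl j k : N o j k = (j == k).
Proof. by rewrite md_comm md_adj md_dual md_dualK eq_sym. Qed.

(** The formal codegree of the character [h k]: by [md_conj], its value at the sum of the products
    of each simple object with its dual. *)
Definition codeg k : C := \sum_j h k j * (h k j)^*.

Lemma codeg_gt0 k : 0 < codeg k.
Proof.
rewrite /codeg (bigD1 o) //= md_unit conjC1 mulr1.
by rewrite ltr_wpDr ?ltr01 ?sumr_ge0 // => i _; rewrite mul_conjC_ge0.
Qed.

(** By [md_adj], multiplication by [i] and by its dual are adjoint for the standard hermitian form.
    At [k = l] this shows that duality is complex conjugation; for different characters it forces
    orthogonality. *)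
Lemma md_shift k l i (ip := \sum_j h k j * (h l j)^*) :
  h k i * ip = (h l (i^∨))^* * ip.
Proof.
rewrite /ip !mulr_sumr.
transitivity (\sum_j \sum_m (N i j m)%:R * h k m * (h l j)^*).
  by apply: eq_bigr => j _; rewrite mulrA md_mul mulr_suml.
rewrite exchange_big; apply: eq_bigr => m _ /=.
rewrite mulrCA -rmorphM md_mul rmorph_sum mulr_sumr; apply: eq_bigr => j _.
by rewrite rmorphM /= conjC_nat -md_adj mulrA [h k m * _]mulrC.
Qed.

Lemma md_conj k i : h k (i^∨) = (h k i)^*.
Proof.
have := md_shift k k i; rewrite -/(codeg k) => /(mulIf (lt0r_neq0 (codeg_gt0 k))).
by move=> ->; rewrite conjCK.
Qed.

Lemma md_S_inj (v : 'I_r -> C) :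
  (forall j, \sum_k v k * (h o k * h k j) = 0) -> forall k, v k = 0.
Proof.
move=> vS k; have : (\row_k v k) *m \matrix_(k, j) (h o k * h k j) = 0.
  by apply/rowP => j; rewrite !mxE -[RHS](vS j); apply: eq_bigr => l _; rewrite !mxE.
move=> /(congr1 (mulmx^~ (invmx (\matrix_(k, j) (h o k * h k j))))).
by rewrite mulmxK ?md_inj // mul0mx => /rowP/(_ k); rewrite !mxE.
Qed.

Lemma md_dim_neq0 k : h o k != 0.
Proof.
apply/negP => /eqP hk0; have : δ k k = 0.
  apply: (md_S_inj (v := fun l => δ l k)) => j.
  rewrite (bigD1 k) //= hk0 mul0r mulr0 big1 ?addr0 // => l /negPf->.
  by rewrite mul0r.
by move/eqP; rewrite eqxx oner_eq0.
Qed.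

(** Otherwise two rows of the S-matrix would be proportional. *)
Lemma md_char_inj k l : (forall i, h k i = h l i) -> k = l.
Proof.
move=> kl; apply/eqP; apply: contraT => neq_kl.
have : δ k k * h o l - δ k l * h o k = 0.
  apply: (md_S_inj (v := fun j => δ j k * h o l - δ j l * h o k)) => j.
  rewrite (bigD1 k) //= (bigD1 l) 1?eq_sym //= big1 ?addr0 => [|i /andP[/negPf-> /negPf->]];
    last by rewrite !mul0r subr0 mul0r.
  rewrite !eqxx [l == k]eq_sym !(negPf neq_kl) !mul0r !mul1r subr0 sub0r kl.
  by rewrite mulNr mulrCA subrr.
by move/eqP; rewrite eqxx (negPf neq_kl) mul0r mul1r subr0 (negPf (md_dim_neq0 l)).
Qed.

Lemma md_orth k l : \sum_j h k j * (h l j)^* = δ k l * codeg k.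
Proof.
have [<-|/eqP kl] := eqVneq k l; first by rewrite mul1r.
rewrite mul0r; apply: contra_not_eq kl => ip0; apply: md_char_inj => i.
by apply: (mulIf ip0); rewrite md_shift md_conj conjCK.
Qed.

Lemma md_orth2 i j : \sum_k h k i * (h k j)^* / codeg k = δ i j.
Proof.
pose H := \matrix_(k, j) h k j; pose G := \matrix_(j, k) ((h k j)^* / codeg k).
have HG : H *m G = 1%:M.
  apply/matrixP => k l; rewrite !mxE; under eq_bigr do rewrite !mxE mulrA.
  rewrite -mulr_suml md_orth; have [->|_] := eqVneq k l; last by rewrite mul0r mul0r.
  by rewrite mul1r divff ?mulr1n // lt0r_neq0 ?codeg_gt0.
have /matrixP/(_ j i) := mulmx1C HG; rewrite !mxE eq_sym => <-.
by apply: eq_bigr => k _; rewrite !mxE [RHS]mulrC mulrA.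
Qed.

Lemma md_expand (u : 'I_r -> C) j :
  u j = \sum_k (\sum_m u m * (h k m)^*) / codeg k * h k j.
Proof.
transitivity (\sum_m u m * \sum_k h k j * (h k m)^* / codeg k).
  rewrite (bigD1 j) //= md_orth2 eqxx mulr1 big1 ?addr0 // => m /negPf mj.
  by rewrite md_orth2 eq_sym mj mulr0.
under eq_bigr do rewrite mulr_sumr.
rewrite exchange_big; apply: eq_bigr => k _ /=; rewrite !mulr_suml.
by apply: eq_bigr => m _; ring.
Qed.

Lemma md_parseval (u v : 'I_r -> C) :
  \sum_k (\sum_m u m * (h k m)^*) * (\sum_m v m * (h k m)^*)^* / codeg k =
  \sum_m u m * (v m)^*.
Proof.
transitivity (\sum_m (\sum_k (\sum_n u n * (h k n)^*) / codeg k * h k m) * (v m)^*);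
  last by apply: eq_bigr => m _; rewrite -md_expand.
under [RHS]eq_bigr do rewrite mulr_suml.
rewrite exchange_big; apply: eq_bigr => k _ /=.
rewrite rmorph_sum /= [LHS]mulrAC mulr_sumr; apply: eq_bigr => m _.
by rewrite rmorphM /= conjCK [(v m)^* * _]mulrC mulrA.
Qed.

Lemma md_symC i j : h i j = h o j * h j i / h o i.
Proof. by rewrite -md_sym mulrAC divff ?mul1r // md_dim_neq0. Qed.

(* Since S is symmetric, the characters are orthogonal for the weights
   [1 / (codeg k |h o k|^2)] too, which forces these weights to be constant. *)
Lemma md_codeg k : codeg k * (h o k * (h o k)^*) = codeg o.
Proof.
pose w k := (codeg k * (h o k * (h o k)^*))^-1.
have w_orth j : j != o -> \sum_k w k * h o k * (h j k)^* = 0.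
  move=> jo; have := md_orth2 o j; rewrite eq_sym (negPf jo) => e.
  apply: (mulfI (x := (h o j)^*)); first by rewrite conjC_eq0 md_dim_neq0.
  rewrite mulr0 -[RHS]e mulr_sumr; apply: eq_bigr => l _.
  rewrite md_unit mul1r (md_symC l j) !rmorphM /= fmorphV /w.
  have := md_dim_neq0 l; have := lt0r_neq0 (codeg_gt0 l).
  move: (h o l) (codeg l) => x c c0 x0.
  have xc0 : x^* != 0 by rewrite conjC_eq0.
  by field; rewrite c0 x0 xc0.
have w_const : w k = w o.
  have e j : w j * h o j = (\sum_m w m * h o m * (h o m)^*) / codeg o * h o j.
    rewrite [LHS](md_expand (fun l => w l * h o l)) (bigD1 o) //= [X in _ + X]big1 ?addr0 // => l lo.
    by rewrite [X in X / _ * _](w_orth l lo) !mul0r.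
  apply: (mulIf (md_dim_neq0 k)).
  by rewrite (e k); congr (_ * _); have := e o; rewrite md_unit !mulr1.
by move/invr_inj: w_const; rewrite md_unit conjC1 !mulr1.
Qed.

End Characters.

Lemma real_argmax {C : numClosedFieldType} (I : finType) (x : I -> C) (i0 : I) :
  (forall i, x i \is Num.real) -> exists k, forall i, x i <= x k.
Proof.
move=> xr; have: exists k, all (fun i => x i <= x k) (enum I).
  elim: (enum I) => [|i s [k sk]]; first by exists i0.
  have [ki|ik] := real_leP (xr k) (xr i).
    exists i; rewrite /= lexx; apply: sub_all sk => j jk; exact: le_trans jk ki.
  by exists k; rewrite /= ltW.
by case=> k /allP sk; exists k => i; apply: sk; rewrite mem_enum.
Qed.

(** * A Perron-Frobenius argument *)

Section PositiveCharacter.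
Context {C : numClosedFieldType} {r : nat} (D : modular_datum C r).
Local Notation o := (md0 D).
Local Notation N := (mdN D).
Local Notation "i ^∨" := (mdual D i) (at level 2, format "i ^∨").
Local Notation h := (mdh D).
Local Notation ρ k := (\sum_m h k m).

(** Multiplication by the sum of all simple objects: a symmetric matrix with positive entries, with
    eigenvectors [h k] and eigenvalues [ρ k]. *)
Let M i j : C := (\sum_m N m i j)%N%:R.

Lemma sum_dual (V : nmodType) (F : 'I_r -> V) : \sum_m F (m^∨) = \sum_m F m.
Proof. by rewrite [RHS](reindex_inj (can_inj (md_dualK D))). Qed.

Let rho_real k : ρ k \is Num.real.
Proof.
apply/CrealP; rewrite rmorph_sum -[RHS]sum_dual; apply: eq_bigr => m _.
by rewrite md_conj.
Qed.

Let M_sym i j : M i j = M j i.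
Proof.
rewrite /M !natr_sum -[RHS]sum_dual; apply: eq_bigr => m _.
by rewrite md_adj.
Qed.

Let M_ge1 i j : 1 <= M i j.
Proof.
rewrite /M ler1n lt0n sum_nat_eq0; apply/negP => /forallP m0.
have : h o (i^∨) * h o j = 0.
  rewrite md_mul big1 // => m _; rewrite -md_adj md_comm.
  by rewrite (eqP (implyP (m0 m) isT)) mul0r.
by move/eqP; rewrite mulf_eq0 !(negPf (md_dim_neq0 _ _)).
Qed.

Let M_char k i : \sum_j M i j * h k j = ρ k * h k i.
Proof.
rewrite mulr_suml; under [RHS]eq_bigr do rewrite md_mul.
rewrite exchange_big; apply: eq_bigr => j _ /=.
by rewrite /M natr_sum mulr_suml.
Qed.

Let inner (u : 'I_r -> C) k := \sum_m u m * (h k m)^*.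

Let inner_M u k : inner (fun i => \sum_j M i j * u j) k = ρ k * inner u k.
Proof.
rewrite /inner -[ρ k](CrealP (rho_real k)) mulr_sumr.
transitivity (\sum_m u m * (\sum_i M m i * h k i)^*); last first.
  by apply: eq_bigr => m _; rewrite M_char rmorphM /= mulrCA.
transitivity (\sum_i \sum_m M i m * u m * (h k i)^*).
  by apply: eq_bigr => i _; rewrite mulr_suml.
rewrite exchange_big; apply: eq_bigr => m _ /=; rewrite rmorph_sum mulr_sumr.
by apply: eq_bigr => i _; rewrite rmorphM /= conjC_nat -/(M m i) M_sym mulrCA mulrA.
Qed.

(** Take [k0] with the largest eigenvalue [ρ k0]. The vector [y] of the moduli of [h k0] still lies
    in the top eigenspace, is positive because [M] is, and is a common eigenvector of all
    multiplications because that eigenspace is a line. Hence [y] is a character. *)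
Lemma positive_character : exists k, forall i, 0 < h k i.
Proof.
have [k0 k0max] := real_argmax o rho_real.
pose y i := `|h k0 i|; pose q k := inner y k * (inner y k)^* / codeg D k.
have q_ge0 k : 0 <= q k by rewrite divr_ge0 ?mul_conjC_ge0 ?ltW ?codeg_gt0.
have yo : y o = 1 by rewrite /y md_unit normr1.
(* The Rayleigh quotient of [y] is at least [ρ k0] by the triangle inequality; Parseval writes it as
   an average of the [ρ k] with weights [q k]. So only the characters with [ρ k = ρ k0] can occur in
   [y]. *)
have sum_q : \sum_k (ρ k0 - ρ k) * q k <= 0.
  have -> : \sum_k (ρ k0 - ρ k) * q k =
      ρ k0 * (\sum_m y m * (y m)^*) - \sum_i (\sum_j M i j * y j) * (y i)^*.
    rewrite -!(md_parseval D) mulr_sumr -sumrB; apply: eq_bigr => k _.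
    by rewrite -/(inner y k) -/(inner (fun i => \sum_j M i j * y j) k) inner_M /q; ring.
  have yr i : (y i)^* = y i by rewrite /y conj_normC.
  have -> : ρ k0 * (\sum_m y m * (y m)^*) =
      \sum_i \sum_j M i j * h k0 j * (h k0 i)^*.
    rewrite mulr_sumr; apply: eq_bigr => i _.
    by rewrite yr -expr2 normCK mulrA -M_char mulr_suml.
  set S := (X in X - _ <= 0); rewrite subr_le0.
  have Sr : S \is Num.real.
    apply/CrealP; rewrite /S rmorph_sum [RHS]exchange_big; apply: eq_bigr => i _.
    rewrite rmorph_sum; apply: eq_bigr => j _; rewrite !rmorphM /= conjCK.
    by rewrite /M conjC_nat -/(M j i) M_sym mulrAC.
  apply: (le_trans (real_ler_norm Sr)); apply: (le_trans (ler_norm_sum _ _ _)).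
  apply: ler_sum => i _; rewrite mulr_suml; apply: (le_trans (ler_norm_sum _ _ _)).
  by apply: ler_sum => j _; rewrite yr !normrM norm_conjC normr_nat.
have q0 k : ρ k != ρ k0 -> inner y k = 0.
  move=> kk0; have t_ge0 i : 0 <= (ρ k0 - ρ i) * q i.
    by rewrite mulr_ge0 // subr_ge0.
  have: \sum_k (ρ k0 - ρ k) * q k == 0 by rewrite eq_le sum_q sumr_ge0.
  rewrite psumr_eq0 // => /allP/(_ k (mem_index_enum _))/implyP/(_ isT).
  rewrite mulf_eq0 subr_eq0 eq_sym (negPf kk0) /q mulf_eq0 invr_eq0.
  rewrite (gt_eqF (codeg_gt0 _ _)) orbF -normCK expf_eq0 normr_eq0 /=.
  by move/eqP.
have yE i : y i = \sum_k inner y k / codeg D k * h k i by apply: md_expand.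
(* Multiplication by [i] acts diagonally on the characters, so it maps the top eigenspace, which
   contains [y], into itself. *)
have My_gen i a : \sum_j M a j * (\sum_l (N i j l)%:R * y l) =
    ρ k0 * \sum_l (N i a l)%:R * y l.
  have Ny b : \sum_l (N i b l)%:R * y l = \sum_k inner y k / codeg D k * (h k i * h k b).
    under eq_bigr do rewrite yE mulr_sumr.
    rewrite exchange_big; apply: eq_bigr => k _ /=; rewrite md_mul mulr_sumr.
    by apply: eq_bigr => l _; rewrite mulrCA.
  under eq_bigr do rewrite Ny mulr_sumr.
  rewrite exchange_big Ny mulr_sumr; apply: eq_bigr => k _ /=.
  have [kk0|/q0->] := boolP (ρ k == ρ k0); last first.
    by rewrite mul0r mul0r mulr0 big1 // => j _; rewrite mul0r mulr0.
  rewrite -(eqP kk0); transitivity (inner y k / codeg D k * h k i * \sum_j M a j * h k j).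
    by rewrite mulr_sumr; apply: eq_bigr => j _; ring.
  by rewrite M_char; ring.
have My i : \sum_j M i j * y j = ρ k0 * y i.
  have No j : \sum_l (N o j l)%:R * y l = y j.
    rewrite (bigD1 j) //= md_unitl eqxx mul1r big1 ?addr0 // => l lj.
    by rewrite md_unitl eq_sym (negPf lj) mul0r.
  by have := My_gen o i; rewrite No => <-; apply: eq_bigr => j _; rewrite No.
have y_ge0 i : 0 <= y i by apply: normr_ge0.
have M_ge0 i j : 0 <= M i j by apply: ler0n.
have y_gt0 i : 0 < y i.
  rewrite lt_neqAle y_ge0 andbT; apply/eqP => yi0.
  have := My i; rewrite -yi0 mulr0 => /eqP; rewrite gt_eqF //.
  rewrite (bigD1 o) //= yo mulr1 ltr_wpDr ?sumr_ge0 // => [j _|].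
    by rewrite mulr_ge0.
  by apply: lt_le_trans (M_ge1 _ _); apply: ltr01.
(* With [t] the largest ratio of the entries of [w] and [y], the vector [t y - w] is a nonnegative
   top eigenvector with a zero entry. Since all entries of [M] are positive, it vanishes. The value
   of [t] is read off at the unit. *)
have y_mul i a : \sum_l (N i a l)%:R * y l = y i * y a.
  pose w b := \sum_l (N i b l)%:R * y l.
  have w_ge0 b : 0 <= w b by apply: sumr_ge0 => l _; rewrite mulr_ge0 ?ler0n.
  have [b|a0 a0max] := real_argmax (x := fun b => w b / y b) o.
    by rewrite ger0_real // divr_ge0.
  pose t := w a0 / y a0; pose u b := t * y b - w b.
  have u_ge0 b : 0 <= u b by rewrite subr_ge0 -ler_pdivrMr.
  have ua0 : u a0 = 0 by rewrite /u /t divfK ?subrr // gt_eqF.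
  have: \sum_j M a0 j * u j == 0.
    under eq_bigr do rewrite mulrBr mulrCA.
    by rewrite sumrB -mulr_sumr My My_gen mulrCA -mulrBr -/(u a0) ua0 mulr0.
  rewrite psumr_eq0 => [/allP u0|j _]; last by rewrite mulr_ge0.
  have wt b : w b = t * y b.
    have /implyP/(_ isT) := u0 b (mem_index_enum _).
    rewrite mulf_eq0 gt_eqF ?(lt_le_trans ltr01 (M_ge1 _ _)) //= subr_eq0.
    by move/eqP.
  rewrite -/(w a) wt; congr (_ * _); have := wt o; rewrite yo mulr1 => <-.
  rewrite /w (bigD1 i) //= md_comm md_unitl eqxx mul1r big1 ?addr0 // => l li.
  by rewrite md_comm md_unitl eq_sym (negPf li) mul0r.
have [k yk] : exists k, inner y k != 0.
  apply: contrapT => /forallNP y0; have := yE o; rewrite yo big1 => [/eqP|k _].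
    by rewrite oner_eq0.
  by move/negP/negbNE/eqP: (y0 k) => ->; rewrite !mul0r.
(* As in [md_shift]: a character that pairs nontrivially with [h k] equals it. *)
exists k => i; suff -> : h k i = y i by [].
apply: (mulIf yk); rewrite [in RHS]/inner [RHS]mulr_sumr.
under [RHS]eq_bigr do rewrite mulrA -y_mul mulr_suml.
rewrite [RHS]exchange_big /inner mulr_sumr; apply: eq_bigr => l _ /=.
transitivity (y l * (h k (i^∨) * h k l)^*).
  by rewrite rmorphM /= md_conj conjCK mulrCA.
rewrite md_mul rmorph_sum mulr_sumr; apply: eq_bigr => j _.
by rewrite rmorphM /= conjC_nat -md_adj; ring.
Qed.

End PositiveCharacter.

(** * Algebraic integers and dimensions *)

Section AlgebraicIntegers.
Context {C : numClosedFieldType}.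

Definition aint (x : C) := integralOver (intmul 1 : int -> C) x.

Lemma aint_int (n : int) : aint n%:~R.
Proof. exact: (integral_id (intmul 1 : int -> C) n). Qed.

Lemma aint_nat (n : nat) : aint n%:R.
Proof. exact: (aint_int n). Qed.

Lemma aintD x y : aint x -> aint y -> aint (x + y).
Proof. exact: integral_add. Qed.

Lemma aintB x y : aint x -> aint y -> aint (x - y).
Proof. exact: integral_sub. Qed.

Lemma aintM x y : aint x -> aint y -> aint (x * y).
Proof. exact: integral_mul. Qed.

Lemma aint_sum I (s : seq I) (P : pred I) (F : I -> C) :
  (forall i, P i -> aint (F i)) -> aint (\sum_(i <- s | P i) F i).
Proof. by move=> aF; elim/big_ind: _ => //; [apply: (aint_nat 0)|apply: aintD]. Qed.

Lemma aint_prod I (s : seq I) (P : pred I) (F : I -> C) :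
  (forall i, P i -> aint (F i)) -> aint (\prod_(i <- s | P i) F i).
Proof. by move=> aF; elim/big_ind: _ => //; [apply: (aint_nat 1)|apply: aintM]. Qed.

Lemma aint_rational (x : C) (a b : int) :
  b != 0 -> x * b%:~R = a%:~R -> aint x -> exists n : int, x = n%:~R.
Proof.
move=> b0 xab [p pmon /rootP px]; pose q : rat := a%:~R / b%:~R.
have xq : x = (numq q)%:~R / (denq q)%:~R.
  have b0' : b%:~R != 0 :> C by rewrite intr_eq0.
  apply: (mulIf b0'); rewrite xab -/(ratr q).
  by rewrite fmorph_div /= !rmorph_int divfK.
have dv : (denq q %| numq q ^+ (size p).-1)%Z.
  pose n := (size p).-1; pose u := numq q; pose v := denq q.
  have v0 : v%:~R != 0 :> C by rewrite intr_eq0 denq_neq0.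
  have : \sum_(i < size p) p`_i * u ^+ i * v ^+ (n - i) = 0.
    apply: (@intr_inj C); rewrite rmorph_sum /= -[RHS](mulr0 (v%:~R ^+ n)) -[in RHS]px.
    rewrite horner_coef size_map_inj_poly //; last exact: intr_inj.
    rewrite mulr_sumr; apply: eq_bigr => i _; rewrite coef_map_id0 // !rmorphM /= !rmorphXn /=.
    rewrite xq -/u -/v expr_div_n.
    have ni : (i <= n)%N by rewrite -ltnS prednK ?(leq_trans _ (ltn_ord i)).
    rewrite -{2}(subnK ni) exprD; field.
    by rewrite expf_neq0.
  have s0 : (0 < size p)%N by rewrite size_poly_gt0 monic_neq0.
  rewrite -(prednK s0) big_ord_recr /= subnn mulr1 -/n.
  have -> : p`_n = 1 by have /monicP := pmon; rewrite lead_coefE.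
  rewrite mul1r addrC => /eqP; rewrite addr_eq0 => /eqP ->.
  rewrite rpredN rpred_sum // => i _.
  by rewrite dvdz_mull // -(subnSK (ltn_ord i)) exprS dvdz_mulr.
have cop : coprimez (denq q) (numq q ^+ (size p).-1).
  by rewrite coprimezXr // coprimez_sym; have := coprime_num_den q.
have : (denq q %| 1)%Z by rewrite -(Gauss_dvdzr _ cop) mulr1.
rewrite dvdz1 => /eqP d1; exists (numq q).
by rewrite xq -(absz_denq q) d1 divr1.
Qed.

End AlgebraicIntegers.

Section Arithmetic.
Context {C : numClosedFieldType} {r : nat} (D : modular_datum C r).
Local Notation o := (md0 D).
Local Notation N := (mdN D).
Local Notation "i ^∨" := (mdual D i) (at level 2, format "i ^∨").
Local Notation h := (mdh D).

(* The integer matrices A of which every character is an eigenvector: they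
   represent the elements of the Grothendieck ring. *)
Definition md_eigen (A : 'M[int]_r) (e : 'I_r -> C) :=
  forall k j, \sum_l (A j l)%:~R * h k l = e k * h k j.

Lemma md_eigenN i : md_eigen (\matrix_(j, l) (N i j l)%:Z) (h^~ i).
Proof.
by move=> k j; rewrite md_mul; apply: eq_bigr => l _; rewrite mxE.
Qed.

Lemma md_eigen1 : md_eigen 1%:M (fun=> 1).
Proof.
move=> k j; rewrite (bigD1 j) //= mxE eqxx big1 ?addr0 // => l lj.
by rewrite mxE eq_sym (negPf lj) mul0r.
Qed.

Lemma md_eigenM A B a b : md_eigen A a -> md_eigen B b ->
  md_eigen (A *m B) (fun k => a k * b k).
Proof.
move=> eA eB k j; transitivity (\sum_m (A j m)%:~R * \sum_l (B m l)%:~R * h k l).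
  under [RHS]eq_bigr do rewrite mulr_sumr.
  rewrite exchange_big; apply: eq_bigr => l _; rewrite mxE rmorph_sum mulr_suml.
  by apply: eq_bigr => m _; rewrite rmorphM /= mulrA.
under eq_bigr do rewrite eB mulrCA.
by rewrite -mulr_sumr eA mulrCA mulrA.
Qed.

Lemma md_eigenD A B a b : md_eigen A a -> md_eigen B b ->
  md_eigen (A + B) (fun k => a k + b k).
Proof.
move=> eA eB k j; rewrite mulrDl -eA -eB -big_split /=; apply: eq_bigr => l _.
by rewrite mxE rmorphD mulrDl.
Qed.

Lemma md_eigenZ A a c : md_eigen A a -> md_eigen (c *: A) (fun k => c%:~R * a k).
Proof.
move=> eA k j; rewrite -mulrA -eA mulr_sumr; apply: eq_bigr => l _.
by rewrite mxE rmorphM mulrA.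
Qed.

Lemma md_eigen_codeg : exists A, md_eigen A (codeg D).
Proof.
exists (\sum_i (\matrix_(j, l) (N i j l)%:Z) *m (\matrix_(j, l) (N (i^∨) j l)%:Z)).
move=> k j; rewrite /codeg mulr_suml.
under eq_bigr do rewrite summxE rmorph_sum mulr_suml.
rewrite exchange_big; apply: eq_bigr => i _ /=.
by rewrite -md_conj; apply: (md_eigenM (md_eigenN _) (md_eigenN _)).
Qed.

Lemma aint_char k i : aint (h k i).
Proof.
have : eigenvalue (map_mx (intmul 1 : int -> C) (\matrix_(j, l) (N i j l)%:Z)^T) (h k i).
  apply/eigenvalueP; exists (\row_j h k j).
    apply/rowP => j; rewrite !mxE md_mul; apply: eq_bigr => l _.
    by rewrite !mxE mulrC.
  by apply/eqP => /rowP/(_ o)/eqP; rewrite !mxE md_unit; apply/negP/oner_neq0.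
rewrite eigenvalue_root_char -map_char_poly => rt.
by exists (char_poly (\matrix_(j, l) (N i j l)%:Z)^T); rewrite ?char_poly_monic.
Qed.

Lemma md_det_neq0 : \det (\matrix_(j, k) h k j) != 0.
Proof.
have := md_inj D; rewrite unitmxE unitfE -det_tr; apply: contraNneq => det0.
rewrite (_ : _^T = (\matrix_(j, k) h k j) *m diag_mx (\row_k h o k)).
  by rewrite det_mulmx det0 mul0r.
by apply/matrixP => j k; rewrite mul_mx_diag !mxE mulrC.
Qed.

(** The determinant of [B + X A] is an integer polynomial equal to the product of the [b k + e k X].
    Let n be the number of [k] with [e k != 0]: its coefficient of degree n is the wanted product
    times the product of the nonzero [e k]. That last factor is the same coefficient for [B = 1],
    hence also an integer. *)
Lemma md_eigen_prod (A B : 'M[int]_r) e b : md_eigen A e -> md_eigen B b ->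
  exists a c : int, c != 0 /\ (\prod_(k | e k == 0) b k) * c%:~R = a%:~R.
Proof.
move=> eA eB.
pose P (B : 'M[int]_r) := \det (map_mx polyC B + 'X *: map_mx polyC A).
have PE B' b' : md_eigen B' b' ->
    map_poly (intmul 1 : int -> C) (P B') = \prod_k ((b' k)%:P + e k *: 'X).
  move=> eB'; pose V := \matrix_(j, k) (h k j)%:P.
  have V0 : \det V != 0.
    rewrite (_ : V = map_mx polyC (\matrix_(j, k) h k j)).
      by rewrite det_map_mx polyC_eq0 md_det_neq0.
    by apply/matrixP => j k; rewrite !mxE.
  apply: (mulIf V0); rewrite -det_map_mx -det_mulmx.
  pose Δ := \row_k ((b' k)%:P + e k *: 'X).
  transitivity (\det (V *m diag_mx Δ)); last first.
    rewrite det_mulmx det_diag mulrC; congr (_ * _).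
    by apply: eq_bigr => k _; rewrite mxE.
  congr (\det _); apply/matrixP => j k; rewrite mul_mx_diag !mxE.
  rewrite mulrDr -polyCM [h k j * _]mulrC -eB' -[_ *: 'X]mul_polyC mulrA -polyCM.
  rewrite [h k j * _]mulrC -eA !rmorph_sum mulr_suml -big_split /=.
  apply: eq_bigr => l _; rewrite !mxE rmorphD rmorphM /= !map_polyC map_polyX /=.
  by rewrite mulrDl !polyCM; ring.
pose n := #|[pred k | e k != 0]|; pose Q b' := \prod_(k | e k != 0) ((b' k)%:P + e k *: 'X : {poly C}).
have lin_lead x y : y != 0 -> size (x%:P + y *: 'X : {poly C}) = 2%N /\ lead_coef (x%:P + y *: 'X) = y.
  move=> y0; have sy : size (y *: 'X : {poly C}) = 2%N by rewrite size_scale ?size_polyX.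
  have sx : (size (x%:P : {poly C}) < size (y *: 'X))%N by rewrite sy ltnS size_polyC leq_b1.
  by rewrite addrC size_polyDl // lead_coefDl // lead_coefZ lead_coefX mulr1.
have coefP B' b' : md_eigen B' b' ->
    ((P B')`_n)%:~R = (\prod_(k | e k == 0) b' k) * \prod_(k | e k != 0) e k.
  move=> eB'; rewrite -coef_map (PE _ _ eB') (bigID (fun k => e k == 0)) /=.
  have -> : \prod_(k | e k == 0) ((b' k)%:P + e k *: 'X) =
      (\prod_(k | e k == 0) b' k)%:P :> {poly C}.
    by rewrite rmorph_prod; apply: eq_bigr => k /eqP->; rewrite scale0r addr0.
  rewrite coefCM; congr (_ * _).
  transitivity (lead_coef (Q b')).
    rewrite lead_coefE size_prod => [|k ek]; last first.
      by rewrite -size_poly_gt0; case: (lin_lead (b' k) _ ek) => ->.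
    rewrite (eq_bigr (fun=> 2%N)) => [|k ek]; last by case: (lin_lead (b' k) _ ek).
    by rewrite sum_nat_const muln2 -addnn subSn ?leq_addl // addnK.
  by rewrite lead_coef_prod; apply: eq_bigr => k /(lin_lead (b' k))[].
exists (P B)`_n, (P 1%:M)`_n.
have c1 := coefP _ _ md_eigen1; rewrite big1 // mul1r in c1.
split; last by rewrite c1 (coefP _ _ eB).
rewrite -(intr_eq0 C) c1; apply/prodf_neq0 => k //.
Qed.

(* The characters where e vanishes form a Galois-stable set, so that this
   product is a norm. *)
Lemma md_eigen_prod_int (A : 'M[int]_r) e b B : md_eigen A e -> md_eigen B b ->
  (forall k, aint (b k)) -> exists n : int, \prod_(k | e k == 0) b k = n%:~R.
Proof.
move=> eA eB ab; have [a [c [c0 e1]]] := md_eigen_prod eA eB.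
by apply: aint_rational c0 e1 _; apply: aint_prod.
Qed.

End Arithmetic.

(** * Comparison of the two notions of dimension *)

Section Pseudounitary.
Context {C : numClosedFieldType} {r : nat} (D : modular_datum C r).
Local Notation o := (md0 D).
Local Notation N := (mdN D).
Local Notation "i ^∨" := (mdual D i) (at level 2, format "i ^∨").
Local Notation h := (mdh D).

(** Pair the vector of moduli of [h k] with the positive character [h j]: by the triangle inequality
    multiplication by [i] enlarges the pairing at least by the factor [|h k i|], and by adjunction
    it multiplies it by [h j i]. *)
Lemma char_bound j k i : (forall i, 0 < h j i) -> `|h k i| <= h j i.
Proof.
move=> hj; pose T := \sum_a h j a * `|h k a|.
have T_gt0 : 0 < T.
  rewrite /T (bigD1 o) //= !md_unit normr1 mulr1 ltr_wpDr //.
  by apply: sumr_ge0 => a _; rewrite mulr_ge0 // ltW.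
rewrite -(ler_pM2r T_gt0) /T !mulr_sumr.
apply: (@le_trans _ _ (\sum_a \sum_l (N i a l)%:R * (h j a * `|h k l|))).
  apply: ler_sum => a _; rewrite mulrCA -normrM md_mul.
  apply: (@le_trans _ _ (h j a * \sum_l `|(N i a l)%:R * h k l|)).
    by rewrite ler_pM2l // ler_norm_sum.
  rewrite mulr_sumr; apply: ler_sum => l _.
  by rewrite normrM normr_nat mulrCA.
rewrite exchange_big; apply: ler_sum => l _ /=.
have hjd : h j (i^∨) = h j i by rewrite md_conj; apply/CrealP/ger0_real/ltW.
rewrite mulrA -hjd md_mul mulr_suml; apply: ler_sum => a _.
by rewrite md_adj mulrA.
Qed.

Context (j0 : 'I_r) (dim : 'I_r -> nat).
Context (dim_gt0 : forall i, (0 < dim i)%N) (dimE : forall i, h j0 i = (dim i)%:R).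

Definition gdim : nat := (\sum_i dim i ^ 2)%N.

Lemma hj0_gt0 i : 0 < h j0 i.
Proof. by rewrite dimE ltr0n. Qed.

Lemma gdim_gt0 : (0 < gdim)%N.
Proof. by rewrite /gdim (bigD1 o) //= addn_gt0 expn_gt0 dim_gt0. Qed.

Lemma codeg_j0 : codeg D j0 = gdim%:R.
Proof.
rewrite /codeg /gdim natr_sum; apply: eq_bigr => i _.
by rewrite dimE conjC_nat natrX.
Qed.

Lemma codeg_le k : codeg D k <= gdim%:R.
Proof.
rewrite -codeg_j0; apply: ler_sum => i _.
rewrite -!normCK lerXn2r ?nnegrE ?normr_ge0 // (le_trans (char_bound k i hj0_gt0)) //.
by rewrite real_ler_norm // dimE realn.
Qed.

(** Let [b k] be the squared modulus of [h k j0], and consider the characters with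
    [gdim * b k = codeg k]. The unit character is one of them by [md_codeg], and [codeg_le] gives
    [0 < b k <= 1] on all of them. Their product is an integer, so every factor equals 1. *)
Lemma md_unitary0 : h o j0 * (h o j0)^* = 1.
Proof.
have g0 : gdim%:R != 0 :> C by rewrite pnatr_eq0 -lt0n gdim_gt0.
have [Z eZ] := md_eigen_codeg D.
pose b k := h k j0 * h k (j0^∨).
have [B eB] : exists B, md_eigen D B b.
  by eexists; apply: md_eigenM; apply: md_eigenN.
pose e k := gdim%:Z%:~R * b k + (-1)%:~R * codeg D k.
have eA : md_eigen D (gdim%:Z *: B + (-1) *: Z) e.
  by apply: md_eigenD; apply: md_eigenZ.
have ab k : aint (b k) by apply: aintM; apply: aint_char.
have [n bn] := md_eigen_prod_int eA eB ab.
have bE k : e k == 0 -> b k = codeg D k / gdim%:R.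
  rewrite /e mulN1r subr_eq0 => /eqP bk.
  by apply: (mulfI g0); rewrite [RHS]mulrC divfK.
have b01 k : e k == 0 -> 0 < b k <= 1.
  move=> ek; rewrite (bE k ek) divr_gt0 ?codeg_gt0 ?ltr0n ?gdim_gt0 //=.
  by rewrite ler_pdivrMr ?ltr0n ?gdim_gt0 // mul1r codeg_le.
have eo : e o == 0.
  rewrite /e mulN1r subr_eq0 /b md_conj -[X in X * _]/(gdim%:R) -codeg_j0.
  by rewrite md_codeg.
have n1 : (1 : C) <= n%:~R.
  rewrite -[1]/(1%:~R) ler_int -gtz0_ge1 -(ltr0z C) -bn prodr_gt0 // => k.
  by case/b01/andP.
rewrite -md_conj -/(b o); apply: le_anti; case/andP: (b01 o eo) => b0 -> /=.
apply: (le_trans n1); rewrite -bn (bigD1 o) //= -[leRHS]mulr1 ler_pM2l //.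
by apply: prodr_ile1 => k /andP[/b01/andP[/ltW-> ->]].
Qed.

Lemma codeg_unit : codeg D o = gdim%:R.
Proof. by rewrite -(md_codeg D j0) md_unitary0 mulr1 codeg_j0. Qed.

(** The inequality holds termwise by [char_bound], and the sums of squares agree by [codeg_unit]. *)
Lemma md_norm_dim i : `|h o i| = (dim i)%:R.
Proof.
have le_i j : `|h o j| ^+ 2 <= (dim j)%:R ^+ 2.
  by rewrite lerXn2r ?nnegrE ?normr_ge0 ?ler0n // -dimE (char_bound o j hj0_gt0).
have: \sum_j ((dim j)%:R ^+ 2 - `|h o j| ^+ 2) == 0.
  rewrite sumrB subr_eq0; apply/eqP; transitivity (codeg D o).
    by rewrite codeg_unit /gdim natr_sum; apply: eq_bigr => j _; rewrite natrX.
  by apply: eq_bigr => j _; rewrite normCK.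
rewrite psumr_eq0 => [/allP/(_ i (mem_index_enum _))/implyP/(_ isT)|j _]; last first.
  by rewrite subr_ge0.
rewrite subr_eq0 eqrXn2 ?normr_ge0 ?ler0n // => /eqP->.
by [].
Qed.

Lemma codegE k : codeg D k = gdim%:R / (dim k)%:R ^+ 2.
Proof.
have k0 : (dim k)%:R != 0 :> C by rewrite pnatr_eq0 -lt0n.
by rewrite -codeg_unit -(md_codeg D k) -normCK md_norm_dim mulfK ?expf_neq0.
Qed.

(** The quotient is the codegree, a rational algebraic integer. *)
Lemma dim_sqr_dvd k : (dim k ^ 2 %| gdim)%N.
Proof.
have k0 : (dim k)%:R ^+ 2 != 0 :> C by rewrite expf_neq0 // pnatr_eq0 -lt0n.
have ck : codeg D k * ((dim k)%:Z ^+ 2)%:~R = gdim%:Z%:~R.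
  by rewrite codegE rmorphXn /= divfK.
have [||n kn] := aint_rational _ ck.
- by rewrite expf_neq0 // -lt0n.
- by apply: aint_sum => i _; rewrite -md_conj; apply: aintM; apply: aint_char.
move: ck; rewrite kn -rmorphM => /intr_inj e.
apply/dvdnP; exists `|n|%N; have := congr1 absz e.
by rewrite abszM abszX => /esym.
Qed.

Lemma md_plancherel i j :
  \sum_k (dim k)%:R ^+ 2 * h k i * (h k j)^* = gdim%:R * (i == j)%:R.
Proof.
rewrite -(md_orth2 D) mulr_sumr; apply: eq_bigr => k _.
have k0 : (dim k)%:R != 0 :> C by rewrite pnatr_eq0 -lt0n.
have g0 : gdim%:R != 0 :> C by rewrite pnatr_eq0 -lt0n gdim_gt0.
by rewrite codegE; field; rewrite g0 k0.
Qed.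

(* A column of the S-matrix without zeros has constant modulus: by the
   arithmetic-geometric mean inequality on each set of simple objects of a
   given dimension, on which the product of the values is a nonzero rational
   integer. *)
Lemma md_burnside j : (forall k, h k j != 0) -> forall k, `|h k j| = 1.
Proof.
move=> hj0; pose b k := h k j * h k (j^∨).
have bE k : b k = `|h k j| ^+ 2 by rewrite normCK /b md_conj.
have b_gt0 k : 0 < b k by rewrite bE exprn_gt0 // normr_gt0.
have [Z eZ] := md_eigen_codeg D.
have [B eB] : exists B, md_eigen D B b.
  by eexists; apply: md_eigenM; apply: md_eigenN.
have prod_ge1 n : 1 <= \prod_(k | dim k == n) b k.
  (* By [codegE] this element vanishes exactly at the characters with [dim k = n]. *)
  pose e k := (n%:Z ^+ 2)%:~R * codeg D k + - (gdim%:Z)%:~R * 1.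
  have eA : md_eigen D (n%:Z ^+ 2 *: Z + (- gdim%:Z) *: 1%:M) e.
    rewrite /e -rmorphN; apply: md_eigenD; apply: md_eigenZ => //.
    exact: md_eigen1.
  have g0 : gdim%:R != 0 :> C by rewrite pnatr_eq0 -lt0n gdim_gt0.
  have e0 k : (e k == 0) = (dim k == n).
    have k0 : (dim k)%:R != 0 :> C by rewrite pnatr_eq0 -lt0n.
    rewrite /e mulr1 subr_eq0 codegE rmorphXn /= -[n%:~R]/(n%:R) -[gdim%:~R]/(gdim%:R).
    rewrite mulrCA -[X in _ == X]mulr1 (inj_eq (mulfI g0)).
    rewrite -[1 in X in _ == X](divff (expf_neq0 2 k0)) (inj_eq (mulIf _)) ?invr_eq0 ?expf_neq0 //.
    by rewrite eqrXn2 ?ler0n // eqr_nat eq_sym.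
  have [|m bm] := md_eigen_prod_int eA eB.
    by move=> k; apply: aintM; apply: aint_char.
  rewrite -(eq_bigl _ _ e0) bm -[1]/(1%:~R) ler_int -gtz0_ge1 -(ltr0z C) -bm.
  by rewrite prodr_gt0.
pose cls n := [pred k | dim k == n].
pose mu n := (\sum_(k in cls n) b k) / #|cls n|%:R.
have agm n : \prod_(k in cls n) b k <= mu n ^+ #|cls n|
    ?= iff [forall i in cls n, forall k in cls n, b i == b k].
  by apply: leif_AGM => k _; apply: ltW.
have mu_ge0 n : 0 <= mu n by rewrite divr_ge0 ?ler0n ?sumr_ge0 // => k _; apply: ltW.
have sum_ge n : #|cls n|%:R <= \sum_(k in cls n) b k.
  case: (posnP #|cls n|) => [->|c0].
    by apply: sumr_ge0 => k _; apply: ltW.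
  rewrite -[leLHS]mul1r -ler_pdivlMr ?ltr0n // -(expr_ge1 c0 (mu_ge0 n)) //.
  by apply: le_trans (prod_ge1 n) _; apply: (agm n).1.
(* Plancherel for the column [j], grouped by dimension. Every term is nonnegative by [sum_ge], so
   each class has mean 1, which is the equality case of the inequality between the means. *)
have sum0 : \sum_(n < gdim.+1) n%:R ^+ 2 * (\sum_(k in cls n) b k - #|cls n|%:R) = 0.
  transitivity (\sum_k (dim k)%:R ^+ 2 * (b k - 1)); last first.
    under eq_bigr do rewrite mulrBr mulr1 /b md_conj mulrA.
    rewrite sumrB md_plancherel eqxx mulr1 /gdim natr_sum; apply/eqP.
    by rewrite subr_eq0; apply/eqP/eq_bigr => k _; rewrite natrX.
  have dimlt k : (dim k < gdim.+1)%N.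
    rewrite ltnS; apply: (@leq_trans (dim k ^ 2)); first by rewrite -mulnn leq_pmulr.
    by rewrite /gdim (bigD1 k) //= leq_addr.
  rewrite [RHS](partition_big (fun k => Ordinal (dimlt k)) xpredT) //=.
  apply: eq_bigr => n _; rewrite -sumr_const -sumrB mulr_sumr.
  by apply: eq_big => [k|k /eqP <-].
move=> k; have /eqP := sum0; rewrite psumr_eq0 => [/allP|n _]; last first.
  by rewrite mulr_ge0 ?exprn_ge0 ?ler0n // subr_ge0.
have dimk : (dim k < gdim.+1)%N.
  rewrite ltnS; apply: (@leq_trans (dim k ^ 2)); first by rewrite -mulnn leq_pmulr.
  by rewrite /gdim (bigD1 k) //= leq_addr.
move/(_ (Ordinal dimk) (mem_index_enum _))/implyP/(_ isT) => /=.
rewrite mulf_eq0 expf_eq0 /= pnatr_eq0 -leqn0 leqNgt dim_gt0 /= subr_eq0 => /eqP sumk.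
have ck : k \in cls (dim k) by rewrite inE.
have c0 : #|cls (dim k)|%:R != 0 :> C by rewrite pnatr_eq0 -lt0n; apply/card_gt0P; exists k.
have mu1 : mu (dim k) = 1 by rewrite /mu sumk divff.
have [le_agm eq_agm] := agm (dim k); rewrite mu1 expr1n in le_agm eq_agm.
have : \prod_(i in cls (dim k)) b i == 1 by rewrite eq_le le_agm prod_ge1.
rewrite eq_agm => /forall_inP beq.
have : b k = 1.
  apply: (mulfI c0); rewrite mulr1 -[RHS]sumk mulr_natl -sumr_const.
  by apply: eq_bigr => i /beq/forall_inP/(_ k ck)/eqP.
by rewrite bE => /eqP; rewrite expr2 -expr2 sqrp_eq1 ?normr_ge0 // => /eqP.
Qed.

End Pseudounitary.

(** * A prime ideal above p in the ring of algebraic integers *)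

Section MaximalIdeal.
Context {C : numClosedFieldType} (p : nat) (p_prime : prime p).
Local Open Scope classical_set_scope.

Record aint_ideal (I : set C) : Prop := {
  ideal_aint : forall x, I x -> aint x;
  ideal_p : I p%:R;
  ideal_add : forall x y, I x -> I y -> I (x + y);
  ideal_mul : forall a x, aint a -> I x -> I (a * x);
  ideal_proper : ~ I 1 }.

(** Properness: the inverse of p is rational but not an integer, so it is not an algebraic
    integer. *)
Lemma ideal_pO : aint_ideal [set x | exists2 y, aint y & x = p%:R * y].
Proof.
split.
- by move=> _ [y ay ->]; apply: aintM (aint_nat p) ay.
- by exists 1; rewrite ?mulr1 //; apply: (aint_nat 1).
- by move=> _ _ [y ay ->] [z az ->]; exists (y + z); rewrite ?mulrDr //; apply: aintD.
- by move=> a _ aa [y ay ->]; exists (a * y); [apply: aintM|rewrite mulrCA].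
case=> y ay py; have [||n yn] := @aint_rational _ y 1 p%:Z _ _ ay.
- by rewrite eqz_nat -lt0n prime_gt0.
- by rewrite mulrC [in RHS]py.
move: py; rewrite yn -[p%:R]/(p%:Z%:~R) -rmorphM -[1]/(1%:~R) => /intr_inj/(congr1 absz).
rewrite abszM => /esym/eqP; rewrite muln_eq1 => /andP[/eqP p1 _].
by move: p_prime; rewrite -[p]/(`|p%:Z|%N) p1.
Qed.

Lemma prime_ideal_exists : exists I : set C, aint_ideal I /\
  forall x y, aint x -> aint y -> I (x * y) -> I x \/ I y.
Proof.
have [|A [PA Amax]] := @Zorn_bigcup C (fun I => I = set0 \/ aint_ideal I).
  move=> F FP Ftot; have [F0|/existsNP[J /not_implyP[FJ J0]]] :=
    pselect (forall J, F J -> J = set0).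
    by left; apply/seteqP; split=> // x [J /F0->].
  right; have idF I x : F I -> I x -> aint_ideal I.
    by move=> FI Ix; case: (FP I FI) => // I0; rewrite I0 in Ix.
  have idJ : aint_ideal J by case: (FP J FJ).
  split.
  - by move=> x [I FI Ix]; apply: ideal_aint (idF I x FI Ix) _ Ix.
  - by exists J => //; apply: ideal_p idJ.
  - move=> x y [I FI Ix] [I' FI' Iy]; have [II'|I'I] := Ftot I I' FI FI'.
      by exists I' => //; apply: (ideal_add (idF I' y FI' Iy)) => //; apply: II'.
    by exists I => //; apply: (ideal_add (idF I x FI Ix)) => //; apply: I'I.
  - by move=> a x aa [I FI Ix]; exists I => //; apply: (ideal_mul (idF I x FI Ix)).
  - by case=> I FI I1; apply: (ideal_proper (idF I 1 FI I1)).
have idA : aint_ideal A.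
  case: PA => // A0; exfalso; apply: Amax (or_intror ideal_pO).
  by rewrite A0; split=> // /(_ _ (ideal_p ideal_pO)).
exists A; split=> // x y ax ay Axy; have [Ax|Ax] := pselect (A x); [by left|right].
(* The ideal generated by [A] and [x]. If it contains 1, then multiplying by [y] puts [y] in [A];
   otherwise maximality fails, since it contains [x]. *)
pose B := [set z | exists u v, [/\ A u, aint v & z = u + v * x]].
have A0 : A 0.
  by rewrite -(mul0r p%:R); apply: (ideal_mul idA) (ideal_p idA); apply: (aint_nat 0).
have AB : A `<=` B.
  by move=> u Au; exists u, 0; split; rewrite ?mul0r ?addr0 //; apply: (aint_nat 0).
have Bx : B x.
  by exists 0, 1; split; rewrite ?mul1r ?add0r //; apply: (aint_nat 1).
have : ~ aint_ideal B.
  by move=> idB; apply: Amax (or_intror idB); split=> // /(_ _ Bx).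
move=> idB; apply: contrapT => Ay; apply: idB; split.
- by move=> _ [u [v [Au av ->]]]; apply: aintD; [apply: (ideal_aint idA)|apply: aintM].
- by apply: AB; apply: (ideal_p idA).
- move=> _ _ [u [v [Au av ->]]] [u' [v' [Au' av' ->]]].
  exists (u + u'), (v + v'); split; [exact: (ideal_add idA)|exact: (aintD av)|ring].
- move=> a _ aa [u [v [Au av ->]]]; exists (a * u), (a * v).
  by split; [apply: (ideal_mul idA)|apply: aintM|ring].
case=> u [v [Au av e]]; apply: Ay; rewrite -[y]mul1r e mulrDl [u * y]mulrC.
apply: (ideal_add idA); first exact: (ideal_mul idA).
by rewrite -mulrA; apply: (ideal_mul idA).
Qed.

Lemma ideal_nat (I : set C) (n : nat) : aint_ideal I -> I n%:R -> (p %| n)%N.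
Proof.
move=> idI In; apply: contrapT => /negP pn.
have cop : coprime p n by rewrite prime_coprime.
have [] := egcdnP n (prime_gt0 p_prime) => u v uv _.
apply: (ideal_proper idI).
have -> : 1 = u%:R * p%:R + (- 1) * (v%:R * n%:R) :> C.
  by rewrite -!natrM uv (eqP cop) natrD mulN1r addrAC subrr add0r.
apply: (ideal_add idI); apply: (ideal_mul idI) => //; first exact: aint_nat.
- exact: ideal_p.
- exact: (aint_int (-1)).
by apply: (ideal_mul idI) => //; apply: aint_nat.
Qed.

End MaximalIdeal.

(** * The characters congruent to the unit character modulo p *)

Section PrincipalBlock.
Context {C : numClosedFieldType} {r : nat} (D : modular_datum C r).
Local Notation o := (md0 D).
Local Notation N := (mdN D).
Local Notation "i ^∨" := (mdual D i) (at level 2, format "i ^∨").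
Local Notation h := (mdh D).
Context (j0 : 'I_r) (dim : 'I_r -> nat).
Context (dim_gt0 : forall i, (0 < dim i)%N) (dimE : forall i, h j0 i = (dim i)%:R).
Local Notation gdim := (gdim dim).

Let md_plancherel := md_plancherel dim_gt0 dimE.

(** All moduli are at most 1 by [char_bound], while by Plancherel their weighted mean square is
    1. *)
Lemma md_norm_one j : dim j = 1%N -> forall k, `|h k j| = 1.
Proof.
move=> dj k; have h1 l : `|h l j| <= 1.
  by have := char_bound l j (hj0_gt0 dim_gt0 dimE); rewrite dimE dj.
have: \sum_l (dim l)%:R ^+ 2 * (1 - `|h l j| ^+ 2) == 0.
  under eq_bigr do rewrite mulrBr mulr1 normCK mulrA.
  rewrite sumrB md_plancherel eqxx mulr1 /gdim natr_sum subr_eq0.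
  by apply/eqP/eq_bigr => l _; rewrite natrX.
rewrite psumr_eq0 => [/allP/(_ k (mem_index_enum _))/implyP/(_ isT)|l _]; last first.
  by rewrite mulr_ge0 ?exprn_ge0 ?ler0n // subr_ge0 exprn_ile1.
rewrite mulf_eq0 expf_eq0 /= pnatr_eq0 -leqn0 leqNgt dim_gt0 /= subr_eq0 eq_sym.
by rewrite sqrp_eq1 ?normr_ge0 // => /eqP.
Qed.

Context (p : nat) (p_prime : prime p) (p_dvd : (p %| gdim)%N) (p2_ndvd : ~~ (p ^ 2 %| gdim)%N).
Context (I : set C) (idI : aint_ideal p I).
Context (primeI : forall x y, aint x -> aint y -> I (x * y) -> I x \/ I y).

Let I0 : I 0.
Proof. by rewrite -(mul0r p%:R); apply: (ideal_mul idI) (ideal_p idI); apply: (aint_nat 0). Qed.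

Let IN x : I x -> I (- x).
Proof. by rewrite -mulN1r; apply: (ideal_mul idI); apply: (aint_int (-1)). Qed.

Let IB x y : I x -> I y -> I (x - y).
Proof. by move=> Ix /IN; apply: (ideal_add idI). Qed.

(** Multiplying by the conjugate would put the square of [dim k] in the ideal, so p would divide
    [dim k] and p^2 would divide [gdim]. *)
Lemma dim_notin k : ~ I (h o k).
Proof.
move=> Ik; have := ideal_mul idI (aint_char D o (k^∨)) Ik.
rewrite mulrC md_conj -normCK (md_norm_dim dim_gt0 dimE) -natrX.
move=> /(ideal_nat p_prime idI); rewrite Euclid_dvdX // andbT => pk.
case/negP: p2_ndvd; apply: dvdn_trans (dim_sqr_dvd dim_gt0 dimE k).
by rewrite dvdn_exp2r.
Qed.

Definition in_block (k : 'I_r) : bool := `[< forall i, I (h k i - h o i) >].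

(** Symmetry of the S-matrix exchanges characters and objects; the factor [h o k] can be cancelled
    modulo the prime ideal by [dim_notin]. *)
Lemma in_block_sym j : in_block j -> forall k, I (h k j - h o j).
Proof.
move=> /asboolP bj k; have := bj k => Ijk.
have : I (h o k * (h k j - h o j)).
  rewrite mulrBr md_sym [h o k * h o j]mulrC -mulrBr.
  by apply: (ideal_mul idI) Ijk; apply: aint_char.
have ao : aint (h k j - h o j) by apply: aintB; apply: aint_char.
by case/(primeI (aint_char _ _ _) ao) => // /dim_notin.
Qed.

Lemma block_span (s : seq ('I_r * C)) : (forall x, x \in s -> aint x.2) ->
  exists a : 'I_r -> C, (forall i, aint (a i)) /\
    forall k, \prod_(x <- s) (h k x.1 - x.2) = \sum_i a i * h k i.
Proof.
elim: s => [|[i c] s IHs] sa.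
  exists (fun i => (i == o)%:R); split=> [i|k]; first exact: aint_nat.
  rewrite big_nil (bigD1 o) //= eqxx mul1r md_unit big1 ?addr0 // => i /negPf->.
  by rewrite mul0r.
have [x xs|a [aa ae]] := IHs; first by apply: sa; rewrite inE xs orbT.
exists (fun l => \sum_j a j * (N i j l)%:R - c * a l); split=> [l|k].
  apply: aintB; last by apply: aintM => //; apply: (sa (i, c)); rewrite inE eqxx.
  by apply: aint_sum => j _; apply: aintM => //; apply: aint_nat.
rewrite big_cons ae /= mulrBl mulr_sumr; under [RHS]eq_bigr do rewrite mulrBl mulr_suml.
rewrite sumrB; congr (_ - _); last first.
  by rewrite mulr_sumr; apply: eq_bigr => l _; rewrite mulrA.
rewrite exchange_big; apply: eq_bigr => j _ /=.
rewrite mulrCA md_mul mulr_sumr; apply: eq_bigr => l _.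
by rewrite mulrA.
Qed.

(** For each character [k] outside the block choose an object [sp k] that separates it from the unit
    character modulo the ideal. The product [e] of the corresponding differences vanishes outside
    the block and is congruent on it to [e o], which is not in the ideal: up to a factor it is the
    idempotent of the block. *)
Lemma block_dvd : (p %| \sum_(k | in_block k) dim k ^ 2)%N.
Proof.
have sep k : exists i, ~~ in_block k -> ~ I (h k i - h o i).
  have [bk|/asboolPn/existsNP[i ki]] := boolP (in_block k); first by exists o.
  by exists i.
have [sp spP] := choice sep.
pose s := [seq (sp k, h k (sp k)) | k <- enum [pred k | ~~ in_block k]].
pose e l := \prod_(x <- s) (h l x.1 - x.2).
have eE l : e l = \prod_(k | ~~ in_block k) (h l (sp k) - h k (sp k)).
  by rewrite /e big_map big_enum.
have [x /mapP[k _ ->]|a [aa ae]] := @block_span s; first exact: aint_char.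
(* By [block_span] the values [e l] come from a combination of simple objects with algebraic integer
   coefficients; Plancherel against the unit column extracts the coefficient of the unit, times
   [gdim]. *)
have Isum : I (\sum_l (dim l)%:R ^+ 2 * e l).
  have -> : \sum_l (dim l)%:R ^+ 2 * e l = gdim%:R * a o.
    transitivity (\sum_i a i * (gdim%:R * (i == o)%:R)).
      under eq_bigr do rewrite /e ae mulr_sumr.
      rewrite exchange_big; apply: eq_bigr => i _ /=.
      rewrite -md_plancherel mulr_sumr; apply: eq_bigr => l _.
      by rewrite md_unit conjC1 mulr1 mulrCA.
    rewrite (bigD1 o) //= eqxx mulr1 mulrC big1 ?addr0 // => i /negPf->.
    by rewrite !mulr0.
  rewrite mulrC; apply: (ideal_mul idI) => //; have /dvdnP[q ->] := p_dvd.
  by rewrite natrM; apply: (ideal_mul idI); [apply: aint_nat|apply: ideal_p].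
have aB l k i : aint (h l i - h k i) by apply: aintB; apply: aint_char.
have ae' l : aint (e l) by rewrite eE; apply: aint_prod.
have e_notin : ~ I (e o).
  rewrite eE; suff [] : aint (\prod_(k | ~~ in_block k) (h o (sp k) - h k (sp k))) /\
    ~ I (\prod_(k | ~~ in_block k) (h o (sp k) - h k (sp k))) by [].
  elim/big_ind: _ => [|x y [ax Ix] [ay Iy]|k bk].
  - by split; [apply: (aint_nat 1)|apply: (ideal_proper idI)].
  - by split; [apply: aintM|case/(primeI ax ay)].
  - by split=> // /IN; rewrite opprB; apply: spP.
have e_block l : in_block l -> I (e l - e o).
  move=> /asboolP bl; rewrite !eE.
  suff [] : I (\prod_(k | ~~ in_block k) (h l (sp k) - h k (sp k)) -
      \prod_(k | ~~ in_block k) (h o (sp k) - h k (sp k))) /\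
      aint (\prod_(k | ~~ in_block k) (h o (sp k) - h k (sp k))) by [].
  elim/big_rec2: _ => [|k y2 y1 bk [Iy ay]].
    by rewrite subrr; split=> //; apply: (aint_nat 1).
  split; last exact: aintM.
  have -> : (h l (sp k) - h k (sp k)) * y1 - (h o (sp k) - h k (sp k)) * y2 =
    (h l (sp k) - h k (sp k)) * (y1 - y2) + y2 * (h l (sp k) - h o (sp k)) by ring.
  by apply: (ideal_add idI); apply: (ideal_mul idI).
have e_out l : ~~ in_block l -> e l = 0.
  by move=> bl; rewrite eE (bigD1 l) //= subrr mul0r.
have Iblock : I (e o * (\sum_(k | in_block k) dim k ^ 2)%N%:R).
  have -> : e o * (\sum_(k | in_block k) dim k ^ 2)%N%:R =
      \sum_l (dim l)%:R ^+ 2 * e l - \sum_(k | in_block k) (dim k)%:R ^+ 2 * (e k - e o).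
    rewrite [X in _ = X - _](bigID in_block) /= [X in _ = _ + X - _]big1 => [|k /e_out->]; last by rewrite mulr0.
    rewrite addr0 -sumrB natr_sum mulr_sumr; apply: eq_bigr => k _.
    by rewrite natrX; ring.
  apply: IB => //; elim/big_ind: _ => // [x y|k bk]; first exact: (ideal_add idI).
  by apply: (ideal_mul idI); [rewrite -natrX; apply: aint_nat|apply: e_block].
by case/(primeI (ae' o) (aint_nat _)): Iblock => [/e_notin//|/(ideal_nat p_prime idI)].
Qed.

Lemma in_block_dim j : in_block j -> dim j = 1%N.
Proof.
move=> bj; have hj0 k : h k j != 0.
  apply/eqP => hkj; have := in_block_sym bj k; rewrite hkj sub0r => /IN.
  by rewrite opprK => /dim_notin.
have := md_burnside dim_gt0 dimE hj0 j0.
by rewrite dimE normr_nat => /eqP; rewrite pnatr_eq1 => /eqP.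
Qed.

Lemma card_block_dvd : (p %| #|[pred k | in_block k]|)%N.
Proof.
rewrite -sum1_card; have := block_dvd.
by rewrite (eq_bigr (fun=> 1%N)) // => k /in_block_dim->.
Qed.

Lemma in_blockP j : reflect (forall k, I (h k j - h o j)) (in_block j).
Proof.
apply: (iffP idP) => [/in_block_sym //|bj]; apply/asboolP => k.
have : I (h o j * (h j k - h o k)).
  rewrite mulrBr -md_sym [h o j * h o k]mulrC -mulrBr.
  by apply: (ideal_mul idI) (bj k); apply: aint_char.
have ao : aint (h j k - h o k) by apply: aintB; apply: aint_char.
by case/(primeI (aint_char _ _ _) ao) => // /dim_notin.
Qed.

End PrincipalBlock.

(** * The group of invertible objects *)

Section InvertibleGroup.
Context {C : numClosedFieldType} {r : nat} (D : modular_datum C r).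
Local Notation o := (md0 D).
Local Notation N := (mdN D).
Local Notation h := (mdh D).
Context (j0 : 'I_r) (dim : 'I_r -> nat).
Context (dim_gt0 : forall i, (0 < dim i)%N) (dimE : forall i, h j0 i = (dim i)%:R).
Local Notation gdim := (gdim dim).
Implicit Types σ τ : {perm 'I_r}.

Let md_plancherel := md_plancherel dim_gt0 dimE.
Let gdim_neq0 : gdim%:R != 0 :> C.
Proof. by rewrite pnatr_eq0 -lt0n (gdim_gt0 D). Qed.

(* The invertible objects, encoded as the permutations of the simple objects
   given by tensoring with them. *)
Definition inv_set : {set {perm 'I_r}} :=
  [set σ : {perm 'I_r} | [forall k, forall j, h k (σ j) == h k (σ o) * h k j]].

Lemma inv_setP σ : reflect (forall k j, h k (σ j) = h k (σ o) * h k j) (σ \in inv_set).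
Proof.
rewrite inE; apply: (iffP forallP) => [H k j|H k]; first by have /forallP/(_ j)/eqP := H k.
by apply/forallP => j; apply/eqP.
Qed.

Lemma inv_group_set : group_set inv_set.
Proof.
apply/group_setP; split=> [|σ τ /inv_setP Hσ /inv_setP Hτ].
  by apply/inv_setP => k j; rewrite !perm1 md_unit mul1r.
by apply/inv_setP => k j; rewrite !permM Hτ Hσ mulrA -Hτ.
Qed.

Definition inv_group := Group inv_group_set.
Local Notation G := inv_group.

Lemma invP σ : σ \in G -> forall k j, h k (σ j) = h k (σ o) * h k j.
Proof. by move/inv_setP. Qed.

Lemma col_inj i j : (forall k, h k i = h k j) -> i = j.
Proof.
move=> ij; have := md_plancherel i j; under eq_bigr do rewrite ij.
rewrite md_plancherel eqxx => /(mulfI gdim_neq0)/eqP.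
by have [//|_] := eqVneq i j; rewrite oner_eq0.
Qed.

Lemma inv_inj : {in G &, injective (fun σ => σ o)}.
Proof.
move=> σ τ Gσ Gτ /= στ; apply/permP => j; apply: col_inj => k.
by rewrite (invP Gσ) (invP Gτ) στ.
Qed.

(** The permutation multiplies all dimensions by [dim (σ o)] and preserves the sum of their
    squares. *)
Lemma inv_dim σ : σ \in G -> dim (σ o) = 1%N.
Proof.
move=> Gσ; have dσ j : dim (σ j) = (dim (σ o) * dim j)%N.
  by apply/eqP; rewrite -(eqr_nat C) natrM -!dimE (invP Gσ).
have : gdim = (dim (σ o) ^ 2 * gdim)%N.
  rewrite {1}/gdim (reindex_inj (@perm_inj _ σ)) /= /gdim big_distrr /=.
  by apply: eq_bigr => j _; rewrite dσ expnMn.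
rewrite -{1}[gdim]mul1n => /eqP; rewrite eqn_pmul2r ?(gdim_gt0 D) // eq_sym.
by rewrite -[1%N](exp1n 2) eqn_exp2r // => /eqP.
Qed.

Lemma dim_perm σ j : σ \in G -> dim (σ j) = dim j.
Proof.
move=> Gσ; apply/eqP; rewrite -(eqr_nat C) -!dimE (invP Gσ) !dimE inv_dim //.
by rewrite mul1r.
Qed.

(** The Verlinde formula. *)
Lemma md_fusion_coef i j l :
  gdim%:R * (N i j l)%:R = \sum_k (dim k)%:R ^+ 2 * (h k i * h k j) * (h k l)^*.
Proof.
transitivity (\sum_m (N i j m)%:R * (gdim%:R * (m == l)%:R) : C).
  rewrite (bigD1 l) //= eqxx mulr1 mulrC big1 ?addr0 // => m /negPf->.
  by rewrite !mulr0.
under [RHS]eq_bigr do rewrite md_mul mulr_sumr mulr_suml.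
rewrite [RHS]exchange_big; apply: eq_bigr => m _ /=.
by rewrite -md_plancherel mulr_sumr; apply: eq_bigr => k _; ring.
Qed.

Lemma inv_fusion σ j l : σ \in G -> N (σ o) j l = (l == σ j).
Proof.
move=> Gσ; apply/eqP; rewrite -(eqr_nat C) -(inj_eq (mulfI gdim_neq0)).
rewrite md_fusion_coef [l == _]eq_sym -md_plancherel; apply/eqP/eq_bigr => k _.
by rewrite -(invP Gσ).
Qed.

(** Since all [h k j] have modulus 1, multiplication by [j] preserves the Plancherel norm. The
    squares of the multiplicities in the product of [j] and [a] thus add up to 1, so this product is
    simple. *)
Lemma inv_exists j : dim j = 1%N -> exists2 σ, σ \in G & σ o = j.
Proof.
move=> dj; have hj := md_norm_one dim_gt0 dimE dj.
have hj0 k : h k j != 0 by rewrite -normr_eq0 hj oner_eq0.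
have prod_j a : exists l, forall k, h k l = h k j * h k a.
  have N1 : (\sum_l N j a l ^ 2 = 1)%N.
    have e : gdim%:R * (\sum_l N j a l ^ 2)%N%:R =
        \sum_k (dim k)%:R ^+ 2 * h k a * (h k a)^* :> C; last first.
      move: e; rewrite md_plancherel eqxx => /(mulfI gdim_neq0)/eqP.
      by rewrite eqr_nat => /eqP.
    rewrite natr_sum mulr_sumr.
    have e2 k : (dim k)%:R ^+ 2 * h k a * (h k a)^* =
        \sum_l (dim k)%:R ^+ 2 * (h k j * h k a) * (h k l)^* * (N j a l)%:R.
      transitivity ((dim k)%:R ^+ 2 * (h k j * h k a) * (h k j * h k a)^*).
        rewrite rmorphM /=; transitivity
          ((dim k)%:R ^+ 2 * h k a * (h k a)^* * (h k j * (h k j)^*)); last by ring.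
        by rewrite -normCK hj expr1n mulr1.
      rewrite [X in _ * X^*]md_mul rmorph_sum mulr_sumr; apply: eq_bigr => l _.
      by rewrite rmorphM /= conjC_nat; ring.
    under [RHS]eq_bigr do rewrite e2.
    rewrite [RHS]exchange_big; apply: eq_bigr => l _ /=.
    by rewrite natrX expr2 mulrA md_fusion_coef mulr_suml.
  have [l Nl] : exists l, (0 < N j a l)%N.
    apply: contrapT => /forallNP N0; move: N1; rewrite big1 // => l _.
    by move/negP: (N0 l); rewrite -leqNgt leqn0 => /eqP->.
  exists l => k; rewrite md_mul (bigD1 l) //=.
  move: N1; rewrite (bigD1 l) //= => N1.
  have Nl1 : N j a l = 1%N by apply/eqP; rewrite eqn_leq Nl andbT; nia.
  move: N1; rewrite Nl1 exp1n => -[/eqP]; rewrite sum_nat_eq0 => /forallP N0.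
  rewrite mul1r big1 ?addr0 // => m ml.
  by have /implyP/(_ ml) := N0 m; rewrite expn_eq0 andbT => /eqP->; rewrite mul0r.
have [f fE] := choice prod_j.
have f_inj : injective f.
  move=> a b fab; apply: col_inj => k; apply: (mulfI (hj0 k)).
  by rewrite -!fE fab.
exists (perm f_inj); last first.
  by apply: col_inj => k; rewrite permE fE md_unit mulr1.
by apply/inv_setP => k a; rewrite !permE !fE md_unit mulr1.
Qed.

Lemma inv_card : #|G| = #|[pred j | dim j == 1%N]|.
Proof.
rewrite -(card_in_imset inv_inj); apply: eq_card => j; rewrite inE.
apply/imsetP/eqP => [[σ Gσ ->]|/inv_exists[σ Gσ <-]]; first exact: inv_dim.
by exists σ.
Qed.

(* The scalar by which the double braiding of k with σ o acts. *)
Definition chi k σ : C := h k (σ o) / h o (σ o).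

Lemma chiM k : {in G &, forall σ τ, chi k (σ * τ)%g = chi k σ * chi k τ}.
Proof.
by move=> σ τ Gσ Gτ; rewrite /chi permM !(invP Gτ _ (σ o)) mulf_div [h k _ * _]mulrC [h o _ * _]mulrC.
Qed.

Lemma chi1 k : chi k 1%g = 1.
Proof. by rewrite /chi perm1 !md_unit divr1. Qed.

Lemma chiX k σ n : σ \in G -> chi k (σ ^+ n)%g = chi k σ ^+ n.
Proof.
move=> Gσ; elim: n => [|n IHn]; first by rewrite expg0 chi1.
by rewrite expgS exprS chiM ?groupX // IHn.
Qed.

Lemma chi_sym σ τ : chi (σ o) τ = chi (τ o) σ.
Proof.
rewrite /chi (md_symC D (σ o) (τ o)); have := md_dim_neq0 D (σ o).
by have := md_dim_neq0 D (τ o) => t0 s0; field; rewrite s0 t0.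
Qed.

Lemma chi_perm σ τ k : σ \in G -> τ \in G -> chi (σ k) τ = chi (σ o) τ * chi k τ.
Proof.
move=> Gσ Gτ; rewrite /chi (md_symC D (σ k)) (md_symC D (σ o)) (md_symC D k).
rewrite !(invP Gσ _ k).
have := md_dim_neq0 D (σ o); have := md_dim_neq0 D (τ o); have := md_dim_neq0 D k.
by move=> k0 t0 s0; field; rewrite s0 t0 k0.
Qed.

Definition centralizer (A : {set {perm 'I_r}}) : pred 'I_r :=
  [pred k | [forall τ in A, chi k τ == 1]].

Lemma centralizerP (A : {set {perm 'I_r}}) k :
  reflect {in A, forall τ, chi k τ = 1} (k \in centralizer A).
Proof. by apply: (iffP forall_inP) => H τ /H/eqP. Qed.

Section Subgroup.
Context (A : {group {perm 'I_r}}) (AG : A \subset G).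

Lemma sum_chi k : \sum_(τ in A) chi k τ = #|A|%:R * (k \in centralizer A)%:R.
Proof.
have [kA|kA] := boolP (k \in centralizer A).
  rewrite mulr1 -sumr_const; apply: eq_bigr => τ Aτ.
  exact: (centralizerP _ _ kA).
rewrite mulr0; have /forall_inPn[σ Aσ sk] := kA.
have Gσ := fintype.subsetP AG _ Aσ.
apply/eqP; have : chi k σ * \sum_(τ in A) chi k τ == \sum_(τ in A) chi k τ.
  rewrite mulr_sumr [X in _ == X](reindex_inj (mulgI σ)) /=; apply/eqP.
  apply: eq_big => [τ|τ Aτ]; first by rewrite groupMl.
  by rewrite chiM // (fintype.subsetP AG).
by rewrite -subr_eq0 -{2}[\sum_(_ in A) _]mul1r -mulrBl mulf_eq0 subr_eq0 (negPf sk).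
Qed.

(** Sum [dim k ^ 2 * chi k τ] over [k] and over [τ] in [A]. Summing over [τ] first selects the
    centralizer; summing over [k] first leaves only [τ = 1], by Plancherel. *)
Lemma dim_centralizer : (#|A| * \sum_(k in centralizer A) dim k ^ 2)%N = gdim.
Proof.
apply/eqP; rewrite -(eqr_nat C) natrM natr_sum; apply/eqP.
transitivity (\sum_k (dim k)%:R ^+ 2 * \sum_(τ in A) chi k τ : C).
  rewrite mulr_sumr [RHS](bigID (mem (centralizer A))) /= [X in _ + X]big1 => [|k kA].
    rewrite addr0; apply: eq_bigr => k kA; rewrite sum_chi.
    by rewrite kA mulr1 natrX mulrC.
  by rewrite sum_chi (negPf kA) !mulr0.
under eq_bigr do rewrite mulr_sumr.
rewrite exchange_big (bigD1 1%g) //= [X in _ + X]big1 => [|τ /andP[Aτ t1]].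
  under eq_bigr do rewrite chi1 mulr1 -natrX.
  by rewrite addr0 /gdim natr_sum.
transitivity ((h o (τ o))^-1 * \sum_k (dim k)%:R ^+ 2 * h k (τ o) * (h k o)^*).
  by rewrite mulr_sumr; apply: eq_bigr => k _; rewrite /chi md_unit conjC1; ring.
rewrite md_plancherel (_ : (τ o == o) = false) ?mulr0 //.
apply: contraNF t1 => /eqP t1; apply/eqP/inv_inj => //; first exact: (fintype.subsetP AG).
by rewrite perm1.
Qed.

Lemma card_sub_dvd : (#|A| %| gdim)%N.
Proof. by rewrite -dim_centralizer dvdn_mulr. Qed.

End Subgroup.

End InvertibleGroup.

Lemma squarefree_dvd (d n : nat) : (0 < d)%N -> squarefree d ->
  (forall p, prime p -> p %| d -> p %| n)%N -> (d %| n)%N.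
Proof.
move=> d0 sqf pn; apply/dvdn_partP => // p; rewrite mem_primes => /and3P[pp _ pd].
rewrite p_part; apply: dvdn_trans (pn p pp pd).
rewrite -[X in (_ %| X)%N]expn1 dvdn_exp2l // leqNgt.
apply/negP => l2; case/negP: (sqf p pp); apply: dvdn_trans (dvdn_part p d).
by rewrite p_part dvdn_exp2l.
Qed.

(** The fixed point congruence for a group of order p, applied to each level set of the weight
    [w]. *)
Lemma perm_fix_mod (I : finType) (σ : {perm I}) (p : nat) (Y : {pred I}) (w : I -> nat) :
  prime p -> #[σ]%g = p -> (forall k, (σ k \in Y) = (k \in Y)) ->
  (forall k, w (σ k) = w k) ->
  (\sum_(k in Y) w k = \sum_(k in Y | σ k == k) w k %[mod p])%N.
Proof.
move=> pp oσ Yσ wσ; pose B := (\max_k w k).+1.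
have wB k : (w k < B)%N by rewrite ltnS leq_bigmax.
have sumE (Z : {pred I}) :
    (\sum_(k in Z) w k = \sum_(n < B) n * #|[set k in Z | w k == n]|)%N.
  rewrite (partition_big (fun k => Ordinal (wB k)) xpredT) //=.
  apply: eq_bigr => n _; rewrite -sum1_card big_distrr /=.
  apply: eq_big => [k|k /andP[_ /eqP<-]]; last by rewrite muln1.
  by rewrite !inE -val_eqE.
rewrite (sumE Y) (sumE [pred k in Y | σ k == k]).
elim/big_ind2: _ => [//|x y u v xy uv|n _]; first by rewrite -modnDm xy uv modnDm.
rewrite -modnMmr -[RHS]modnMmr; congr (_ * _ %% _)%N.
rewrite (@pgroup_fix_mod _ _ _ ('P)%act p <[σ]>%G); last first.
- by rewrite cycle_subG; apply/astabsP => k; rewrite /= apermE !inE wσ Yσ.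
- by rewrite /pgroup -orderE oσ pnat_id.
congr (#|pred_of_set _| %% _)%N; apply/setP => k; rewrite afix_cycle finset.in_setI.
by rewrite (sameP afix1P eqP) /= apermE !inE andbAC.
Qed.

(** * The d-torsion of the group of invertible objects *)

Section Decompose.
Context {C : numClosedFieldType} {r : nat} (D : modular_datum C r).
Local Notation o := (md0 D).
Local Notation h := (mdh D).
Context (j0 : 'I_r) (dim : 'I_r -> nat).
Context (dim_gt0 : forall i, (0 < dim i)%N) (dimE : forall i, h j0 i = (dim i)%:R).
Local Notation gdim := (gdim dim).
Local Notation G := (inv_group D).
Implicit Types σ τ : {perm 'I_r}.
Context (d m : nat) (gdimE : gdim = (d * m)%N).
Context (d_gt0 : (0 < d)%N) (d_sqf : squarefree d) (d_cop : coprime d m).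

Lemma prime_exact p : prime p -> (p %| d)%N -> (p %| gdim)%N /\ ~~ (p ^ 2 %| gdim)%N.
Proof.
move=> pp pd; rewrite gdimE; split; first by rewrite dvdn_mulr.
have pm : coprime (p ^ 2) m by rewrite coprimeXl // (coprime_dvdl pd).
by rewrite Gauss_dvdl // d_sqf.
Qed.

Lemma inv_comm σ τ : σ \in G -> τ \in G -> commute σ τ.
Proof.
move=> Gσ Gτ; apply/permP => j; apply: (col_inj dim_gt0 dimE) => k.
by rewrite !permM (invP Gτ k (σ j)) (invP Gσ k (τ j)) (invP Gσ k j) (invP Gτ k j) mulrCA.
Qed.

(** The objects of the block are invertible, and in the column form of [in_blockP] the congruence is
    visibly stable under products. They form a subgroup, to which Lagrange's theorem applies. *)
Lemma prime_dvd_inv p : prime p -> (p %| d)%N -> (p %| #|G|)%N.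
Proof.
move=> pp pd; have [pg p2] := prime_exact pp pd.
have [I [idI primeI]] := prime_ideal_exists (C := C) pp.
have blockP := in_blockP dim_gt0 dimE pp p2 idI primeI.
pose B := [set σ in G | in_block D I (σ o)].
have Bgrp : group_set B.
  apply/group_setP; split=> [|σ τ].
    apply/setIdP; split; [exact: group1|rewrite perm1].
    apply/blockP => k; rewrite !md_unit subrr.
    by rewrite -(mul0r p%:R); apply: (ideal_mul idI) (ideal_p idI); apply: (aint_nat 0).
  move=> /setIdP[Gσ /blockP bσ] /setIdP[Gτ /blockP bτ].
  apply/setIdP; split; [exact: groupM|apply/blockP => k].
  rewrite permM !(invP Gτ _ (σ o)).
  have -> : h k (τ o) * h k (σ o) - h o (τ o) * h o (σ o) =
    h k (τ o) * (h k (σ o) - h o (σ o)) + h o (σ o) * (h k (τ o) - h o (τ o)) by ring.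
  by apply: (ideal_add idI); apply: (ideal_mul idI) => //; apply: aint_char.
have cardB : #|B| = #|[pred k | in_block D I k]|.
  have injB : {in B &, injective (fun σ => σ o)}.
    move=> σ τ /setIdP[Gσ _] /setIdP[Gτ _].
    exact: (inv_inj dim_gt0 dimE).
  rewrite -(card_in_imset injB); apply: eq_card => k; rewrite inE.
  apply/imsetP/idP => [[σ]|bk]; first by move=> /setIdP[_ bσ] ->.
  have dk := in_block_dim dim_gt0 dimE pp p2 idI primeI bk.
  have [σ Gσ σk] := inv_exists dim_gt0 dimE dk.
  by exists σ => //; apply/setIdP; rewrite σk.
have pB : (p %| #|B|)%N by rewrite cardB (card_block_dvd dim_gt0 dimE).
apply: dvdn_trans pB (cardSg (G := G) (H := Group Bgrp) _).
by apply/fintype.subsetP => σ /setIdP[].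
Qed.

Lemma d_dvd_inv : (d %| #|G|)%N.
Proof. exact: squarefree_dvd prime_dvd_inv. Qed.

Definition dtor_set := [set σ in G | σ ^+ d == 1]%g.

Lemma dtor_group_set : group_set dtor_set.
Proof.
apply/group_setP; split=> [|σ τ]; first by apply/setIdP; rewrite expg1n.
move=> /setIdP[Gσ /eqP sd] /setIdP[Gτ /eqP td]; apply/setIdP; split; first exact: groupM.
by rewrite expgMn ?sd ?td ?mulg1 //; apply: inv_comm.
Qed.

Definition dtor := Group dtor_group_set.
Local Notation A := dtor.

Lemma dtorG : A \subset G.
Proof. by apply/fintype.subsetP => σ /setIdP[]. Qed.

Lemma dtorP σ : σ \in A -> σ \in G. Proof. exact: (fintype.subsetP dtorG). Qed.

Lemma dtor_card : #|A| = d.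
Proof.
apply/eqP; rewrite eqn_dvd; apply/andP; split.
  (* By Cauchy a common prime divisor would be the order of an element of [A], hence a divisor of d.
     Coprimality then turns the divisibility of [d * m] by the order of [A] into one of d. *)
  have copA : coprime #|A| m.
    rewrite coprime_has_primes ?cardG_gt0 //.
      apply/hasPn => q; rewrite mem_primes => /and3P[qp _ qm].
      apply/negP; rewrite mem_primes => /and3P[_ _ qA].
      have [x xA oq] := Cauchy qp qA; move: xA => /setIdP[_ xd].
      have qd : (q %| d)%N by rewrite -oq order_dvdn.
      have : (q %| gcdn d m)%N by rewrite dvdn_gcd qd.
      by rewrite (eqP d_cop) dvdn1 => /eqP q1; rewrite q1 in qp.
    by have := gdim_gt0 D dim_gt0; rewrite gdimE muln_gt0 => /andP[].
  by rewrite -(Gauss_dvdl _ copA) -gdimE (card_sub_dvd dim_gt0 dimE dtorG).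
apply: squarefree_dvd => // p pp pd.
have [x Gx ox] := Cauchy pp (prime_dvd_inv pp pd).
rewrite -ox; apply: order_dvdG; apply/setIdP; split=> //.
by rewrite -order_dvdn ox.
Qed.

End Decompose.

(** * Nondegeneracy on the d-torsion and unique factorization of simple objects *)

Section Nondegenerate.
Context {C : numClosedFieldType} {r : nat} (D : modular_datum C r).
Local Notation o := (md0 D).
Local Notation h := (mdh D).
Local Notation t := (mdt D).
Local Notation "i ^∨" := (mdual D i) (at level 2, format "i ^∨").
Context (j0 : 'I_r) (dim : 'I_r -> nat).
Context (dim_gt0 : forall i, (0 < dim i)%N) (dimE : forall i, h j0 i = (dim i)%:R).
Local Notation gdim := (gdim dim).
Local Notation G := (inv_group D).
Implicit Types σ τ : {perm 'I_r}.
Context (d m : nat) (gdimE : gdim = (d * m)%N).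
Context (d_gt0 : (0 < d)%N) (d_sqf : squarefree d) (d_cop : coprime d m).
Local Notation A := (dtor dim_gt0 dimE d).
Local Notation Q := (centralizer D A).

Lemma chi_twist σ k : σ \in G -> chi D k σ * t (σ o) * t k = t (σ k).
Proof.
move=> Gσ; have := @md_twist _ _ D (σ o) k (σ k) (fun l => inv_fusion dim_gt0 dimE k l Gσ).
rewrite (invP Gσ o k) /chi => e; have k0 := md_dim_neq0 D k; have s0 := md_dim_neq0 D (σ o).
apply: (mulIf s0); apply: (mulIf k0); rewrite -[RHS]mulrA -e.
by field; rewrite s0.
Qed.

(* An isotropic σ of prime order p would act on its own centralizer, of
   dimension gdim / p prime to p; but its fixed points all lie either inside
   or outside the centralizer, according to whether its twist is trivial. *)
Lemma chi_prime_neq1 σ p : prime p -> (p %| d)%N -> σ \in G -> #[σ]%g = p ->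
  chi D (σ o) σ != 1.
Proof.
move=> pp pd Gσ oσ; have [pg p2] := prime_exact gdimE d_sqf d_cop pp pd.
apply/eqP => chi1s; pose P := <[σ]>%G; pose Y := centralizer D P.
have PG : P \subset G by rewrite cycle_subG.
have YE k : (k \in Y) = (chi D k σ == 1).
  apply/centralizerP/eqP => [H|H τ /cycleP[n ->]]; first exact: (H _ (cycle_id σ)).
  by rewrite chiX // H expr1n.
have YF : (p * \sum_(k in Y) dim k ^ 2 = gdim)%N.
  by rewrite -oσ /order (dim_centralizer dim_gt0 dimE PG).
have pY : ~~ (p %| \sum_(k in Y) dim k ^ 2)%N.
  by apply: contraNN p2 => /dvdnP[q e]; rewrite -YF e mulnCA mulnn dvdn_mull.
have Yσ k : (σ k \in Y) = (k \in Y).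
  by rewrite !YE (chi_perm k Gσ Gσ) chi1s mul1r.
have wσ k : (dim (σ k) ^ 2 = dim k ^ 2)%N by rewrite (dim_perm dim_gt0 dimE).
have fixY := perm_fix_mod pp oσ Yσ wσ.
have fixT := perm_fix_mod (Y := predT) pp oσ (fun=> erefl) wσ.
have fixE k : σ k == k -> chi D k σ * t (σ o) = 1.
  move=> /eqP sk; apply: (mulIf (md_twist0 D k)).
  by rewrite mul1r chi_twist // sk.
have [t1|t1] := eqVneq (t (σ o)) 1.
  case/negP: pY; rewrite /dvdn fixY.
  rewrite (eq_bigl (fun k => (k \in predT) && (σ k == k))); first by rewrite -fixT.
  move=> k; have [/fixE|_] := boolP (σ k == k); rewrite ?andbF // !andbT.
  by rewrite t1 mulr1 => chik; rewrite YE chik eqxx.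
case/negP: pY; rewrite /dvdn fixY big1 ?mod0n // => k /andP[kY /fixE].
by move: kY; rewrite YE => /eqP->; rewrite mul1r => /eqP; rewrite (negPf t1).
Qed.

(** A nontrivial element of the radical has a power [x] of prime order with [chi D (x o) x = 1],
    excluded by [chi_prime_neq1]. *)
Lemma chi_nondeg σ : σ \in A -> {in A, forall τ, chi D (σ o) τ = 1} -> σ = 1%g.
Proof.
move=> Aσ chiσ; have Gσ := dtorP Aσ; apply/eqP; apply: contraT => s1.
have os1 : (1 < #[σ]%g)%N by rewrite order_gt1.
set p := pdiv #[σ]%g; have pp : prime p := pdiv_prime os1.
have po : (p %| #[σ]%g)%N := pdiv_dvd _.
have od : (#[σ]%g %| d)%N by rewrite order_dvdn; case/setIdP: Aσ.
pose x := (σ ^+ (#[σ]%g %/ p))%g; have Ax : x \in A by apply: groupX.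
have ox : #[x]%g = p.
  by rewrite orderXdiv ?dvdn_div // divnA ?mulKn ?order_gt0.
have : chi D (x o) x = 1.
  rewrite {2}/x chiX // chi_sym {1}/x chiX // chiσ //.
  by rewrite !expr1n.
by move/eqP; rewrite (negPf (chi_prime_neq1 pp (dvdn_trans po od) (dtorP Ax) ox)).
Qed.

(** The braiding of [σ k] with [A] depends only on [σ], and determines it by [chi_nondeg]. *)
Lemma dtor_centralizer_inj σ τ k l : σ \in A -> τ \in A -> k \in Q -> l \in Q ->
  σ k = τ l -> σ = τ /\ k = l.
Proof.
move=> Aσ Aτ /centralizerP kQ /centralizerP lQ e.
have Gσ := dtorP Aσ; have Gτ := dtorP Aτ.
have st : (σ * τ^-1)%g = 1%g.
  apply: chi_nondeg; first by rewrite groupM ?groupV.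
  move=> ρ Aρ; have Gρ := dtorP Aρ.
  have : chi D (σ o) ρ = chi D (τ o) ρ.
    by rewrite -[LHS]mulr1 -(kQ ρ Aρ) -chi_perm // e chi_perm // lQ ?mulr1.
  rewrite !(chi_sym _ _ ρ) => st; rewrite chiM ?groupV //.
  by rewrite st -chiM ?groupV // mulgV chi1.
have eq_st : σ = τ by rewrite -[σ]mulg1 -(mulVg τ) mulgA st mul1g.
by split=> //; move: e; rewrite eq_st => /perm_inj.
Qed.

(** By [dim_centralizer] the squared dimensions of the distinct products [σ k] already add up to
    [gdim], which leaves no room for another simple object. *)
Lemma dtor_centralizer_surj j : exists σ k, [/\ σ \in A, k \in Q & j = σ k].
Proof.
pose f (x : {perm 'I_r} * 'I_r) := x.1 x.2.
pose S := finset.setX A [set k | k \in Q].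
have f_inj : {in S &, injective f}.
  move=> [σ k] [τ l] /finset.setXP[Aσ kQ] /finset.setXP[Aτ lQ] e; rewrite !finset.in_set in kQ lQ.
  by have [-> ->] := dtor_centralizer_inj Aσ Aτ kQ lQ e.
suff : j \in f @: S.
  by case/imsetP=> -[σ k] /finset.setXP[Aσ]; rewrite finset.in_set => kQ ->; exists σ, k.
apply: contraT => jS; have: (\sum_(i in f @: S) dim i ^ 2 = gdim)%N.
  rewrite big_imset //= -(dim_centralizer dim_gt0 dimE (dtorG dim_gt0 dimE d)).
  rewrite -sum_nat_const pair_big /=.
  apply: eq_big => [[σ k]|[σ k] /finset.setXP[Aσ _]].
    by rewrite finset.in_setX finset.in_set.
  by rewrite /f /= (dim_perm dim_gt0 dimE _ (dtorP Aσ)).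
rewrite /gdim [RHS](bigID (mem (f @: S))) /= => /eqP; rewrite -[X in X == _]addn0 eqn_add2l.
by rewrite (bigD1 j) //= eq_sym addn_eq0 expn_eq0 andbT eqn0Ngt dim_gt0.
Qed.

(** For rows in [A], the column of the S-matrix at [σ k] is the column at [σ o] times [h o k],
    because [k] centralizes [A]. So a relation on the columns in [A] extends to all columns, and the
    full S-matrix is invertible. *)
Lemma dtor_S_inj (v : 'I_r -> C) :
  (forall k, v k != 0 -> exists2 σ, σ \in A & k = σ o) ->
  {in A, forall σ, \sum_k v k * (h o k * h k (σ o)) = 0} -> forall k, v k = 0.
Proof.
move=> vA vS; apply: (md_S_inj (D := D)) => j.
have [σ [k [Aσ kQ ->]]] := dtor_centralizer_surj j.
transitivity ((\sum_l v l * (h o l * h l (σ o))) * h o k); last by rewrite vS // mul0r.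
rewrite mulr_suml; apply: eq_bigr => l _.
have [->|/vA[τ Aτ ->]] := eqVneq (v l) 0; first by rewrite !mul0r.
rewrite (invP (dtorP Aσ) _ k) [h (τ o) k]md_symC.
have := centralizerP _ _ _ kQ τ Aτ; rewrite /chi => ckt.
have t0 := md_dim_neq0 D (τ o); have -> : h k (τ o) = h o (τ o).
  by rewrite -[LHS](divfK t0) ckt mul1r.
by field.
Qed.

Lemma centralizer_S_inj (v : 'I_r -> C) : (forall k, v k != 0 -> k \in Q) ->
  {in Q, forall l, \sum_k v k * (h o k * h k l) = 0} -> forall k, v k = 0.
Proof.
move=> vQ vS; apply: (md_S_inj (D := D)) => j.
have [σ [k [Aσ kQ ->]]] := dtor_centralizer_surj j.
transitivity ((\sum_l v l * (h o l * h l k)) * h o (σ o)); last by rewrite vS // mul0r.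
rewrite mulr_suml; apply: eq_bigr => l _.
have [->|/vQ/centralizerP lQ] := eqVneq (v l) 0; first by rewrite !mul0r.
have := lQ σ Aσ; rewrite /chi => cls; have s0 := md_dim_neq0 D (σ o).
have -> : h l (σ k) = h o (σ o) * h l k.
  by rewrite (invP (dtorP Aσ) _ k) -[h l (σ o)](divfK s0) cls mul1r.
by ring.
Qed.

Lemma dtor_dual σ : σ \in A -> (σ o)^∨ = (σ^-1)%g o.
Proof.
move=> Aσ; apply/esym/eqP; have := md_dual D (σ o) ((σ^-1)%g o).
by rewrite (inv_fusion dim_gt0 dimE _ _ (dtorP Aσ)) permKV eqxx; case: (_ == _).
Qed.

Lemma centralizer_dual k : k \in Q -> k^∨ \in Q.
Proof.
move=> /centralizerP kQ; apply/centralizerP => τ Aτ; have := kQ τ Aτ.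
have t0 := md_dim_neq0 D (τ o); have k0 := md_dim_neq0 D k.
rewrite /chi => /(canRL (divfK t0)); rewrite mul1r => kt.
have : h (τ o) k = h o k by rewrite md_symC kt mulfK.
move/(congr1 (fun x => x^*)); rewrite -!md_conj => tk.
rewrite [h (k^∨) _]md_symC tk mulfK ?divff ?md_dim_neq0 //.
Qed.

Lemma centralizer_gdim : (\sum_(k in Q) dim k ^ 2)%N = m.
Proof.
have := dim_centralizer dim_gt0 dimE (dtorG dim_gt0 dimE d).
rewrite (dtor_card dim_gt0 dimE gdimE d_gt0 d_sqf d_cop) gdimE => /eqP.
by rewrite eqn_pmul2l // => /eqP.
Qed.

End Nondegenerate.

(** * The modular datum of a modular category *)

Section TensorDecomposition.
Context {R : realType} {M : monCat R}.
Implicit Types X Y : M.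

Lemma isomorphic_tens X X' Y Y' :
  isomorphic X X' -> isomorphic Y Y' -> isomorphic (X ⊗ Y) (X' ⊗ Y').
Proof. by move=> [f fi] [g gi]; exists (f ⊛ g); apply: bmap_is_iso. Qed.

Lemma isomorphic_lun X : isomorphic (unit_ob M ⊗ X) X.
Proof. by exists (lun X); apply: lun_iso. Qed.

Lemma dsum_tensl n (F : 'I_n -> M) X Y :
  is_direct_sum F X -> is_direct_sum (fun a => F a ⊗ Y) (X ⊗ Y).
Proof.
move=> [i [p [p1 p0 ip]]]; exists (fun a => i a ▷ Y), (fun a => p a ▷ Y); split.
- by move=> a; rewrite -rwM p1 bmap1.
- by move=> a b ab; rewrite -rwM p0 // bmap0l.
- by rewrite -bmap1 -ip bmap_suml; apply: eq_bigr => a _; rewrite rwM.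
Qed.

Lemma dsum_tensr n (F : 'I_n -> M) X Y :
  is_direct_sum F X -> is_direct_sum (fun a => Y ⊗ F a) (Y ⊗ X).
Proof.
move=> [i [p [p1 p0 ip]]]; exists (fun a => Y ◁ i a), (fun a => Y ◁ p a); split.
- by move=> a; rewrite -lwM p1 bmap1.
- by move=> a b ab; rewrite -lwM p0 // bmap0r.
- by rewrite -bmap1 -ip bmap_sumr; apply: eq_bigr => a _; rewrite lwM.
Qed.

End TensorDecomposition.

Section BraidedFusion.
Context {R : realType} {C : braidFusCat R}.
Local Notation I := (unit_ob C).
Let fus : is_fusion C := braidfus_fusion C.
Let hC := fusion_fss fus.
Context (r : nat) (s : 'I_r -> C) (sR : simple_reps s).

Lemma isomorphic_br (X Y : C) : isomorphic (X ⊗ Y) (Y ⊗ X).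
Proof. by exists (br X Y); apply: br_iso. Qed.

(** Transposition embeds End(Y) into the one-dimensional End(s i), so [Y] has at most one simple
    summand; it has one because the zigzag identity prevents [Y] from being zero. *)
Lemma right_dual_reps i : exists j (Y : C), left_dual Y (s i) /\ isomorphic Y (s j).
Proof.
have [Y [ev [coev dd]]] := fusion_rdual fus (s i).
have [dY dsi] := dual_data_alt.1 dd.
have [n [κ [δ]]] := reps_decomp hC sR Y.
pose T (g : hom Y Y) : hom (s i) (s i) := transpose (evX := ev) (coevY := coev) g.
have Tlin : linear T.
  move=> a u v; rewrite /T /transpose bmap_linr comp_linr bmap_linl comp_linr.
  by rewrite comp_linl.
have Tinj : injective T.
  move=> u v uv; apply: (iso_rcancel (lun_iso Y)); rewrite -dY !compA -!pair_nat.
  rewrite -!compA -!rwM -(coev_transpose dd dd u) -(coev_transpose dd dd v).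
  by rewrite -/(T u) uv.
have dimY : has_dim (hom Y Y) (\sum_a mult s Y (κ a))%N.
  by apply: dsum_hom_dim (decomp_dsum δ) _ => a; apply: has_dim_mult.
have dims : has_dim (hom (s i) (s i)) 1.
  by have := has_dim_reps hC sR i i; rewrite eqxx.
pose TL : {linear _ -> _} := HB.pack T (GRing.isLinear.Build _ _ _ _ T Tlin).
have n_le1 : (n <= 1)%N.
  apply: leq_trans (has_dim_inj (L := TL) Tinj dimY dims).
  rewrite -[X in (X <= _)%N](card_ord n) -sum1_card; apply: leq_sum => a _.
  by rewrite (mult_decomp hC sR _ δ) (bigD1 a) //= eqxx.
case: n n_le1 κ δ {dimY} => [|[|//]] _ κ δ.
  exfalso; apply: (reps_neq0 sR (i := i)); rewrite -lunKV -dsi.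
  have Y0 : idm Y = 0 by rewrite -(decompS δ) big_ord0.
  by rewrite -[ev]compm1 -lw1 Y0 bmap0r comp0r bmap0l comp0l comp0r.
exists (κ ord0), Y; split; first by exists ev, coev.
exists (dprj δ ord0), (dinj δ ord0); split; last exact: decomp1.
by rewrite -(decompS δ) big_ord1.
Qed.

Lemma unit_reps : exists o, isomorphic I (s o).
Proof. by case: sR => _ sF _; apply/sF/(fusion_unit fus). Qed.

Definition fusN i j l := mult s (s i ⊗ s j) l.

Lemma fusN_adj i i' (Y : C) j l : left_dual Y (s i) -> isomorphic Y (s i') ->
  fusN i j l = fusN i' l j.
Proof.
move=> [ev [coev dd]] Yi'; rewrite /fusN (mult_iso hC _ _ (isomorphic_br _ _)).
rewrite /mult -(vdim_adj dd) (vdimE (mult_hom_rev hC sR _ _)).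
rewrite (mult_iso hC _ _ (isomorphic_br _ _)); apply: mult_iso => //.
by apply: isomorphic_tens => //; apply: isomorphic_refl.
Qed.

Lemma fusN_dual i i' (Y : C) j o : left_dual Y (s i) -> isomorphic Y (s i') ->
  isomorphic I (s o) -> fusN i j o = (j == i').
Proof.
move=> Yd Yi' so; rewrite (fusN_adj _ _ Yd Yi') /fusN.
rewrite -(mult_reps hC sR); apply: mult_iso => //.
apply: isomorphic_trans (isomorphic_br _ _) _.
apply: isomorphic_trans (isomorphic_tens (isomorphic_sym so) (isomorphic_refl _)) _.
exact: isomorphic_lun.
Qed.

End BraidedFusion.

Section ModularDatumOf.
Context {R : realType} (C : modularCat R).
Notation K := (R[i]%C).
Local Notation I := (unit_ob C).
Let fus : is_fusion C := braidfus_fusion C.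
Let hC := fusion_fss fus.
Let rib := twist_ribbon C.
Local Notation θ := (@twist R C).
Context (r : nat) (s : 'I_r -> C) (sR : simple_reps s).
Local Notation N := (fusN s).
Local Notation h k j := (encircle θ (s k) (s j)).
Let ss i : simple (s i) := reps_simple sR i.
Local Notation δ i := (ribbon_trace θ (idm (s i))).

Let encD k : additive_fun (encircle θ (s k)) := encircle_dsum rib (ss k).

Lemma encircle_mul k i j : h k i * h k j = \sum_l (N i j l)%:R * h k l.
Proof.
rewrite -(encircle_tens rib) // (additive_mult hC sR _ (@encD k)).
by apply: eq_bigr => l _; rewrite mulr_natl.
Qed.

Let S_entry i j : S_matrix θ s i j = h i j * δ i.
Proof. by rewrite mxE (rtrace_monodromy rib). Qed.

Let S_row i : exists j, h i j * δ i != 0.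
Proof.
apply: contrapT => /forallNP S0; have := modular_nondeg sR; rewrite unitmxE unitfE.
rewrite (expand_det_row _ i) big1 ?eqxx // => j _.
by rewrite S_entry; move/negP/negbNE/eqP: (S0 j) => ->; rewrite mul0r.
Qed.

Lemma rdim_neq0 i : δ i != 0.
Proof. by have [j] := S_row i; rewrite mulf_eq0 negb_or => /andP[]. Qed.

Lemma S_sym i j : h i j * δ i = h j i * δ j.
Proof. by rewrite -!(rtrace_monodromy rib) // /monodromy (rtrace_cyclic rib). Qed.

Context (o : 'I_r) (so : isomorphic I (s o)).

(** The row [k] of the S-matrix has a nonzero entry, so the multiplicative function [h k] is not
    identically zero. *)
Lemma encircle_unit k : h k o = 1.
Proof.
have [j] := S_row k; rewrite mulf_eq0 negb_or => /andP[kj _].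
apply: (mulIf kj); rewrite mul1r -(encircle_tens rib) //.
apply: (additive_iso (@encD k)).
apply: isomorphic_trans (isomorphic_tens (isomorphic_sym so) (isomorphic_refl _)) _.
exact: isomorphic_lun.
Qed.

Lemma rdim_encircle i : δ i = h o i * δ o.
Proof. by rewrite S_sym encircle_unit mul1r. Qed.

Definition twist_scal i : K := sval (cid (endo_scal (θ (s i)) (ss i))).

Lemma twist_scalE i : θ (s i) = twist_scal i *: idm (s i).
Proof. by rewrite /twist_scal; case: cid. Qed.

Lemma twist_scal_neq0 i : twist_scal i != 0.
Proof.
apply/eqP => t0; have [f [ft tf]] := ribbon_iso rib (s i).
by case: (ss i) => + _; apply; rewrite -ft twist_scalE t0 scale0r comp0r.
Qed.

(* On a simple tensor product the double braiding is a scalar, computed both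
   by the balancing axiom and by its trace. *)
Lemma monodromy_simple i j l : (forall l', N i j l' = (l' == l)) ->
  exists c : K, [/\ monodromy (s i) (s j) = c *: idm (s i ⊗ s j),
    h o j * h j i = c * h o l & c * twist_scal i * twist_scal j = twist_scal l].
Proof.
move=> Nl; have iso_l : isomorphic (s i ⊗ s j) (s l) by apply: (iso_reps_mult hC sR).
have simp : simple (s i ⊗ s j) by apply: isomorphic_simple (isomorphic_sym iso_l) _.
have [c mc] := endo_scal (monodromy (s i) (s j)) simp; exists c; split=> //.
  apply: (mulIf (rdim_neq0 o)); rewrite -!mulrA -rdim_encircle.
  have -> : δ l = ribbon_trace θ (idm (s i ⊗ s j)).
    have [f [g [gf fg]]] := iso_l.
    by rewrite -gf -fg (rtrace_cyclic rib).
  rewrite -[RHS](rtraceZ rib) -mc (rtrace_monodromy rib) // S_sym.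
  by rewrite [in RHS]rdim_encircle mulrCA.
have [f [g [gf fg]]] := iso_l; apply: (scal_inj (ss l)).
rewrite -twist_scalE -[RHS]compm1 -fg compA (ribbon_nat rib).
rewrite (ribbon_tens rib) -/(monodromy (s i) (s j)) mc !twist_scalE.
by rewrite bmapZl bmapZr bmap1 !compZl comp1m !compZr !compZl compm1 fg !scalerA.
Qed.

Lemma modular_datum_exists : exists D : modular_datum K r,
  [/\ md0 D = o, forall i j l, mdN D i j l = N i j l,
      forall k j, mdh D k j = h k j
    & forall i, exists Y, left_dual Y (s i) /\ isomorphic Y (s (mdual D i))].
Proof.
have [dual dualP] := choice (right_dual_reps sR).
have comm i j l : N i j l = N j i l by apply: mult_iso (isomorphic_br _ _).
have adj i j l : N i j l = N (dual i) l j.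
  by have [Y [Yd Yi]] := dualP i; apply: (fusN_adj sR _ _ Yd Yi).
have unit_dual i j : N i j o = (j == dual i).
  by have [Y [Yd Yi]] := dualP i; apply: (fusN_dual sR _ Yd Yi).
have sym i j : h o i * h i j = h o j * h j i.
  by apply: (mulIf (rdim_neq0 o)); rewrite ![_ * _ * δ o]mulrAC -!rdim_encircle ![δ _ * _]mulrC S_sym.
have inj : \matrix_(k, j) (h o k * h k j) \in unitmx.
  have -> : \matrix_(k, j) (h o k * h k j) = (δ o)^-1 *: S_matrix θ s.
    apply/matrixP => k j; rewrite mxE [RHS]mxE S_entry (rdim_encircle k).
    by rewrite [h o k * δ o]mulrC [RHS]mulrCA mulKf ?rdim_neq0 // mulrC.
  rewrite unitmxZ ?(modular_nondeg sR) // unitfE invr_eq0.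
  exact: rdim_neq0.
have tw i j l : (forall l', N i j l' = (l' == l)) ->
    h o j * h j i * twist_scal i * twist_scal j = twist_scal l * h o l.
  move=> /monodromy_simple[c [_ -> <-]]; ring.
by exists (ModularDatum encircle_mul encircle_unit comm adj unit_dual sym inj twist_scal_neq0 tw).
Qed.

End ModularDatumOf.

(** * Frobenius-Perron dimension and fusion subcategories *)

Section FrobeniusPerron.
Context {R : realType} (M : monCat R) (fus : is_fusion M) (dm : M -> R).
Context (dm_gt0 : forall X, simple X -> 0 < dm X) (dmD : additive_fun dm).
Context (dmM : forall X Y, dm (X ⊗ Y) = dm X * dm Y).
Let hM := fusion_fss fus.

Lemma dm_reps n (s : 'I_n -> M) X : simple_reps s ->
  dm X = \sum_k (mult s X k)%:R * dm (s k).
Proof.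
by move=> sR; rewrite (additive_mult hM sR _ dmD); apply: eq_bigr => k _; rewrite mulr_natl.
Qed.

Lemma dm_ge0 X : 0 <= dm X.
Proof.
have [n [s sR]] := fusion_finite fus; rewrite (dm_reps _ sR) sumr_ge0 // => k _.
by rewrite mulr_ge0 // ltW ?dm_gt0 //; apply: reps_simple sR k.
Qed.

Section Representatives.
Context (n : nat) (s : 'I_n -> M) (sR : simple_reps s) (X : M).
Let s_gt0 k : 0 < dm (s k). Proof. exact: dm_gt0 (reps_simple sR k). Qed.

Lemma fusion_mx_dm i : \sum_j fusion_mx s X i j * dm (s j) = dm X * dm (s i).
Proof.
by rewrite -dmM (dm_reps _ sR); apply: eq_bigr => j _; rewrite mxE.
Qed.

(** [eigenvalue] refers to row vectors, whereas [dm] provides a column eigenvector; the argument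
    therefore goes through the singularity of the matrix minus the scalar. *)
Lemma fusion_mx_eigenvalue : eigenvalue (fusion_mx s X) (dm X).
Proof.
rewrite /eigenvalue /eigenspace kermx_eq0 row_free_unit; apply/negP => Nu.
pose v : 'cV[R]_n := \col_j dm (s j).
have Nv : (fusion_mx s X - (dm X)%:M) *m v = 0.
  apply/matrixP => i j; rewrite mulmxBl mul_scalar_mx !mxE -fusion_mx_dm.
  by under eq_bigr do rewrite [v _ _]mxE; rewrite subrr.
have v0 : v = 0 by rewrite -(mulKmx Nu v) Nv mulmx0.
have [_ /(_ _ (fusion_unit fus))[i _] _] := sR.
by have := s_gt0 i; have /matrixP/(_ i 0) := v0; rewrite !mxE => ->; rewrite ltxx.
Qed.

(** Pair the moduli of the entries of a row eigenvector with the positive column eigenvector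
    [dm]. *)
Lemma fusion_mx_spectral_bound x : eigenvalue (fusion_mx s X) x -> `|x| <= dm X.
Proof.
move=> /eigenvalueP[w wN w0].
have sum_gt0 : 0 < \sum_j `|w 0 j| * dm (s j).
  have [j wj] : exists j, w 0 j != 0.
    apply: contrapT => /forallNP wz; case/eqP: w0; apply/rowP => j.
    by have /negP/negbNE/eqP := wz j; rewrite mxE.
  rewrite (bigD1 j) //= ltr_pwDl ?mulr_gt0 ?normr_gt0 // sumr_ge0 // => k _.
  by rewrite mulr_ge0 // ltW.
rewrite -(ler_pM2r sum_gt0) !mulr_sumr.
apply: (@le_trans _ _ (\sum_j \sum_i `|w 0 i| * fusion_mx s X i j * dm (s j))).
  apply: ler_sum => j _; rewrite mulrA -mulr_suml (ler_wpM2r (ltW (s_gt0 j))) // -normrM.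
  have /matrixP/(_ 0 j) := wN; rewrite !mxE => <-.
  apply: le_trans (ler_norm_sum _ _ _) _; apply: ler_sum => i _.
  by rewrite normrM [X in _ * X]ger0_norm // mxE ler0n.
rewrite exchange_big /=; apply: ler_sum => i _.
by under eq_bigr do rewrite -mulrA; rewrite -mulr_sumr fusion_mx_dm mulrCA.
Qed.

Lemma max_nneg_eigenvalue_dm : max_nneg_eigenvalue (fusion_mx s X) = dm X.
Proof.
apply/eqP; rewrite eq_le; apply/andP; split.
  apply: ge_sup => [|x [x0 /fusion_mx_spectral_bound]]; last by rewrite ger0_norm.
  by exists (dm X); split; [apply: dm_ge0 | apply: fusion_mx_eigenvalue].
apply: ub_le_sup; last by split; [apply: dm_ge0 | apply: fusion_mx_eigenvalue].
by exists (dm X) => x [x0 /fusion_mx_spectral_bound]; rewrite ger0_norm.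
Qed.

End Representatives.

Lemma FPdim_ob_dm X : FPdim_ob X = dm X.
Proof.
rewrite /FPdim_ob; case: xgetP => [x _ [n [s [sR ->]]]|/(_ (dm X)) []].
  exact: max_nneg_eigenvalue_dm.
by have [n [s sR]] := fusion_finite fus; exists n, s; rewrite max_nneg_eigenvalue_dm.
Qed.

Lemma sum_reps (f : M -> R) n (s : 'I_n -> M) n' (s' : 'I_n' -> M) :
  (forall X Y, isomorphic X Y -> f X = f Y) -> simple_reps s -> simple_reps s' ->
  \sum_i f (s i) = \sum_i f (s' i).
Proof.
move=> f_iso [s1 s2 s3] [s1' s2' s3'].
have [p pP] := choice (fun i => s2' _ (s1 i)); have [q qP] := choice (fun i => s2 _ (s1' i)).
rewrite (reindex q) /=; first by apply: eq_bigr => i _; apply: f_iso; apply: isomorphic_sym.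
exists p => i _; [apply: s3' | apply: s3].
  by apply: isomorphic_sym; apply: isomorphic_trans (qP i) (pP _).
by apply: isomorphic_sym; apply: isomorphic_trans (pP i) (qP _).
Qed.

Lemma FPdim_dm n (s : 'I_n -> M) : simple_reps s -> FPdim M = \sum_i dm (s i) ^+ 2.
Proof.
move=> sR; rewrite /FPdim; case: xgetP => [x _ [n' [s' [sR' ->]]]|]; last first.
  move=> /(_ (\sum_i dm (s i) ^+ 2)) []; exists n, s; split=> //.
  by apply: eq_bigr => i _; rewrite FPdim_ob_dm.
under eq_bigr do rewrite FPdim_ob_dm.
apply: (sum_reps (f := fun X => dm X ^+ 2)) sR' sR => X Y XY.
by rewrite (additive_iso dmD XY).
Qed.

End FrobeniusPerron.

(** * Full fusion subcategories *)

Section FusionSubcategory.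
Context {R : realType} (M : monCat R) (fus : is_fusion M).
Context (P : M -> Prop) (subP : fusion_sub P).
Context (P1 : P (unit_ob M)) (PM : forall X Y, P X -> P Y -> P (X ⊗ Y)).
Local Notation N := (full_sub P1 PM).
Let hM := fusion_fss fus.
Let reps := fusion_finite fus.

Let ginv (X Y : M) (f : hom X Y) : exists g : hom Y X, f ∘ g ∘ f = f.
Proof. by have [n [s sR]] := reps; apply: (fusion_ginv hM sR). Qed.

(** Being a monomorphism is tested here on objects of the subcategory only. A generalized inverse
    computed in [M] still belongs to the full subcategory, and it splits [f]. *)
Lemma full_sub_mono (X Y : N) (f : hom X Y) :
  is_mono f -> exists g : hom Y X, g ∘ f = idm X.
Proof.
move=> fm; have [g fgf] := @ginv (sval X) (sval Y) f; exists g.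
by apply: fm; rewrite compA compm1.
Qed.

Lemma full_sub_epi (X Y : N) (f : hom X Y) :
  is_epi f -> exists g : hom Y X, f ∘ g = idm Y.
Proof.
move=> fe; have [g fgf] := @ginv (sval X) (sval Y) f; exists g.
by apply: fe; rewrite comp1m.
Qed.

Lemma full_sub_simple (X : N) : simple X <-> simple (sval X : M).
Proof.
split=> -[X0 Xmono]; split=> // Y f fm.
  have [n [s sR]] := reps; have [g gf] := mono_split hM sR fm.
  have PY : P Y by apply: fsub_summand subP _ _ f g gf (svalP X).
  have [|->|[h [hf fh]]] := Xmono (exist P Y PY) f; [|by left|by right; exists h].
  by move=> W a b; apply: fm.
have [g gf] := full_sub_mono fm.
have [|->|[h [hf fh]]] := Xmono (sval Y) f; [|by left|by right; exists h].
move=> W a b /(congr1 (fun c => (g : hom (sval X) (sval Y)) ∘ c)).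
by rewrite !compA (gf : (g : hom (sval X) (sval Y)) ∘ f = idm (sval Y)) !comp1m.
Qed.

Lemma full_sub_abelian : abelian N.
Proof.
have [n0 [s sR]] := reps; have ab := fusion_abelian fus; split.
- move=> n F; have [X FX] := abelian_dsum ab (fun i => sval (F i)).
  have PX : P X by apply: fsub_dsum subP _ _ _ FX _ => i; apply: svalP.
  by exists (exist P X PX).
- move=> X Y f; have [W [k [fk ku]]] := abelian_ker ab (f : hom (sval X) (sval Y)).
  have km : is_mono k.
    move=> V g h kgh; have [|x [kx xu]] := ku V (k ∘ g); first by rewrite compA fk comp0l.
    by rewrite -(xu g) // -(xu h).
  have [g gk] := mono_split hM sR km.
  have PW : P W by apply: fsub_summand subP _ _ k g gk (svalP X).
  by exists (exist P W PW), k; split=> // V g' fg; apply: ku.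
- move=> X Y f; have [Q [c cQ]] := abelian_coker ab (f : hom (sval X) (sval Y)).
  have [i [_ [ci _]]] := coker_split hM sR cQ; have [cf cu] := cQ.
  have PQ : P Q by apply: fsub_summand subP _ _ i c ci (svalP Y).
  by exists (exist P Q PQ), c; split=> // V g' fg; apply: cu.
(* A split monomorphism is the kernel of the complementary idempotent; epimorphisms are treated
   dually below. *)
- move=> X Y f fm; have [g gf] := full_sub_mono fm; exists Y, (idm Y - f ∘ g).
  split=> [|W h]; first by rewrite compDl comp1m compNl -compA gf compm1 subrr.
  rewrite compDl comp1m compNl => /eqP; rewrite subr_eq0 -compA => /eqP h_eq.
  by exists (g ∘ h); split=> // h' fh'; apply: fm; rewrite -h_eq fh'.
move=> X Y f fe; have [g fg] := full_sub_epi fe; exists X, (idm X - g ∘ f).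
split=> [|W h]; first by rewrite compDr compm1 compNr compA fg comp1m subrr.
rewrite compDr compm1 compNr => /eqP; rewrite subr_eq0 compA => /eqP h_eq.
by exists (h ∘ g); split=> // h' fh'; apply: fe; rewrite -h_eq fh'.
Qed.

Section Representatives.
Context (r : nat) (s : 'I_r -> M) (sR : simple_reps s).
Let J := [pred k | `[< P (s k) >]].

Definition full_sub_reps (a : 'I_#|J|) : N :=
  exist P (s (enum_val a)) (asboolW (enum_valP a)).

Lemma full_sub_repsP : simple_reps full_sub_reps.
Proof.
split=> [a|X /full_sub_simple Xs|a b [f fi]].
- by apply/full_sub_simple; apply: reps_simple sR _.
- have [_ /(_ _ Xs)[k [f [g [gf fg]]]] _] := sR.
  have kJ : k \in J by apply/asboolP; apply: fsub_summand subP _ _ g f fg (svalP X).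
  exists (enum_rank_in kJ k); rewrite /isomorphic /full_sub_reps.
  move: (asboolW _); rewrite enum_rankK_in // => p.
  by exists f, g.
by have [_ _ sI] := sR; apply: enum_val_inj; apply: sI; exists f.
Qed.

End Representatives.

Lemma full_sub_fusion : is_fusion N.
Proof.
have [n [s sR]] := reps; split.
- exact: full_sub_abelian.
- by move=> X Y; apply: (fusion_homfin fus (sval X)).
- move=> X; have [m [F [Fs FX]]] := fusion_semisimple fus (sval X).
  have [i [p [p1 p0 ip]]] := FX.
  have PF a : P (F a) by apply: fsub_summand subP _ _ (i a) (p a) (p1 a) (svalP X).
  exists m, (fun a => exist P (F a) (PF a)); split; last by exists i, p.
  by move=> a; apply/full_sub_simple; apply: Fs.
- by exists #|[pred k | `[< P (s k) >]]|, (@full_sub_reps _ s); apply: full_sub_repsP.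
- move=> X; have [Y Yd] := fusion_ldual fus (sval X).
  by exists (exist P Y ((fsub_dual subP Yd).1 (svalP X))).
- move=> X; have [Y Yd] := fusion_rdual fus (sval X).
  by exists (exist P Y ((fsub_dual subP Yd).2 (svalP X))).
by apply/full_sub_simple; apply: fusion_unit.
Qed.

Section Dimension.
Context (dm : M -> R) (dm_gt0 : forall X, simple X -> 0 < dm X) (dmD : additive_fun dm).
Context (dmM : forall X Y, dm (X ⊗ Y) = dm X * dm Y).

Lemma FPdim_full_sub r (s : 'I_r -> M) : simple_reps s ->
  FPdim N = \sum_(k | `[< P (s k) >]) dm (s k) ^+ 2.
Proof.
move=> sR; rewrite (FPdim_dm full_sub_fusion (dm := dm \o sval) _ _ _ (full_sub_repsP sR)) /=.
- transitivity (\sum_(k in [pred k | `[< P (s k) >]]) dm (s k) ^+ 2); last exact: eq_bigl.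
  by rewrite [RHS]big_enum_val.
- by move=> X /full_sub_simple; apply: dm_gt0.
- by move=> n F X FX; apply: dmD.
by move=> X Y; apply: dmM.
Qed.

End Dimension.
End FusionSubcategory.

Lemma fusion_sub_pt_ob {R : realType} (M : monCat R) : fusion_sub (@pt_ob R M).
Proof.
split; [exact: pt_ob_unit|exact: pt_ob_tens|..].
- by move=> n F X FX Fpt P subP Pinv; apply: (fsub_dsum subP FX) => i; apply: Fpt.
- by move=> X Y i p pi Xpt P subP Pinv; apply: (fsub_summand subP pi); apply: Xpt.
by move=> X Y XY; split=> H P subP Pinv; apply/(fsub_dual subP XY); apply: H.
Qed.

Section IndexSubcategory.
Context {R : realType} {C : braidFusCat R}.
Notation K := (R[i]%C).
Local Notation I := (unit_ob C).
Let fus : is_fusion C := braidfus_fusion C.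
Let hC := fusion_fss fus.
Context (r : nat) (s : 'I_r -> C) (sR : simple_reps s).
Context (D : modular_datum K r) (so : isomorphic I (s (md0 D))).
Context (DN : forall i j l, mdN D i j l = fusN s i j l).

Lemma mult_tens X Y k :
  mult s (X ⊗ Y) k = (\sum_i \sum_j mult s X i * (mult s Y j * mdN D i j k))%N.
Proof.
rewrite (additive_mult hC sR X (φ := fun X => mult s (X ⊗ Y) k : nat)); last first.
  by move=> n F Z FZ; rewrite (mult_dsum hC s _ (dsum_tensl _ FZ)).
apply: eq_bigr => i _.
rewrite (additive_mult hC sR Y (φ := fun Y => mult s (s i ⊗ Y) k : nat)); last first.
  by move=> n F Z FZ; rewrite (mult_dsum hC s _ (dsum_tensr _ FZ)).
rewrite -big_distrr /= -[LHS]mulr_natl natn; congr (_ * _)%N.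
by apply: eq_bigr => j _; rewrite DN -[LHS]mulr_natl natn.
Qed.

(** Both sides are compared through Hom from [X] tensored with the simple object dual to [i] to the
    unit. Passing to the dual object thus permutes the multiplicities. *)
Lemma mult_ldual X Y i : left_dual X Y -> mult s Y (mdual D i) = mult s X i.
Proof.
move=> [ev [coev dd]]; set j := mdual D i.
have -> : mult s Y j = mult s (s (md0 D) ⊗ Y) j.
  apply: (mult_iso hC); apply: isomorphic_sym.
  apply: isomorphic_trans (isomorphic_tens (isomorphic_sym so) (isomorphic_refl _)) _.
  exact: isomorphic_lun.
rewrite /mult -(vdim_adj dd) (vdimE (mult_hom_rev hC sR _ _)) mult_tens.
rewrite (bigD1 j) //= (mult_reps hC sR) eqxx (bigD1 i) //= md_comm md_dual eqxx.
rewrite !big1 ?mul1n ?muln1 ?addn0 // => k.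
  by move=> /negPf kj; rewrite big1 // => l _; rewrite (mult_reps hC sR) kj.
by move=> /negPf ki; rewrite md_dual md_dualK ki !muln0.
Qed.

Definition supported (J : pred 'I_r) (X : C) : Prop :=
  forall k, k \notin J -> mult s X k = 0%N.

Lemma supported_reps J k : supported J (s k) <-> k \in J.
Proof.
split=> [Jk|kJ l lJ]; last first.
  by rewrite (mult_reps hC sR); have [lk|//] := eqVneq l k; rewrite lk kJ in lJ.
by apply: contraT => /Jk; rewrite (mult_reps hC sR) eqxx.
Qed.

Lemma supported_fusion_sub (J : pred 'I_r) : md0 D \in J ->
  (forall i j k, i \in J -> j \in J -> mdN D i j k != 0%N -> k \in J) ->
  (forall i, i \in J -> mdual D i \in J) -> fusion_sub (supported J).
Proof.
move=> J0 JM Jd; split.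
- move=> k kJ; rewrite (mult_iso hC _ _ so) (mult_reps hC sR).
  by have [ko|//] := eqVneq k (md0 D); rewrite ko J0 in kJ.
- move=> X Y XJ YJ k kJ; rewrite mult_tens big1 // => i _; rewrite big1 // => j _.
  have [iJ|/XJ -> //] := boolP (i \in J); have [jJ|/YJ ->] := boolP (j \in J); last first.
    by rewrite muln0.
  have [->|/JM] := eqVneq (mdN D i j k) 0%N; first by rewrite !muln0.
  by move=> /(_ iJ jJ) kJ'; rewrite kJ' in kJ.
- move=> n F X FX FJ k kJ; rewrite (mult_dsum hC s _ FX) big1 // => i _; exact: FJ.
- move=> X Y i p pi XJ k /XJ /(mult_eq0 hC s) X0.
  apply/(mult_eq0 hC s) => f; by rewrite -[f]comp1m -pi -compA (X0 (i ∘ f)) comp0r.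
move=> X Y XY; split=> H k kJ.
  rewrite -(md_dualK D k) (mult_ldual _ XY); apply: H.
  by apply: contra kJ => /Jd; rewrite md_dualK.
by rewrite -(mult_ldual _ XY); apply: H; apply: contra kJ => /Jd; rewrite md_dualK.
Qed.

End IndexSubcategory.

(** * Subcategories on which the S-matrix stays nondegenerate *)

Section ModularSubcategory.
Context {R : realType} {C : modularCat R} (P : C -> Prop) (subP : fusion_sub P).
Notation K := (R[i]%C).
Local Notation θ := (@twist R C).
Let fus : is_fusion C := braidfus_fusion C.
Let rib : is_ribbon θ := twist_ribbon C.

Definition braided_sub : braidCat R :=
  @BraidCat R (full_sub (fsub_unit subP) (fsub_tens subP))
    (fun X Y => br (sval X : C) (sval Y)) (fun X Y => br_iso (sval X : C) (sval Y))
    (fun _ _ _ _ => @br_nat R C _ _ _ _)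
    (fun X Y Z => hexagon1 (sval X : C) (sval Y) (sval Z))
    (fun X Y Z => hexagon2 (sval X : C) (sval Y) (sval Z)).

Definition braidfus_sub : braidFusCat R :=
  @BraidFusCat R braided_sub (full_sub_fusion fus subP _ _).

Definition twist_sub (X : braidfus_sub) : hom X X := θ (sval X).

Lemma twist_sub_ribbon : is_ribbon twist_sub.
Proof.
split.
- by move=> X; apply: (ribbon_iso rib (sval X)).
- by move=> X Y f; apply: (ribbon_nat rib (f : hom (sval X) (sval Y))).
- by move=> X Y; apply: (ribbon_tens rib (sval X) (sval Y)).
by move=> X Xs ev coev dd; apply: (ribbon_dual rib (dd : @dual_data R C (sval X) (sval Xs) ev coev)).
Qed.

Lemma rtrace_sub (X : braidfus_sub) (f : hom X X) :
  ribbon_trace twist_sub f = ribbon_trace θ (f : hom (sval X) (sval X)).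
Proof.
have [Xs [ev [coev dd]]] := fusion_ldual (braidfus_fusion braidfus_sub) X.
apply: (scal_inj (fusion_unit fus)).
rewrite -(rtraceE rib _ (dd : @dual_data R C (sval X) (sval Xs) ev coev)).
by rewrite -[LHS](rtraceE twist_sub_ribbon f dd).
Qed.

Lemma rtrace_monodromy_iso (X X' Y Y' : C) : isomorphic X X' -> isomorphic Y Y' ->
  ribbon_trace θ (monodromy X Y) = ribbon_trace θ (monodromy X' Y').
Proof.
move=> [f [f' [f'f ff']]] [g [g' [g'g gg']]].
have -> : monodromy X Y = (f' ⊛ g') ∘ (monodromy X' Y' ∘ (f ⊛ g)).
  rewrite /monodromy -[_ ∘ br X' Y' ∘ _]compA br_nat [br Y' X' ∘ _]compA br_nat.
  by rewrite -[_ ∘ br Y X ∘ _]compA compA -bmapM f'f g'g bmap1 comp1m.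
by rewrite (rtrace_cyclic rib) -compA -bmapM ff' gg' bmap1 compm1.
Qed.

Context (r : nat) (s : 'I_r -> C) (sR : simple_reps s).
Context (nondeg : forall v : 'I_r -> K, (forall k, v k != 0 -> P (s k)) ->
  (forall l, P (s l) -> \sum_k v k * S_matrix θ s k l = 0) -> forall k, v k = 0).

(** The representatives [t] are arbitrary, so they are first matched with a subset of the [s k] by
    [κ]. A vector in the left kernel of their S-matrix, extended by zero along [κ], meets the
    hypothesis [nondeg]. *)
Lemma nondeg_sub n (t : 'I_n -> braidfus_sub) :
  simple_reps t -> S_matrix twist_sub t \in unitmx.
Proof.
have [s1 s2 s3] := sR; move=> [t1 t2 t3].
have t1' a := (full_sub_simple fus subP (t a)).1 (t1 a).
have [κ κP] := choice (fun a => s2 _ (t1' a)).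
have κ_inj : injective κ.
  move=> a b κab; apply: t3; apply: isomorphic_trans (κP a) _.
  by rewrite κab; apply: isomorphic_sym.
have κ_sub a : P (s (κ a)).
  by have [f [g [gf fg]]] := κP a; apply: fsub_summand subP _ _ g f fg (svalP (t a)).
have κ_surj k : P (s k) -> exists a, k = κ a.
  move=> Pk; have [|a [f fi]] := t2 (exist P (s k) Pk).
    exact: (full_sub_simple fus subP (exist P (s k) Pk : braidfus_sub)).2 (s1 k).
  by exists a; apply: s3; apply: isomorphic_trans (κP a); exists f.
have SE a b : S_matrix twist_sub t a b = S_matrix θ s (κ a) (κ b).
  by rewrite !mxE rtrace_sub; apply: rtrace_monodromy_iso.
rewrite -row_free_unit; apply: inj_row_free => w wS.
pose v k := \sum_a (κ a == k)%:R * w 0 a.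
have vκ a : v (κ a) = w 0 a.
  rewrite /v (bigD1 a) //= eqxx mul1r big1 ?addr0 // => b /negPf ba.
  by rewrite (inj_eq κ_inj) ba mul0r.
apply/rowP => a; rewrite mxE -vκ; apply: nondeg => [k vk|l /κ_surj[b ->]].
  apply: contrapT => Pk; case/eqP: vk; rewrite /v big1 // => b _.
  by have [kb|_] := eqVneq (κ b) k; rewrite ?mul0r //; rewrite -kb in Pk.
transitivity ((w *m S_matrix twist_sub t) 0 b); last by rewrite wS mxE.
rewrite mxE; under eq_bigr do rewrite mulr_suml.
rewrite exchange_big /=; apply: eq_bigr => c _; rewrite SE (bigD1 (κ c)) //= eqxx mul1r.
by rewrite big1 ?addr0 // => k /negPf kc; rewrite eq_sym kc !mul0r.
Qed.

Definition modular_sub : modularCat R := @ModularCat R braidfus_sub _ twist_sub_ribbon nondeg_sub.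

End ModularSubcategory.

(** * Deligne products of semisimple categories *)

Section LinearFunctors.
Context {R : realType}.

Lemma fmap0 (A B : linCat R) (F : linFun A B) X Y : fmap F (0 : hom X Y) = 0.
Proof. by have := fmap_lin F (-1) (0 : hom X Y) 0; rewrite scaler0 addr0 scaleN1r addNr. Qed.

Lemma fmapD (A B : linCat R) (F : linFun A B) X Y (f g : hom X Y) :
  fmap F (f + g) = fmap F f + fmap F g.
Proof. by have := fmap_lin F 1 f g; rewrite !scale1r. Qed.

Lemma fmapZ (A B : linCat R) (F : linFun A B) X Y a (f : hom X Y) :
  fmap F (a *: f) = a *: fmap F f.
Proof. by have := fmap_lin F a f 0; rewrite fmap0 !addr0. Qed.

Lemma fmap_sum (A B : linCat R) (F : linFun A B) X Y J (q : seq J) (f : J -> hom X Y) :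
  fmap F (\sum_(a <- q) f a) = \sum_(a <- q) fmap F (f a).
Proof. by elim/big_rec2: _ => [|a x y _ <-]; rewrite ?fmap0 ?fmapD. Qed.

(** Cokernels split in a semisimple category, and split cokernels are preserved by every linear
    functor. *)
Lemma semisimple_right_exact (A B : linCat R) (F : linFun A B) r (s : 'I_r -> A) :
  fin_semisimple A -> simple_reps s -> right_exact F.
Proof.
move=> hA sR X Y Q f c cQ; have [i [g [ci icfg]]] := coker_split hA sR cQ.
apply: (split_coker (i := fmap F i) (g := fmap F g)).
- by rewrite -fmapM cQ.1 fmap0.
- by rewrite -fmapM ci fmap1.
by rewrite -!fmapM -fmapD icfg fmap1.
Qed.

Definition lsection (A B C : linCat R) (F : bifun A B C) Y : linFun A C :=
  @LinFun R A C (fun X => F X Y) (fun _ _ f => bmap F f (idm Y))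
    (fun X => bmap1 F X Y)
    (fun _ _ _ g f => etrans (congr1 _ (esym (comp1m (idm Y)))) (bmapM F g f (idm Y) (idm Y)))
    (fun _ _ a f f' => bmap_linl F a f f' (idm Y)).

Definition rsection (A B C : linCat R) (F : bifun A B C) X : linFun B C :=
  @LinFun R B C (fun Y => F X Y) (fun _ _ g => bmap F (idm X) g)
    (fun Y => bmap1 F X Y)
    (fun _ _ _ g f => etrans (congr1 (fun h => bmap F h _) (esym (comp1m (idm X)))) (bmapM F (idm X) (idm X) g f))
    (fun _ _ a g g' => bmap_linr F a (idm X) g g').

Lemma semisimple_right_exact2 (A B C : linCat R) (F : bifun A B C)
    r (s : 'I_r -> A) r' (s' : 'I_r' -> B) :
  fin_semisimple A -> simple_reps s -> fin_semisimple B -> simple_reps s' ->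
  right_exact2 F.
Proof.
move=> hA sR hB sR'; split=> [X Y Q f c Z|Z X Y Q f c] fc.
  exact: (semisimple_right_exact (lsection F Z) hA sR fc).
exact: (semisimple_right_exact (rsection F Z) hB sR' fc).
Qed.

End LinearFunctors.

Section MatrixOfDecomposition.
Context {R : realType} {A : linCat R} {J : eqType} (T : J -> A).
Notation K := (R[i]%C).

Lemma mxhom_entries m n (κ : 'I_m -> J) (ν : 'I_n -> J) X Y (δ : decomp T κ X)
    (ε : decomp T ν Y) (f : hom X Y) (F : 'M[K]_(n, m)) :
  (forall b a, dprj ε b ∘ f ∘ dinj δ a = F b a *: fam_id T (κ a) (ν b)) ->
  f = mxhom δ ε F.
Proof.
move=> fF; rewrite -[f]comp1m -(decompS ε) comp_suml; apply: eq_bigr => b _.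
rewrite -[LHS]compm1 -(decompS δ) comp_sumr; apply: eq_bigr => a _.
by rewrite -compZl -compZr -fF !compA.
Qed.

End MatrixOfDecomposition.

Section ProductFamily.
Context {R : realType} {D D' : linCat R} (hD : fin_semisimple D) (hD' : fin_semisimple D').
Notation K := (R[i]%C).
Context (p q : nat) (s : 'I_p -> D) (s' : 'I_q -> D').
Context (sR : simple_reps s) (sR' : simple_reps s').
Let J : eqType := ('I_p * 'I_q)%type.

Definition prod_fam {A : linCat R} (F : bifun D D' A) (c : J) : A := F (s c.1) (s' c.2).

Lemma fam_id_prod (A : linCat R) (F : bifun D D' A) i i' j j' :
  bmap F (fam_id s i i') (fam_id s' j j') = fam_id (prod_fam F) (i, j) (i', j').
Proof.
have [<-|ii'] := eqVneq i i'; last first.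
  by rewrite fam_id0 // bmap0l fam_id0 // xpair_eqE negb_and ii'.
have [<-|jj'] := eqVneq j j'; last first.
  by rewrite (fam_id0 _ jj') bmap0r fam_id0 // xpair_eqE negb_and jj' orbT.
by rewrite !fam_id1 bmap1.
Qed.

Section OneObject.
Context m n (κ : 'I_m -> 'I_p) (κ' : 'I_n -> 'I_q).

Definition prod_idx (c : 'I_#|{: 'I_m * 'I_n}|) : J :=
  (κ (enum_val c).1, κ' (enum_val c).2).

(** Transparent, because the matrix of [bmap F f g] is computed by unfolding its injections and
    projections. *)
Definition decomp_prod {A : linCat R} (F : bifun D D' A) X Y
  (δ : decomp s κ X) (δ' : decomp s' κ' Y) : decomp (prod_fam F) prod_idx (F X Y).
Proof.
pose i (c : 'I_#|{: 'I_m * 'I_n}|) := dinj δ (enum_val c).1.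
pose i' (c : 'I_#|{: 'I_m * 'I_n}|) := dinj δ' (enum_val c).2.
pose r (c : 'I_#|{: 'I_m * 'I_n}|) := dprj δ (enum_val c).1.
pose r' (c : 'I_#|{: 'I_m * 'I_n}|) := dprj δ' (enum_val c).2.
refine (@Decomp R A J (prod_fam F) _ prod_idx _ (fun c => bmap F (i c) (i' c))
         (fun c => bmap F (r c) (r' c)) _ _ _).
- by move=> c; rewrite -bmapM !decomp1 bmap1.
- move=> a b ab; rewrite -bmapM.
  have [e1|e1] := eqVneq (enum_val a).1 (enum_val b).1; last first.
    have -> : r a ∘ i b = 0 by apply: decomp0.
    by rewrite bmap0l.
  have [e2|e2] := eqVneq (enum_val a).2 (enum_val b).2; last first.
    have -> : r' a ∘ i' b = 0 by apply: decomp0.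
    by rewrite bmap0r.
  case/eqP: ab; apply: enum_val_inj; case: (enum_val a) (enum_val b) e1 e2.
  by move=> x y [x' y'] /= -> ->.
transitivity (\sum_c bmap F (i c ∘ r c) (i' c ∘ r' c)).
  by apply: eq_bigr => c _; rewrite bmapM.
transitivity (\sum_(c in {: 'I_m * 'I_n})
    bmap F (dinj δ c.1 ∘ dprj δ c.1) (dinj δ' c.2 ∘ dprj δ' c.2)).
  by rewrite [RHS]big_enum_val.
rewrite -bmap1 -(decompS δ) -(decompS δ') bmap_suml.
under [RHS]eq_bigr do rewrite bmap_sumr.
by rewrite pair_bigA.
Defined.

End OneObject.

Definition kron m n m' n' (M : 'M[K]_(m', m)) (N : 'M[K]_(n', n)) :
    'M[K]_(#|{: 'I_m' * 'I_n'}|, #|{: 'I_m * 'I_n}|) :=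
  \matrix_(b, a) (M (enum_val b).1 (enum_val a).1 * N (enum_val b).2 (enum_val a).2).

Section TwoObjects.
Context m n (κ : 'I_m -> 'I_p) (κ' : 'I_n -> 'I_q) X X' (δ : decomp s κ X) (δ' : decomp s' κ' X').
Context l k (μ : 'I_l -> 'I_p) (μ' : 'I_k -> 'I_q) Y Y' (ε : decomp s μ Y) (ε' : decomp s' μ' Y').

Lemma bmap_entries (A : linCat R) (F : bifun D D' A) (f : hom X Y) (g : hom X' Y') b a :
  dprj (decomp_prod F ε ε') b ∘ bmap F f g ∘ dinj (decomp_prod F δ δ') a =
  kron (mxof δ ε f) (mxof δ' ε' g) b a *: fam_id (prod_fam F) (prod_idx κ κ' a) (prod_idx μ μ' b).
Proof.
rewrite /= -!bmapM mxE -fam_id_prod.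
rewrite [dprj ε _ ∘ f ∘ _](coefK (reps_hom0 hD sR) (reps_hom1 hD sR) (reps_neq0 sR)).
rewrite [dprj ε' _ ∘ g ∘ _](coefK (reps_hom0 hD' sR') (reps_hom1 hD' sR') (reps_neq0 sR')).
by rewrite bmapZl bmapZr scalerA !mxE.
Qed.

Lemma bmap_mxhom (A : linCat R) (F : bifun D D' A) (f : hom X Y) (g : hom X' Y') :
  bmap F f g = mxhom (decomp_prod F δ δ') (decomp_prod F ε ε') (kron (mxof δ ε f) (mxof δ' ε' g)).
Proof. exact/mxhom_entries/bmap_entries. Qed.

End TwoObjects.
End ProductFamily.

Section DeligneProduct.
Context {R : realType} {D D' E : linCat R}.
Context (hD : fin_semisimple D) (hD' : fin_semisimple D') (hE : fin_semisimple E).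
Notation K := (R[i]%C).
Context (p q r : nat) (s : 'I_p -> D) (s' : 'I_q -> D') (sE : 'I_r -> E).
Context (sR : simple_reps s) (sR' : simple_reps s') (sER : simple_reps sE).
Context (B : bifun D D' E).
Let J : eqType := ('I_p * 'I_q)%type.
Local Notation t := (prod_fam s s' B : J -> E).
Context (sch0 : forall i j (f : hom (t i) (t j)), i != j -> f = 0).
Context (sch1 : forall i (f : hom (t i) (t i)), exists c : K, f = c *: idm (t i)).
Context (t_neq0 : forall i, idm (t i) <> 0).
Context (t_gen : forall Z, exists n (κ : 'I_n -> J), inhabited (decomp t κ Z)).

Lemma bmap_mxof m n (κ : 'I_m -> 'I_p) (κ' : 'I_n -> 'I_q) X X'
    (δ : decomp s κ X) (δ' : decomp s' κ' X')
    l k (μ : 'I_l -> 'I_p) (μ' : 'I_k -> 'I_q) Y Y' (ε : decomp s μ Y) (ε' : decomp s' μ' Y')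
    (f : hom X Y) (g : hom X' Y') :
  mxof (decomp_prod B δ δ') (decomp_prod B ε ε') (bmap B f g) =
  kron (mxof δ ε f) (mxof δ' ε' g).
Proof.
apply/matrixP => b a; rewrite mxE bmap_entries // (coefZ t_neq0).
rewrite [X in X * _]mxE [RHS]mxE.
have [_|] := eqVneq; rewrite ?mulr1 // xpair_eqE negb_and mulr0 => /orP[] ab.
  by rewrite (mxof_compat (reps_hom0 hD sR) (reps_hom1 hD sR) (reps_neq0 sR)) ?mul0r.
by rewrite [X in _ * X](mxof_compat (reps_hom0 hD' sR') (reps_hom1 hD' sR') (reps_neq0 sR')) ?mulr0.
Qed.

Section Extension.
Context (A : linCat R) (Aab : abelian A) (F : bifun D D' A).
Local Notation u := (prod_fam s s' F : J -> A).

(** A decomposition of [Z] into the products [t c], with an object of [A] assembled in the same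
    pattern from the values of [F]. Choosing one for each [Z] defines the extension on objects; a
    morphism goes to the one having the same matrix. *)
Record realization (Z : E) := Realization {
  rsize : nat;
  ridx : 'I_rsize -> J;
  rdec : decomp t ridx Z;
  robj : A;
  rimg : decomp u ridx robj }.

Lemma realization_exists Z : exists x : realization Z, True.
Proof.
have [n [κ [δ]]] := t_gen Z.
have [W /dsum_decomp[ε]] := abelian_dsum Aab (fun a => u (κ a)).
by exists (Realization δ ε).
Qed.

Let ρ Z : realization Z := sval (cid (realization_exists Z)).

Definition deligne_extension : linFun E A.
Proof.
refine (@LinFun R E A (fun Z => robj (ρ Z))
  (fun Z Z' f => mxhom (rimg (ρ Z)) (rimg (ρ Z')) (mxof (rdec (ρ Z)) (rdec (ρ Z')) f)) _ _ _).
- by move=> X; rewrite (mxof1 t_neq0) mxhom1.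
- move=> X Y Z g f; rewrite mxhomM; last by apply: mxof_compat.
  by rewrite -mxofM.
by move=> X Y a f g; rewrite (mxof_lin sch0 sch1 t_neq0) mxhom_lin.
Defined.

(** [B X Y] has its chosen decomposition and the one induced by decompositions of [X] and [Y]. The
    comparison is the matrix of its identity between the two, and naturality is the fact that [B]
    and [F] act by the same Kronecker products. *)
Lemma deligne_extension_exists :
  exists (G : linFun E A) (τ : forall X Y, hom (G (B X Y)) (F X Y)),
    [/\ right_exact G, forall X Y, is_iso (τ X Y)
      & forall X X' Y Y' (f : hom X X') (g : hom Y Y'),
          τ X' Y' ∘ fmap G (bmap B f g) = bmap F f g ∘ τ X Y].
Proof.
have decD (X : D) : exists x : {n : nat & {κ : 'I_n -> 'I_p & decomp s κ X}}, True.
  by have [n [κ [δ]]] := reps_decomp hD sR X; exists (existT _ n (existT _ κ δ)).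
have decD' (X : D') : exists x : {n : nat & {κ : 'I_n -> 'I_q & decomp s' κ X}}, True.
  by have [n [κ [δ]]] := reps_decomp hD' sR' X; exists (existT _ n (existT _ κ δ)).
pose δ X := projT2 (projT2 (sval (cid (decD X)))).
pose δ' X := projT2 (projT2 (sval (cid (decD' X)))).
pose β X Y := decomp_prod B (δ X) (δ' Y); pose φ X Y := decomp_prod F (δ X) (δ' Y).
exists deligne_extension, (fun X Y => mxhom (rimg (ρ (B X Y))) (φ X Y)
  (mxof (rdec (ρ (B X Y))) (β X Y) (idm (B X Y)))); split.
- exact: semisimple_right_exact hE sER.
- move=> X Y; exists (mxhom (φ X Y) (rimg (ρ (B X Y)))
    (mxof (β X Y) (rdec (ρ (B X Y))) (idm (B X Y)))).
  by split; rewrite mxhomM; try (by apply: mxof_compat); rewrite -mxofM // comp1m (mxof1 t_neq0) mxhom1.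
move=> X X' Y Y' f g /=; rewrite (bmap_mxhom hD hD' sR sR' (δ X) (δ' Y) (δ X') (δ' Y') F).
rewrite !mxhomM; try (by apply: mxof_compat).
by rewrite -bmap_mxof -!mxofM // comp1m compm1.
Qed.

End Extension.

Section Transformations.
Context (A : linCat R) (G G' : linFun E A).
Context (τ : forall X Y, hom (G (B X Y)) (G' (B X Y))).
Context (τ_nat : forall X X' Y Y' (f : hom X X') (g : hom Y Y'),
  τ X' Y' ∘ fmap G (bmap B f g) = fmap G' (bmap B f g) ∘ τ X Y).

Let τs (c : J) : hom (G (t c)) (G' (t c)) := τ (s c.1) (s' c.2).

(** Every morphism between the [t c] is a multiple of an identity or zero, so naturality costs
    nothing here and extends to direct sums. *)
Let τs_nat i j (f : hom (t i) (t j)) : τs j ∘ fmap G f = fmap G' f ∘ τs i.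
Proof.
rewrite (coefK sch0 sch1 t_neq0 f) !fmapZ compZl compZr; congr (_ *: _).
have [->|ij] := eqVneq i j; first by rewrite fam_id1 !fmap1 comp1m compm1.
by rewrite fam_id0 // !fmap0 comp0l comp0r.
Qed.

Let ext n (κ : 'I_n -> J) Z (δ : decomp t κ Z) : hom (G Z) (G' Z) :=
  \sum_a fmap G' (dinj δ a) ∘ τs (κ a) ∘ fmap G (dprj δ a).

Let ext_nat m n (κ : 'I_m -> J) (ν : 'I_n -> J) Y Z (δ : decomp t κ Y) (ε : decomp t ν Z)
    (f : hom Y Z) : ext ε ∘ fmap G f = fmap G' f ∘ ext δ.
Proof.
pose x b a := fmap G' (dinj ε b) ∘ τs (ν b) ∘ fmap G (dprj ε b ∘ f ∘ dinj δ a) ∘ fmap G (dprj δ a).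
transitivity (\sum_b \sum_a x b a).
  rewrite /ext comp_suml; apply: eq_bigr => b _; rewrite -[in LHS](compm1 f) -(decompS δ).
  rewrite comp_sumr fmap_sum comp_sumr; apply: eq_bigr => a _.
  by rewrite /x !fmapM !compA.
rewrite exchange_big /ext comp_sumr; apply: eq_bigr => a _.
rewrite -[in RHS](comp1m f) -(decompS ε) comp_suml fmap_sum comp_suml; apply: eq_bigr => b _.
by rewrite /x -[_ ∘ τs _ ∘ _]compA τs_nat !fmapM !compA.
Qed.

Let ext_prod m n (κ : 'I_m -> 'I_p) (κ' : 'I_n -> 'I_q) X Y
    (δ : decomp s κ X) (δ' : decomp s' κ' Y) : ext (decomp_prod B δ δ') = τ X Y.
Proof.
rewrite -[RHS]compm1 -fmap1 -(decompS (decomp_prod B δ δ')) fmap_sum comp_sumr.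
by apply: eq_bigr => a _; rewrite fmapM compA -τ_nat.
Qed.

Lemma transformation_exists : exists w : forall Z, hom (G Z) (G' Z),
  (forall Z Z' (f : hom Z Z'), w Z' ∘ fmap G f = fmap G' f ∘ w Z) /\
  (forall X Y, w (B X Y) = τ X Y).
Proof.
have dec Z : exists x : {n : nat & {κ : 'I_n -> J & decomp t κ Z}}, True.
  by have [n [κ [δ]]] := t_gen Z; exists (existT _ n (existT _ κ δ)).
pose δ Z := projT2 (projT2 (sval (cid (dec Z)))).
exists (fun Z => ext (δ Z)); split=> [Z Z' f|X Y]; first exact: ext_nat.
have [m [κ [ε]]] := reps_decomp hD sR X; have [n [κ' [ε']]] := reps_decomp hD' sR' Y.
rewrite -(ext_prod ε ε') -[LHS]compm1 -fmap1 (ext_nat (decomp_prod B ε ε')).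
by rewrite fmap1 comp1m.
Qed.

Lemma transformation_unique (w w' : forall Z, hom (G Z) (G' Z)) :
  (forall Z Z' (f : hom Z Z'), w Z' ∘ fmap G f = fmap G' f ∘ w Z) ->
  (forall X Y, w (B X Y) = τ X Y) ->
  (forall Z Z' (f : hom Z Z'), w' Z' ∘ fmap G f = fmap G' f ∘ w' Z) ->
  (forall X Y, w' (B X Y) = τ X Y) -> forall Z, w Z = w' Z.
Proof.
move=> w_nat wτ w'_nat w'τ Z; have [n [κ [δ]]] := t_gen Z.
rewrite -[w Z]compm1 -[w' Z]compm1 -fmap1 -(decompS δ) fmap_sum !comp_sumr.
apply: eq_bigr => a _; rewrite fmapM !compA w_nat w'_nat.
by congr (_ ∘ _ ∘ _); rewrite wτ w'τ.
Qed.

End Transformations.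

Lemma semisimple_deligne_product : is_deligne_product B.
Proof.
split.
- exact: semisimple_right_exact2 hD sR hD' sR'.
- by move=> A Aab F _; apply: deligne_extension_exists.
move=> A _ G G' _ _ τ τ_nat; split; first exact: transformation_exists.
by move=> w w' [w1 w2] [w1' w2']; apply: transformation_unique w1 w2 w1' w2'.
Qed.

End DeligneProduct.

(** * The decomposition *)

Section Interchange.
Context {R : realType} {C : braidCat R}.
Implicit Types U V W X Y Z : C.
Local Notation I := (unit_ob C).
Local Notation bat X Y Z := (mor_at (br X Y) Z).

(** The crossing of [Y] over [X'], written at the right end of a left-bracketed word. *)
Definition interchange X X' Y Y' : hom ((X ⊗ Y) ⊗ (X' ⊗ Y')) ((X ⊗ X') ⊗ (Y ⊗ Y')) :=
  ass (X ⊗ X') Y Y' ∘ (bat Y X' X ▷ Y') ∘ assV (X ⊗ Y) X' Y'.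

Lemma interchange_iso X X' Y Y' : is_iso (interchange X X' Y Y').
Proof.
rewrite /interchange mor_atE; apply: iso_comp (assV_iso _ _ _) _.
apply: iso_comp _ (ass_iso _ _ _); apply: bmap_is_iso (idm_iso _).
apply: iso_comp (ass_iso _ _ _) _; apply: iso_comp _ (assV_iso _ _ _).
exact: bmap_is_iso (idm_iso _) (br_iso _ _).
Qed.

Lemma interchange_nat X1 X2 X1' X2' Y1 Y2 Y1' Y2' (f : hom X1 X2) (f' : hom X1' X2')
    (g : hom Y1 Y2) (g' : hom Y1' Y2') :
  interchange X2 X2' Y2 Y2' ∘ ((f ⊛ g) ⊛ (f' ⊛ g')) =
  ((f ⊛ f') ⊛ (g ⊛ g')) ∘ interchange X1 X1' Y1 Y1'.
Proof.
have bat_nat : bat Y2 X2' X2 ∘ ((f ⊛ g) ⊛ f') = ((f ⊛ f') ⊛ g) ∘ bat Y1 X1' X1.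
  rewrite !mor_atE -compA ass_nat !compA; congr (_ ∘ _).
  by rewrite -compA -bmapM comp1m br_nat -[f in LHS]compm1 bmapM compA assV_nat -compA.
rewrite /interchange -compA assV_nat !compA; congr (_ ∘ _).
by rewrite -compA -bmapM comp1m bat_nat -[g' in LHS]compm1 bmapM compA ass_nat -compA.
Qed.

Lemma ass_bat X Y Z : ass Z Y X ∘ bat X Y Z = (Z ◁ br X Y) ∘ ass Z X Y.
Proof. by rewrite mor_atE !compA assKV comp1m. Qed.

Lemma lw_assV_ass W Z P Q : (W ◁ assV Z P Q) ∘ ass W Z (P ⊗ Q) =
  ass W (Z ⊗ P) Q ∘ (ass W Z P ▷ Q) ∘ assV (W ⊗ Z) P Q.
Proof.
rewrite -[LHS]compm1 -(assKV (W ⊗ Z) P Q) compA (c23 (pentagon W Z P Q)).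
by rewrite lw_assVK comp1m.
Qed.

Lemma mor_lw X Y P Q (φ : hom (X ⊗ Y) (P ⊗ Q)) W Z :
  (W ◁ mor_at φ Z) ∘ ass W (Z ⊗ X) Y ∘ (ass W Z X ▷ Y) =
  ass W (Z ⊗ P) Q ∘ (ass W Z P ▷ Q) ∘ mor_at φ (W ⊗ Z).
Proof.
rewrite !mor_atE !lwM (c32 (esym (pentagon W Z X Y))) (c22 (esym (ass_natr _ _ φ))).
by rewrite lw_assV_ass !compA.
Qed.

Lemma interchange_unitl X Y :
  (lun X ⊛ lun Y) ∘ interchange I X I Y ∘ (runV I ▷ (X ⊗ Y)) = lun (X ⊗ Y).
Proof.
rewrite /interchange !compA -tens_rl (c21 (triangle _ _)) -rwM -rwM -compA assV_natl compA.
rewrite -rwM -[lun X ∘ _ ∘ _]compA bat_unitl -compA -rwM runKV bmap1 compm1.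
by rewrite -lun_tens -compA assKV compm1.
Qed.

Lemma interchange_unitr X Y :
  (run X ⊛ run Y) ∘ interchange X I Y I ∘ ((X ⊗ Y) ◁ runV I) = run (X ⊗ Y).
Proof.
rewrite /interchange !compA -tens_rl (c21 (run_tens _ _)) (c22 (run_nat _)) bat_unitr.
rewrite run_unit -triangle compA (c21 (assKV _ _ _)) compm1.
by rewrite -compA -lwM lun_run_unit runKV lw1 compm1.
Qed.

(** Braiding the two products crosses [X] with [Y'] once; the interchange on the other side crosses
    them back. The hypothesis makes these two crossings cancel. *)
Lemma interchange_br X X' Y Y' : br Y' X ∘ br X Y' = idm (X ⊗ Y') ->
  (br X X' ⊛ br Y Y') ∘ interchange X X' Y Y' =
  interchange X' X Y' Y ∘ br (X ⊗ Y) (X' ⊗ Y').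
Proof.
move=> mono1; rewrite -[RHS]compm1 -(assKV (X ⊗ Y) X' Y') compA /interchange !compA; congr (_ ∘ _).
have hex1 W : br W (X' ⊗ Y') ∘ ass W X' Y' = bat W Y' X' ∘ (br W X' ▷ Y').
  by rewrite mor_atE -!compA [X in _ = _ ∘ X]compA -hexagon1 !compA assVK comp1m.
have hex2 : br (X ⊗ Y) X' = ass X' X Y ∘ (br X X' ▷ Y) ∘ bat Y X' X.
  by rewrite mor_atE !compA (c33 (esym (hexagon2 X Y X'))) (c21 (assVK _ _ _)) compm1 assKV comp1m.
have mono_at : (bat Y' X X' ▷ Y) ∘ (bat X Y' X' ▷ Y) = idm _.
  by rewrite -rwM -mor_atM mono1 mor_at1 bmap1.
rewrite -[RHS]compA hex1 [in RHS]hex2 !rwM !compA (c32 (esym (hex2_at X Y Y' X'))).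
by rewrite (c21 mono_at) compm1 ass_bat (c22 (ass_natl _ _ _)) tens_lr.
Qed.

Lemma interchange_ass X X' X'' Y Y' Y'' :
  (ass X X' X'' ⊛ ass Y Y' Y'') ∘ interchange (X ⊗ X') X'' (Y ⊗ Y') Y''
    ∘ (interchange X X' Y Y' ▷ (X'' ⊗ Y'')) =
  interchange X (X' ⊗ X'') Y (Y' ⊗ Y'') ∘ ((X ⊗ Y) ◁ interchange X' X'' Y' Y'')
    ∘ ass (X ⊗ Y) (X' ⊗ Y') (X'' ⊗ Y'').
Proof.
(* Precomposition with [n] makes both sides start from a left-bracketed word. They then reduce to
   the same three crossings, of [Y] with [X'] and of [Y] and [Y'] with [X'']. *)
pose n := (ass (X ⊗ Y) X' Y' ▷ (X'' ⊗ Y'')) ∘ ass (X ⊗ Y ⊗ X' ⊗ Y') X'' Y''.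
have n_iso : is_iso n.
  apply: iso_comp (ass_iso _ _ _) _; exact: bmap_is_iso (ass_iso _ _ _) (idm_iso _).
apply: (iso_rcancel n_iso).
transitivity ((ass X X' X'' ▷ (Y ⊗ (Y' ⊗ Y''))) ∘ ass (X ⊗ X' ⊗ X'') Y (Y' ⊗ Y'')
  ∘ ass (X ⊗ X' ⊗ X'' ⊗ Y) Y' Y'' ∘ (bat Y X'' (X ⊗ X') ▷ Y' ▷ Y'')
  ∘ (bat Y' X'' (X ⊗ X' ⊗ Y) ▷ Y'') ∘ (bat Y X' X ▷ Y' ▷ X'' ▷ Y'')).
  rewrite /interchange /n !rwM !compA.
  rewrite -[_ ∘ (assV (X ⊗ Y) X' Y' ▷ _) ∘ _]compA rw_assVK compm1.
  have hex2 Z : (bat (Y ⊗ Y') X'' Z ▷ Y'') ∘ (ass Z Y Y' ▷ X'' ▷ Y'') =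
      (ass (Z ⊗ X'') Y Y' ▷ Y'') ∘ (bat Y X'' Z ▷ Y' ▷ Y'') ∘ (bat Y' X'' (Z ⊗ Y) ▷ Y'').
    by rewrite -!rwM -compA hex2_at !compA assKV comp1m.
  rewrite (c22 (esym (ass_natl _ _ _))) (c22 (esym (ass_natl _ _ _))) (c21 (assVK _ _ _)) compm1.
  by rewrite (c23 (hex2 _)) -tens_rl (c32 (esym (pentagon _ _ _ _))).
have hex1 : (bat Y (X' ⊗ X'') X ▷ Y' ▷ Y'') ∘ (ass (X ⊗ Y) X' X'' ▷ Y' ▷ Y'') =
    (ass X X' X'' ▷ Y ▷ Y' ▷ Y'') ∘ (bat Y X'' (X ⊗ X') ▷ Y' ▷ Y'')
      ∘ (bat Y X' X ▷ X'' ▷ Y' ▷ Y'').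
  by rewrite -!rwM -[_ ∘ _ ∘ (bat Y X' X ▷ _)]compA hex1_at !compA rw_assKV comp1m.
have lw : (((X ⊗ Y) ◁ bat Y' X'' X') ▷ Y'') ∘ (ass (X ⊗ Y) (X' ⊗ Y') X'' ▷ Y'')
      ∘ (ass (X ⊗ Y) X' Y' ▷ X'' ▷ Y'') =
    (ass (X ⊗ Y) (X' ⊗ X'') Y' ▷ Y'') ∘ (ass (X ⊗ Y) X' X'' ▷ Y' ▷ Y'')
      ∘ (bat Y' X'' (X ⊗ Y ⊗ X') ▷ Y'').
  by rewrite -!rwM mor_lw.
rewrite /interchange /n !lwM !compA (c22 (esym (ass_natl _ _ _))) (c23 (lw_assV_ass _ _ _ _)).
rewrite (c21 (assVK _ _ _)) compm1 (c22 (esym (ass_natm _ _ _))) (c33 lw).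
rewrite (c32 (esym (pentagon _ _ _ _))) (c21 (assVK _ _ _)) compm1.
rewrite (c22 (esym (ass_natl _ _ _))) (c23 hex1) (c22 (ass_natl _ _ (ass X X' X'' ▷ Y))) ass_natl.
by rewrite -[RHS]compA -rwM -mor_nat rwM compA.
Qed.

End Interchange.

(** * Frobenius-Perron dimensions as loop values *)

Section Dimensions.
Context {R : realType} (C : modularCat R).
Notation K := (R[i]%C).
Let fus : is_fusion C := braidfus_fusion C.
Let hC := fusion_fss fus.
Let rib := twist_ribbon C.
Local Notation θ := (@twist R C).
Context (r : nat) (s : 'I_r -> C) (sR : simple_reps s).
Context (D : modular_datum K r).
Context (Dh : forall k j, mdh D k j = encircle θ (s k) (s j)).
Context (j0 : 'I_r) (h_gt0 : forall i, 0 < mdh D j0 i).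

(** The loop value at [j0] lies in [R[i]] whereas [FPdim] lies in [R]; by [fpdE] nothing is lost by
    taking the real part. *)
Definition fpd (X : C) : R := complex.Re (encircle θ (s j0) X).

Let encD : additive_fun (encircle θ (s j0)) := encircle_dsum rib (reps_simple sR j0).

Lemma fpdE X : encircle θ (s j0) X = (fpd X)%:C%C.
Proof.
have : 0 <= encircle θ (s j0) X.
  rewrite (additive_mult hC sR X encD) sumr_ge0 // => k _.
  by rewrite mulrn_wge0 // -Dh ltW.
by rewrite /fpd; case: encircle => a b; rewrite lecE /= => /andP[/eqP-> _].
Qed.

Lemma fpdD : additive_fun fpd.
Proof. by move=> n F X FX; rewrite /fpd (encD FX) raddf_sum. Qed.

Lemma fpdM X Y : fpd (X ⊗ Y) = fpd X * fpd Y.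
Proof.
apply: complexI; rewrite rmorphM /= -!fpdE.
by rewrite (encircle_tens rib) //; apply: reps_simple sR j0.
Qed.

Lemma fpd_gt0 X : simple X -> 0 < fpd X.
Proof.
move=> Xs; have [_ /(_ _ Xs)[k Xk] _] := sR.
by rewrite -ltcR -fpdE (additive_iso encD Xk) -Dh.
Qed.

Context (C_integral : integral_cat C).

Lemma integral_dimension : exists dim : 'I_r -> nat,
  [/\ forall k, (0 < dim k)%N, forall k, mdh D j0 k = (dim k)%:R
    & forall k, fpd (s k) = (dim k)%:R].
Proof.
have dimP k : exists n : nat, fpd (s k) = n%:R.
  have sk := reps_simple sR k; have := C_integral sk.
  rewrite (FPdim_ob_dm fus fpd_gt0 fpdD fpdM) => /intrP[z zE].
  have : 0 <= fpd (s k) by rewrite ltW ?fpd_gt0.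
  by rewrite zE ler0z; case: z zE => // n zE _; exists n.
have [dim dE] := choice dimP; exists dim; split=> // k.
  by rewrite -(ltr0n R) -dE fpd_gt0 //; apply: reps_simple sR k.
by rewrite Dh fpdE dE rmorph_nat.
Qed.

End Dimensions.

Section InvertibleObjects.
Context {R : realType} (C : modularCat R).
Notation K := (R[i]%C).
Let fus : is_fusion C := braidfus_fusion C.
Let hC := fusion_fss fus.
Local Notation θ := (@twist R C).
Context (r : nat) (s : 'I_r -> C) (sR : simple_reps s).
Context (D : modular_datum K r) (so : isomorphic (unit_ob C) (s (md0 D))).
Context (DN : forall i j l, mdN D i j l = fusN s i j l).
Context (Dh : forall k j, mdh D k j = encircle θ (s k) (s j)).
Context (j0 : 'I_r) (dim : 'I_r -> nat) (dim_gt0 : forall i, (0 < dim i)%N).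
Context (dimE : forall i, mdh D j0 i = (dim i)%:R).
Context (fpd_dim : forall k, fpd s j0 (s k) = (dim k)%:R).
Local Notation o := (md0 D).
Local Notation N := (mdN D).
Local Notation h := (mdh D).
Local Notation G := (inv_group D).

Let h_gt0 i : 0 < h j0 i. Proof. by rewrite dimE ltr0n. Qed.

Let dim_unit : dim o = 1%N.
Proof. by have := inv_dim dim_gt0 dimE (group1 G); rewrite perm1. Qed.

Lemma iso_inv_tens σ k : σ \in G -> isomorphic (s (σ o) ⊗ s k) (s (σ k)).
Proof.
move=> Gσ; apply: (iso_reps_mult hC sR) => l.
by rewrite -/(fusN s (σ o) k l) -DN (inv_fusion dim_gt0 dimE).
Qed.

Lemma FPdim_sub (P : C -> Prop) (P1 : P (unit_ob C)) (PM : forall X Y, P X -> P Y -> P (X ⊗ Y)) :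
  fusion_sub P -> FPdim (full_sub P1 PM) = (\sum_(k | `[< P (s k) >]) dim k ^ 2)%N%:R.
Proof.
move=> subP; rewrite (FPdim_full_sub fus subP _ _ (fpd_gt0 sR Dh h_gt0) _ _ sR).
- by rewrite natr_sum; apply: eq_bigr => k _; rewrite fpd_dim natrX.
- exact: fpdD.
by move=> X Y; rewrite (fpdM sR Dh h_gt0).
Qed.

Lemma invertible_inv_group σ : σ \in G -> invertible (s (σ o)).
Proof.
move=> Gσ; exists (s ((σ^-1)%g o)); split.
  apply: isomorphic_trans (iso_inv_tens _ Gσ) _.
  by rewrite permKV; apply: isomorphic_sym.
apply: isomorphic_trans (iso_inv_tens _ (groupVr Gσ)) _.
by rewrite permK; apply: isomorphic_sym.
Qed.

(** The dimensions of an object and of its inverse are natural numbers with product 1. *)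
Lemma invertible_dim k : invertible (s k) <-> dim k = 1%N.
Proof.
split=> [[Y [kY _]]|/(inv_exists dim_gt0 dimE)[σ Gσ <-]]; last exact: invertible_inv_group.
have : fpd s j0 (s k) * fpd s j0 Y = 1.
  rewrite -(fpdM sR Dh h_gt0) (additive_iso (fpdD sR j0) kY).
  by rewrite (additive_iso (fpdD sR j0) so) fpd_dim dim_unit.
rewrite (additive_mult hC sR Y (fpdD sR j0)).
under eq_bigr do rewrite fpd_dim -mulrnA.
rewrite -natr_sum fpd_dim -natrM => /eqP; rewrite pnatr_eq1 muln_eq1.
by case/andP=> /eqP.
Qed.

Lemma dim_dual i : dim (mdual D i) = dim i.
Proof. by apply/eqP; rewrite -(eqr_nat K) -!dimE md_conj dimE conjC_nat. Qed.

(** [pt_ob] quantifies over all fusion subcategories that contain the invertible objects; it is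
    tested on the one spanned by the simple objects of dimension 1. *)
Lemma pt_ob_dim k : pt_ob (s k) <-> dim k = 1%N.
Proof.
split=> [ptk|dk]; last first.
  by move=> P _; apply; [apply: reps_simple sR k | apply/invertible_dim].
pose J := [pred k | dim k == 1%N].
have subJ : fusion_sub (supported s J).
  apply: (supported_fusion_sub sR so DN) => [|i j l|i]; rewrite ?inE /=.
  - by rewrite dim_unit.
  - move=> /eqP/(inv_exists dim_gt0 dimE)[σ Gσ <-] dj; rewrite (inv_fusion dim_gt0 dimE) //.
    by have [-> _|//] := eqVneq l (σ j); rewrite (dim_perm dim_gt0 dimE).
  by rewrite dim_dual.
apply/eqP; apply/(supported_reps sR J k); apply: (ptk _ subJ) => Y Ys Yinv.
have [_ /(_ _ Ys)[l Yl] _] := sR; have : invertible (s l).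
  have [Z [YZ ZY]] := Yinv; exists Z; split.
    apply: isomorphic_trans YZ; apply: isomorphic_tens (isomorphic_sym Yl) (isomorphic_refl _).
  by apply: isomorphic_trans ZY; apply: isomorphic_tens (isomorphic_refl _) (isomorphic_sym Yl).
move=> /invertible_dim dl i iJ; rewrite (mult_iso hC _ _ Yl) (mult_reps hC sR).
by have [il|//] := eqVneq i l; rewrite inE il dl in iJ.
Qed.

Lemma FPdim_pointed_part : FPdim (pointed_part C) = #|G|%:R.
Proof.
rewrite FPdim_sub; last exact: fusion_sub_pt_ob.
rewrite (inv_card dim_gt0 dimE) -sum1_card; congr (_%:R).
rewrite (eq_bigl [pred k | dim k == 1%N]) => [|k]; last first.
  by apply/asboolP/eqP => /pt_ob_dim.
by apply: eq_bigr => k /eqP->.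
Qed.

Lemma monodromy_inv σ k : σ \in G -> monodromy (s (σ o)) (s k) = chi D k σ *: idm _.
Proof.
move=> Gσ.
have [|c [-> + _]] := @monodromy_simple R C r s sR o so (σ o) k (σ k).
  by move=> l; rewrite -DN (inv_fusion dim_gt0 dimE).
rewrite -!Dh (invP Gσ o k) /chi => e; congr (_ *: _).
have k0 := md_dim_neq0 D k; have s0 := md_dim_neq0 D (σ o).
by apply: (mulIf s0); rewrite divfK //; apply: (mulfI k0); rewrite e; ring.
Qed.

End InvertibleObjects.

Section TrivialMonodromy.
Context {R : realType} {C : braidFusCat R} {r : nat} (s : 'I_r -> C).

Lemma monodromy_decompr V n (κ : 'I_n -> 'I_r) X : decomp s κ X ->
  (forall a, monodromy V (s (κ a)) = idm _) -> monodromy V X = idm _.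
Proof.
move=> δ mono1; rewrite -[LHS]compm1 -[RHS]lw1 -bmap1 -(decompS δ) !bmap_sumr comp_sumr.
by apply: eq_bigr => a _; rewrite lwM compA monodromy_natr mono1 compm1.
Qed.

Lemma monodromy_decompl V n (κ : 'I_n -> 'I_r) X : decomp s κ X ->
  (forall a, monodromy (s (κ a)) V = idm _) -> monodromy X V = idm _.
Proof.
move=> δ mono1; rewrite -[LHS]compm1 -[RHS]bmap1 -bmap1 -(decompS δ) !bmap_suml comp_sumr.
by apply: eq_bigr => a _; rewrite rwM compA monodromy_natl mono1 compm1.
Qed.

End TrivialMonodromy.

(** * The two factors and their product *)

Section Factors.
Context {R : realType} (C : modularCat R).
Notation K := (R[i]%C).
Let fus : is_fusion C := braidfus_fusion C.
Let hC := fusion_fss fus.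
Let rib := twist_ribbon C.
Local Notation θ := (@twist R C).
Context (r : nat) (s : 'I_r -> C) (sR : simple_reps s).
Context (D : modular_datum K r) (so : isomorphic (unit_ob C) (s (md0 D))).
Context (DN : forall i j l, mdN D i j l = fusN s i j l).
Context (Dh : forall k j, mdh D k j = encircle θ (s k) (s j)).
Context (j0 : 'I_r) (dim : 'I_r -> nat) (dim_gt0 : forall i, (0 < dim i)%N).
Context (dimE : forall i, mdh D j0 i = (dim i)%:R).
Context (fpd_dim : forall k, fpd s j0 (s k) = (dim k)%:R).
Context (d m : nat) (gdimE : gdim dim = (d * m)%N).
Context (d_gt0 : (0 < d)%N) (d_sqf : squarefree d) (d_cop : coprime d m).
Local Notation o := (md0 D).
Local Notation N := (mdN D).
Local Notation h := (mdh D).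
Local Notation G := (inv_group D).
Local Notation A := (dtor dim_gt0 dimE d).
Local Notation Q := (centralizer D A).
Let AG σ : σ \in A -> σ \in G := @dtorP _ _ D j0 dim dim_gt0 dimE d σ.

Definition dtor_idx : pred 'I_r := [pred k | [exists σ in A, σ o == k]].

Lemma dtor_idxP k : reflect (exists2 σ, σ \in A & k = σ o) (k \in dtor_idx).
Proof.
apply: (iffP exists_inP) => -[σ Aσ]; first by move/eqP=> <-; exists σ.
by move=> ->; exists σ.
Qed.

Lemma supported_decomp J n (κ : 'I_n -> 'I_r) X a :
  supported s J X -> decomp s κ X -> κ a \in J.
Proof.
move=> XJ δ; apply: contraT => /XJ; rewrite (mult_decomp hC sR _ δ) (bigD1 a) //= eqxx.
by [].
Qed.

Lemma monodromy_trivial X Y :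
  supported s dtor_idx X -> supported s Q Y -> monodromy X Y = idm (X ⊗ Y).
Proof.
move=> XA YQ; have [n [κ [δ]]] := reps_decomp hC sR X; have [l [μ [ε]]] := reps_decomp hC sR Y.
apply: (monodromy_decompl δ) => a; apply: (monodromy_decompr ε) => b.
have /dtor_idxP[σ Aσ ->] := supported_decomp a XA δ.
rewrite (monodromy_inv sR so DN Dh dim_gt0 dimE) ?AG //.
by have /centralizerP-> := supported_decomp b YQ ε; rewrite ?scale1r.
Qed.

Lemma dtor_fusion_sub : fusion_sub (supported s dtor_idx).
Proof.
apply: (supported_fusion_sub sR so DN).
- by apply/dtor_idxP; exists 1%g; rewrite ?group1 // perm1.
- move=> i j k /dtor_idxP[σ Aσ ->] /dtor_idxP[τ Aτ ->].
  rewrite (inv_fusion dim_gt0 dimE) ?AG //; have [-> _|//] := eqVneq k (σ (τ o)).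
  by apply/dtor_idxP; exists (τ * σ)%g; rewrite ?groupM // permM.
move=> i /dtor_idxP[σ Aσ ->]; apply/dtor_idxP; exists (σ^-1)%g; first by rewrite groupV.
exact: dtor_dual Aσ.
Qed.

(** The double braiding of [V] with the product of [s i] and [s j] is trivial. By naturality along a
    nonzero [f] from [s k], the scalar of [V] on [s k] is 1 unless [V ◁ f] vanishes; but then the
    identity of the simple object [V ⊗ s k] would vanish too. *)
Lemma centralizer_fusion i j k : i \in Q -> j \in Q -> N i j k != 0%N -> k \in Q.
Proof.
move=> iQ jQ; rewrite DN => Nk; apply/centralizerP => σ Aσ.
have Gσ := AG Aσ; pose V := s (σ o).
have [f f0] : exists f : hom (s k) (s i ⊗ s j), f <> 0.
  by apply: contrapT => /forallNP H; case/eqP: Nk; apply/(mult_eq0 hC s) => f; apply: contrapT.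
have mono1 l : l \in Q -> monodromy V (s l) = idm _.
  move=> /centralizerP lQ.
  by rewrite (monodromy_inv sR so DN Dh dim_gt0 dimE) // lQ // scale1r.
have mono_tens : monodromy V (s i ⊗ s j) = idm _.
  apply: (iso_rcancel (ass_iso V (s i) (s j))).
  apply: (iso_lcancel (assV_iso V (s i) (s j))); rewrite compA monodromy_tens mono1 //.
  rewrite lw1 compm1 assVK compm1 -rwM -/(monodromy V (s i)) mono1 //.
  by rewrite bmap1 comp1m assVK.
have := monodromy_natr V f; rewrite mono_tens comp1m.
rewrite (monodromy_inv sR so DN Dh dim_gt0 dimE) // compZr compm1 => /eqP.
rewrite -subr_eq0 -[X in X - _]scale1r -scalerBl scaler_eq0 subr_eq0 => /orP[/eqP//|/eqP Vf0].
(* The composite of [f] with its generalized inverse is a scalar fixing the nonzero [f], so [f] is a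
   split monomorphism. *)
have [g fgf] := fusion_ginv hC sR f; have [c gf] := reps_hom1 hC sR (g ∘ f).
have /eqP : c *: f = f by rewrite -{2}fgf -compA gf compZr compm1.
rewrite -subr_eq0 -[X in _ - X]scale1r -scalerBl scaler_eq0 subr_eq0 => /orP[/eqP c1|/eqP//].
have [V0 _] : simple (V ⊗ s k).
  apply: isomorphic_simple (isomorphic_sym (iso_inv_tens sR DN dim_gt0 dimE k Gσ)) _.
  exact: reps_simple.
by case: V0; rewrite -lw1 -[idm (s k)]scale1r -c1 -gf lwM Vf0 comp0r.
Qed.

Lemma centralizer_fusion_sub : fusion_sub (supported s Q).
Proof.
apply: (supported_fusion_sub sR so DN); last exact: centralizer_dual.
  by apply/centralizerP => σ Aσ; rewrite /chi divff // md_dim_neq0.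
exact: centralizer_fusion.
Qed.

Let S_entry k l : S_matrix θ s k l = h o k * h k l * ribbon_trace θ (idm (s o)).
Proof.
rewrite mxE (rtrace_monodromy rib); last exact: reps_simple sR k.
by rewrite (rdim_encircle sR so) -!Dh mulrA [h k l * _]mulrC.
Qed.

Let S_sum (v : 'I_r -> K) l : \sum_k v k * S_matrix θ s k l = 0 ->
  \sum_k v k * (h o k * h k l) = 0.
Proof.
under eq_bigr do rewrite S_entry mulrA; rewrite -mulr_suml => /eqP.
by rewrite mulf_eq0 (negPf (rdim_neq0 sR o)) orbF => /eqP.
Qed.

Lemma dtor_nondeg (v : 'I_r -> K) : (forall k, v k != 0 -> supported s dtor_idx (s k)) ->
  (forall l, supported s dtor_idx (s l) -> \sum_k v k * S_matrix θ s k l = 0) ->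
  forall k, v k = 0.
Proof.
move=> vA vS; apply: (@dtor_S_inj _ _ D _ _ dim_gt0 dimE _ _ gdimE d_sqf d_cop) => [k /vA|σ Aσ].
  by move/(supported_reps sR)/dtor_idxP.
by apply/S_sum/vS/(supported_reps sR)/dtor_idxP; exists σ.
Qed.

Lemma centralizer_nondeg (v : 'I_r -> K) : (forall k, v k != 0 -> supported s Q (s k)) ->
  (forall l, supported s Q (s l) -> \sum_k v k * S_matrix θ s k l = 0) ->
  forall k, v k = 0.
Proof.
move=> vQ vS; apply: (@centralizer_S_inj _ _ D _ _ dim_gt0 dimE _ _ gdimE d_sqf d_cop) => [k /vQ|l lQ].
  by move/(supported_reps sR).
by apply/S_sum/vS/(supported_reps sR).
Qed.

Definition dtor_cat : modularCat R := modular_sub dtor_fusion_sub sR dtor_nondeg.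

Definition centralizer_cat : modularCat R :=
  modular_sub centralizer_fusion_sub sR centralizer_nondeg.

Lemma FPdim_dtor : FPdim dtor_cat = d%:R.
Proof.
rewrite (FPdim_sub sR Dh dim_gt0 dimE fpd_dim _ _ dtor_fusion_sub); congr (_%:R).
rewrite -(dtor_card dim_gt0 dimE gdimE d_gt0 d_sqf d_cop).
have o_inj : {in A &, injective (fun σ : {perm 'I_r} => σ o)}.
  by move=> σ τ Aσ Aτ; apply: (inv_inj dim_gt0 dimE); apply: AG.
rewrite -(card_in_imset o_inj) -sum1_card; apply: eq_big => k.
  apply/asboolP/imsetP => [/(supported_reps sR)/dtor_idxP //|[σ Aσ ->]].
  by apply/(supported_reps sR)/dtor_idxP; exists σ.
move=> /asboolP/(supported_reps sR)/dtor_idxP[σ Aσ ->].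
by rewrite (inv_dim dim_gt0 dimE) ?AG.
Qed.

Lemma FPdim_centralizer : FPdim centralizer_cat = m%:R.
Proof.
rewrite (FPdim_sub sR Dh dim_gt0 dimE fpd_dim _ _ centralizer_fusion_sub).
congr (_%:R); rewrite -(centralizer_gdim dim_gt0 dimE gdimE d_gt0 d_sqf d_cop); apply: eq_bigl => k.
by apply/asboolP/idP => /(supported_reps sR).
Qed.

Lemma dtor_pointed : pointed_cat dtor_cat.
Proof.
move=> X /(full_sub_simple fus dtor_fusion_sub) Xs.
have [_ /(_ _ Xs)[k Xk] _] := sR.
have /dtor_idxP[σ Aσ kσ] : k \in dtor_idx.
  apply/(supported_reps sR) => l lA.
  by rewrite -(mult_iso hC _ _ Xk); apply: (svalP X).
have Pσ : supported s dtor_idx (s ((σ^-1)%g o)).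
  by apply/(supported_reps sR)/dtor_idxP; exists (σ^-1)%g; rewrite ?groupV.
rewrite kσ in Xk; have Gσ := AG Aσ.
have := invertible_inv_group sR so DN dim_gt0 dimE Gσ.
have XY : isomorphic (sval X ⊗ s ((σ^-1)%g o)) (unit_ob C).
  apply: isomorphic_trans (isomorphic_tens Xk (isomorphic_refl _)) _.
  apply: isomorphic_trans (iso_inv_tens sR DN dim_gt0 dimE _ Gσ) _.
  by rewrite permKV; apply: isomorphic_sym.
by exists (exist _ _ Pσ); split; last exact: isomorphic_trans (isomorphic_br _ _) XY.
Qed.

Definition factor_bifun : bifun dtor_cat centralizer_cat C :=
  @Bifun R dtor_cat centralizer_cat C (fun X Y => sval X ⊗ sval Y) 
    (fun X X' Y Y' => @bmap _ _ _ _ (tens C) (sval X) (sval X') (sval Y) (sval Y'))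
    (fun X Y => bmap1 (tens C) (sval X) (sval Y))
    (fun _ _ _ _ _ _ => @bmapM _ _ _ _ (tens C) _ _ _ _ _ _)
    (fun _ _ _ _ => @bmap_linl _ _ _ _ (tens C) _ _ _ _)
    (fun _ _ _ _ => @bmap_linr _ _ _ _ (tens C) _ _ _ _).

Lemma factor_bifunctor : braided_bifunctor (B := factor_bifun)
  (fun X X' Y Y' => interchange (sval X) (sval X') (sval Y) (sval Y')) (runV (unit_ob C)).
Proof.
split.
- by move=> X X' Y Y'; apply: interchange_iso.
- by exists (run (unit_ob C)); split; [apply: runKV | apply: runVK].
- move=> X1 X2 X1' X2' Y1 Y2 Y1' Y2' f f' g g'.
  exact: (@interchange_nat R C _ _ _ _ _ _ _ _ f f' g g').
- by move=> X X' X'' Y Y' Y''; apply: interchange_ass.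
- by move=> X Y; apply: interchange_unitl.
- by move=> X Y; apply: interchange_unitr.
by move=> X X' Y Y'; apply: interchange_br; apply: monodromy_trivial (svalP X) (svalP Y').
Qed.

(** By unique factorization the products of simple objects of the two factors represent every simple
    object of [C] exactly once, which is what the criterion [semisimple_deligne_product] asks
    for. *)
Lemma factor_deligne_product : is_deligne_product factor_bifun.
Proof.
pose u := @full_sub_reps R C _ (fsub_unit dtor_fusion_sub) (fsub_tens dtor_fusion_sub) r s.
pose u' := @full_sub_reps R C _ (fsub_unit centralizer_fusion_sub)
  (fsub_tens centralizer_fusion_sub) r s.
have uR : simple_reps u :=
  full_sub_repsP fus dtor_fusion_sub (fsub_unit _) (fsub_tens _) sR.
have uR' : simple_reps u' :=
  full_sub_repsP fus centralizer_fusion_sub (fsub_unit _) (fsub_tens _) sR.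
pose t := prod_fam (D := dtor_cat) (D' := centralizer_cat) u u' factor_bifun.
have tP c : exists σ k, [/\ σ \in A, k \in Q, enum_val c.1 = σ o & enum_val c.2 = k]
    /\ isomorphic (t c) (s (σ k)).
  have := enum_valP c.1; rewrite inE => /asboolP/(supported_reps sR)/dtor_idxP[σ Aσ e1].
  have := enum_valP c.2; rewrite inE => /asboolP/(supported_reps sR) e2.
  exists σ, (enum_val c.2); split=> //; rewrite /t /prod_fam /= e1.
  exact: (iso_inv_tens sR DN dim_gt0 dimE _ (AG Aσ)).
have t_simple c : simple (t c).
  have [σ [k [_ tk]]] := tP c; apply: isomorphic_simple (isomorphic_sym tk) _.
  exact: reps_simple.
have t_inj c c' : isomorphic (t c) (t c') -> c = c'.
  have [σ [k [[Aσ kQ e1 e2] tk]]] := tP c; have [τ [l [[Aτ lQ e1' e2'] tl]]] := tP c'.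
  move=> cc'; have [_ _ sI] := sR; 
  have [|] := dtor_centralizer_inj gdimE d_sqf d_cop Aσ Aτ kQ lQ _.
    apply: sI; apply: isomorphic_trans tl; apply: isomorphic_trans cc'.
    exact: isomorphic_sym.
  move=> στ kl; case: c c' e1 e2 e1' e2' {tk tl cc'} => a b [a' b'] /= e1 e2 e1' e2'.
  by congr (_, _); apply: enum_val_inj; rewrite ?e1 ?e1' ?e2 ?e2' ?στ ?kl.
have t_surj j : exists c, isomorphic (s j) (t c).
  have [σ [k [Aσ kQ ->]]] := dtor_centralizer_surj dim_gt0 dimE gdimE d_sqf d_cop j.
  have a1 : σ o \in [pred k | `[< supported s dtor_idx (s k) >]].
    by rewrite inE; apply/asboolP/(supported_reps sR)/dtor_idxP; exists σ.
  have a2 : k \in [pred k | `[< supported s Q (s k) >]].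
    by rewrite inE; apply/asboolP/(supported_reps sR).
  exists (enum_rank_in a1 (σ o), enum_rank_in a2 k); apply: isomorphic_sym.
  rewrite /t /prod_fam /= !enum_rankK_in //; exact: (iso_inv_tens sR DN dim_gt0 dimE _ (AG Aσ)).
apply: (semisimple_deligne_product (fusion_fss (braidfus_fusion dtor_cat))
  (fusion_fss (braidfus_fusion centralizer_cat)) hC uR uR' sR).
- move=> i j f ij; apply: contrapT => f0; case/eqP: ij; apply: t_inj; exists f.
  by apply: (schur_iso (fusion_abelian fus)).
- by move=> i f; apply: endo_scal.
- by move=> i; case: (t_simple i).
move=> Z; have [n [κ [δ]]] := reps_decomp hC sR Z; have [ψ ψP] := choice t_surj.
exists n, (ψ \o κ); apply: dsum_decomp; apply: dsum_iso (decomp_dsum δ) => a.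
exact: ψP.
Qed.

End Factors.

Section IdentityEquivalence.
Context {R : realType} (C : braidCat R).

Definition identity_fun : linFun C C :=
  @LinFun R C C (fun X => X) (fun _ _ f => f) (fun _ => erefl) (fun _ _ _ _ _ => erefl)
    (fun _ _ _ _ _ => erefl).

Lemma braided_equiv_refl : braided_equiv C C.
Proof.
exists identity_fun, (fun X Y => idm (X ⊗ Y)), (idm (unit_ob C)); split.
  split=> [X Y||X X' Y Y' f g|X Y Z|X|X|X Y] /=.
  - exact: idm_iso.
  - exact: idm_iso.
  - by rewrite comp1m compm1.
  - by rewrite !bmap1 !compm1 comp1m.
  - by rewrite bmap1 !compm1.
  - by rewrite bmap1 !compm1.
  by rewrite comp1m compm1.
exists identity_fun, (fun X => idm X), (fun X => idm X); split=> /=.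
- by move=> X; apply: idm_iso.
- by move=> X X' f; rewrite comp1m compm1.
- by move=> X; apply: idm_iso.
by move=> X X' f; rewrite comp1m compm1.
Qed.

End IdentityEquivalence.

Theorem corollary1p22 (R : realType) (C : modularCat R) (d m : nat)
    (C_integral : integral_cat C)
    (C_dim : FPdim C = (d * m)%N%:R)
    (d_gt0 : (0 < d)%N) (d_sqf : squarefree d) (d_coprime : coprime d m) :
  (exists k : nat, FPdim (pointed_part C) = (d * k)%N%:R) /\
  (exists (D D' : modularCat R) (E : braidFusCat R),
     [/\ is_braided_deligne_product D D' E,
         braided_equiv C E,
         pointed_cat D,
         FPdim D = d%:R
       & FPdim D' = m%:R]).
Proof.
have fus : is_fusion C := braidfus_fusion C.
have [r [s sR]] := fusion_finite fus.
have [o so] := unit_reps sR.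
have [D [D0 DN Dh _]] := modular_datum_exists sR so; rewrite -D0 in so.
have [j0 h_gt0] := positive_character D.
have [dim [dim_gt0 dimE fpd_dim]] := integral_dimension sR Dh h_gt0 C_integral.
have gdimE : gdim dim = (d * m)%N.
  apply/eqP; rewrite -(eqr_nat R) -C_dim /gdim natr_sum; apply/eqP.
  rewrite (FPdim_dm fus (fpd_gt0 sR Dh h_gt0) (fpdD sR j0) (fpdM sR Dh h_gt0) sR).
  by apply: eq_bigr => k _; rewrite fpd_dim natrX.
split.
  have /dvdnP[k Gk] := d_dvd_inv dim_gt0 dimE gdimE d_gt0 d_sqf d_coprime.
  by exists k; rewrite (FPdim_pointed_part sR so DN Dh dim_gt0 dimE fpd_dim) Gk mulnC.
(* The product category is [C] itself, with its own tensor product as universal functor, so the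
   equivalence is the identity. *)
exists (dtor_cat sR so DN Dh dim_gt0 dimE gdimE d_sqf d_coprime),
  (centralizer_cat sR so DN Dh dim_gt0 dimE gdimE d_sqf d_coprime), C; split.
- eexists _, _, _; split; first exact: factor_deligne_product.
  exact: factor_bifunctor.
- exact: braided_equiv_refl.
- exact: dtor_pointed.
- exact: (FPdim_dtor sR so DN Dh dim_gt0 dimE fpd_dim gdimE d_gt0 d_sqf d_coprime).
exact: (FPdim_centralizer sR so DN Dh dim_gt0 dimE fpd_dim gdimE d_gt0 d_sqf d_coprime).
Qed.
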